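(* Let $C_2$ be a projective primitive double curve with associated reduced curve $C$, write $\mathcal{O}_2=\mathcal{O}_{C_2}$, and let $P\in C$ be a closed point. 1. A finitely generated $\mathcal{O}_{2,P}$-module is reflexive if and only if it is torsion free. 2. A coherent sheaf on $C_2$ is reflexive if and only if it is torsion free.
   Context: Everything is over $\mathbb{C}$. A projective primitive double curve $C_2$ with reduced curve $C$: $C$ is a smooth irreducible projective curve in a smooth connected threefold $X$, $C_2\subset X$ is a closed Cohen–Macaulay subscheme with $(C_2)_{red}=C$ such that near each closed point $P\in C$ it is contained in a surface smooth at $P$, and its multiplicity is $2$: the ideal sheaf $\mathcal{I}_C$ of $C$ in $C_2$ is nonzero, locally generated by one element $z$, and $\mathcal{I}_C^2=0$ (so $\mathcal{I}_C=L$ is a line bundle on $C$). A coherent sheaf on $C_2$ is torsion free if it has no nonzero subsheaf with zero-dimensional support; a finitely generated $\mathcal{O}_{2,P}$-module is torsion free if it has no nonzero submodule of finite length (equivalently, if $x\in\mathcal{O}_{2,P}$ lies over a generator of the maximal ideal of $\mathcal{O}_{C,P}$, multiplication by $x$ is injective). Duals: $M^\vee=\mathrm{Hom}_{\mathcal{O}_{2,P}}(M,\mathcal{O}_{2,P})$ for a module $M$, $\mathcal{E}^\vee=\mathcal{H}om_{\mathcal{O}_2}(\mathcal{E},\mathcal{O}_2)$ for a sheaf $\mathcal{E}$. $M$ (resp. $\mathcal{E}$) is reflexive if the canonical morphism $M\to M^{\vee\vee}$ (resp. $\mathcal{E}\to\mathcal{E}^{\vee\vee}$) is an isomorphism. 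*)

(* Defs.v *)
From HB Require Import structures.
From mathcomp Require Import all_boot all_order all_algebra.
From mathcomp Require Import generic_quotient complex.
From mathcomp Require Import mathcomp_extra boolp classical_sets functions reals.
From mathcomp Require Import topology.

Set Implicit Arguments.
Unset Strict Implicit.
Unset Printing Implicit Defensive.

Import GRing.Theory.
Local Open Scope classical_set_scope.
Local Open Scope ring_scope.
Local Open Scope quotient_scope.

Section Rings.
Variable A : comPzRingType.
Implicit Types (I : set A) (a b c : A).

Definition is_unit a := exists b, a * b = 1.

Definition local_ring :=
  (1 : A) <> 0 /\ forall a b, ~ is_unit a -> ~ is_unit b -> ~ is_unit (a + b).

Definition max_ideal : set A := [set a | ~ is_unit a].

Definition is_ideal I :=
  [/\ I 0, forall a b, I a -> I b -> I (a + b) & forall a b, I b -> I (a * b)].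

Definition prime_ideal I :=
  [/\ is_ideal I, ~ I 1 & forall a b, I (a * b) -> I a \/ I b].

Definition ideal_gen n (x : 'I_n -> A) : set A :=
  [set a | exists c : 'I_n -> A, a = \sum_i c i * x i].

Definition noetherian :=
  forall I, is_ideal I -> exists n (x : 'I_n -> A), I = ideal_gen x.

Definition prime_chain n (p : 'I_n.+1 -> set A) :=
  (forall i, prime_ideal (p i)) /\
  (forall i j : 'I_n.+1, (i < j)%N -> p i `<` p j).

Definition krull_dim n :=
  (exists p : 'I_n.+1 -> set A, prime_chain p) /\
  (forall m (p : 'I_m.+1 -> set A), prime_chain p -> (m <= n)%N).

Definition regular_local n :=
  [/\ local_ring, noetherian, krull_dim n &
      exists x : 'I_n -> A, max_ideal = ideal_gen x].

Definition regular_sequence n (x : 'I_n -> A) :=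
  forall (i : 'I_n) a,
    (exists c : 'I_n -> A, x i * a = \sum_(j < n | (j < i)%N) c j * x j) ->
    exists c : 'I_n -> A, a = \sum_(j < n | (j < i)%N) c j * x j.

Definition cohen_macaulay_local :=
  [/\ local_ring, noetherian &
      exists n (x : 'I_n -> A),
        [/\ krull_dim n, forall i, max_ideal (x i) & regular_sequence x]].

End Rings.

(* g exhibits B as the localization A[1/f]. *)
Definition localization_away (A B : comPzRingType) (f : A) (g : A -> B) :=
  [/\ is_unit (g f),
      forall b, exists e a, g f ^+ e * b = g a &
      forall a, g a = 0 -> exists e, f ^+ e * a = 0].

Definition fg_algebra (k A : comPzRingType) (s : k -> A) :=
  exists n (x : 'I_n -> A), forall S : set A,
    (forall c, S (s c)) -> (forall i, S (x i)) ->
    (forall a b, S a -> S b -> S (a + b)) ->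
    (forall a b, S a -> S b -> S (a * b)) -> forall a, S a.

(* A is the polynomial k-algebra on the family (x i) for i != i0. *)
Definition polynomial_algebra (k A : comPzRingType) (s : {rmorphism k -> A})
    n (i0 : 'I_n) (x : 'I_n -> A) :=
  forall (B : comPzRingType) (t : {rmorphism k -> B}) (y : 'I_n -> B),
    exists2 h : {rmorphism A -> B},
      (forall c, h (s c) = t c) /\ (forall i, i != i0 -> h (x i) = y i) &
      forall h' : {rmorphism A -> B},
        (forall c, h' (s c) = t c) -> (forall i, i != i0 -> h' (x i) = y i) ->
        h' =1 h.

Definition fg_module (A : comPzRingType) (M : lmodType A) :=
  exists n (x : 'I_n -> M), forall m, exists c : 'I_n -> A,
    m = \sum_i c i *: x i.

Section Submodules.
Variables (A : comPzRingType) (M : lmodType A).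
Implicit Type N : set M.

Definition is_submodule N :=
  [/\ N 0, forall m n, N m -> N n -> N (m + n) &
      forall (a : A) m, N m -> N (a *: m)].

Definition finite_length N :=
  exists l : nat, forall n (c : 'I_n.+1 -> set M),
    (forall i, is_submodule (c i) /\ c i `<=` N) ->
    (forall i j : 'I_n.+1, (i < j)%N -> c i `<` c j) -> (n <= l)%N.

Definition torsion_free_module :=
  forall N, is_submodule N -> finite_length N -> forall m, N m -> m = 0.

End Submodules.

Definition dual (A : comPzRingType) (M : lmodType A) : Type :=
  {linear M -> A^o}.
HB.instance Definition _ (A : comPzRingType) (M : lmodType A) :=
  gen_eqMixin (dual M).
HB.instance Definition _ (A : comPzRingType) (M : lmodType A) :=
  gen_choiceMixin (dual M).

Definition dual_apply (A : comPzRingType) (M : lmodType A) (f : dual M) :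
  M -> A := (f : {linear M -> A^o}).

Section DualModule.
Variables (A : comPzRingType) (M : lmodType A).
Implicit Types f g h : dual M.

Lemma dualP f g : dual_apply f =1 dual_apply g -> f = g.
Proof.
case: f g => f [[f1] [f2]] [g [[g1] [g2]]]; rewrite /dual_apply /= => /funext fg.
case: _ / fg g1 g2 => g1 g2.
by rewrite (Prop_irrelevance f1 g1) (Prop_irrelevance f2 g2).
Qed.

Lemma dual_linear f a m n :
  dual_apply f (a *: m + n) = a * dual_apply f m + dual_apply f n.
Proof. exact: (@linearP _ _ _ _ (f : {linear M -> A^o})). Qed.

Lemma mk_dual_subproof (f : M -> A) :
  (forall (a : A) m n, f (a *: m + n) = a * f m + f n) ->
  linear (f : M -> A^o).
Proof. by move=> fP a m n; rewrite fP. Qed.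

Definition mk_dual (f : M -> A)
    (fP : forall a m n, f (a *: m + n) = a * f m + f n) : dual M :=
  HB.pack_for {linear M -> A^o} (f : M -> A^o)
    (GRing.isLinear.Build A M A^o *:%R f (mk_dual_subproof fP)).

Lemma dual0_subproof a (m n : M) : 0 = a * 0 + 0 :> A.
Proof. by rewrite mulr0 addr0. Qed.
Definition dual0 : dual M := mk_dual dual0_subproof.

Lemma dualD_subproof f g a m n :
  dual_apply f (a *: m + n) + dual_apply g (a *: m + n) =
  a * (dual_apply f m + dual_apply g m) + (dual_apply f n + dual_apply g n).
Proof. by rewrite !dual_linear mulrDr addrACA. Qed.
Definition dualD f g : dual M := mk_dual (dualD_subproof f g).

Lemma dualZ_subproof b f a m n :
  b * dual_apply f (a *: m + n) =
  a * (b * dual_apply f m) + b * dual_apply f n.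
Proof. by rewrite dual_linear mulrDr mulrCA. Qed.
Definition dualZ b f : dual M := mk_dual (dualZ_subproof b f).

Definition dualN f : dual M := dualZ (- 1) f.

Lemma dualA : associative dualD.
Proof. by move=> f g h; apply: dualP => m; rewrite /dual_apply /= addrA. Qed.
Lemma dualC : commutative dualD.
Proof. by move=> f g; apply: dualP => m; rewrite /dual_apply /= addrC. Qed.
Lemma dual0D : left_id dual0 dualD.
Proof. by move=> f; apply: dualP => m; rewrite /dual_apply /= add0r. Qed.
Lemma dualND : left_inverse dual0 dualN dualD.
Proof.
by move=> f; apply: dualP => m; rewrite /dual_apply /= mulN1r addNr.
Qed.

HB.instance Definition _ :=
  GRing.isZmodule.Build (dual M) dualA dualC dual0D dualND.

Lemma dualZA a b f : dualZ a (dualZ b f) = dualZ (a * b) f.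
Proof. by apply: dualP => m; rewrite /dual_apply /= mulrA. Qed.
Lemma dualZ1 : left_id 1 dualZ.
Proof. by move=> f; apply: dualP => m; rewrite /dual_apply /= mul1r. Qed.
Lemma dualZDr : right_distributive dualZ +%R.
Proof. by move=> a f g; apply: dualP => m; rewrite /dual_apply /= mulrDr. Qed.
Lemma dualZDl f : {morph dualZ^~ f : a b / a + b}.
Proof. by move=> a b; apply: dualP => m; rewrite /dual_apply /= mulrDl. Qed.

HB.instance Definition _ :=
  GRing.Zmodule_isLmodule.Build A (dual M) dualZA dualZ1 dualZDr dualZDl.

End DualModule.

Section Biduality.
Variables (A : comPzRingType) (M : lmodType A).

Lemma biduality_subproof (m : M) a (f g : dual M) :
  dual_apply (a *: f + g) m = a * dual_apply f m + dual_apply g m.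
Proof. by []. Qed.

Definition biduality (m : M) : dual (dual M) :=
  mk_dual (M := dual M) (f := fun f => dual_apply f m) (biduality_subproof m).

Definition reflexive_module := bijective biduality.

End Biduality.

Record opens (T : topologicalType) := Opens {
  open_set :> T -> Prop;
  open_setP : open (open_set : set T) }.

Definition openI (T : topologicalType) (U V : opens T) : opens T :=
  Opens (openI (open_setP U) (open_setP V)).

Lemma openI_subl (T : topologicalType) (U V : opens T) : openI U V `<=` U.
Proof. exact: subIsetl. Qed.

Lemma openI_subr (T : topologicalType) (U V : opens T) : openI U V `<=` V.
Proof. exact: subIsetr. Qed.

Definition openT (T : topologicalType) : opens T := Opens (@openT T).

Definition covers (T : topologicalType) (I : Type) (V : I -> opens T)
    (U : opens T) :=
  forall x, U x -> exists i, V i x.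

(* The structure morphism to Spec k is recorded by the maps scalar U, which make
   each O(U) a k-algebra. *)
Record ringed_space (k : fieldType) := RingedSpace {
  space :> topologicalType;
  sect : opens space -> comPzRingType;
  res : forall U V : opens space, V `<=` U -> {rmorphism sect U -> sect V};
  res_id : forall (U : opens space) (UU : U `<=` U) s, res UU s = s;
  res_comp : forall (U V W : opens space) (VU : V `<=` U) (WV : W `<=` V)
    (WU : W `<=` U) s, res WV (res VU s) = res WU s;
  sect_ext : forall (U : opens space) (I : Type) (V : I -> opens space)
    (VU : forall i, V i `<=` U), covers V U ->
    forall s t, (forall i, res (VU i) s = res (VU i) t) -> s = t;
  sect_glue : forall (U : opens space) (I : Type) (V : I -> opens space)
    (VU : forall i, V i `<=` U), covers V U ->
    forall s : forall i, sect (V i),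
    (forall i j (W : opens space) (Wi : W `<=` V i) (Wj : W `<=` V j),
      res Wi (s i) = res Wj (s j)) ->
    exists t, forall i, res (VU i) t = s i;
  scalar : forall U : opens space, {rmorphism k -> sect U};
  scalar_res : forall (U V : opens space) (VU : V `<=` U) c,
    res VU (scalar U c) = scalar V c }.

Arguments sect {k} X U : rename.
Arguments res {k X U V} VU : rename.
Arguments scalar {k} X U : rename.
Arguments sect_ext {k X U I V} VU _ s t _ : rename.
Arguments sect_glue {k X U I V} VU _ s _ : rename.

Section Stalk.
Variables (k : fieldType) (X : ringed_space k) (x : X).

Record pregerm := Pregerm {
  pg_open : opens X;
  pg_in : pg_open x;
  pg_sect : sect X pg_open }.

HB.instance Definition _ := gen_eqMixin pregerm.
HB.instance Definition _ := gen_choiceMixin pregerm.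

Definition pg_equiv (s t : pregerm) :=
  exists (W : opens X) (Ws : W `<=` pg_open s) (Wt : W `<=` pg_open t),
    W x /\ res Ws (pg_sect s) = res Wt (pg_sect t).

Lemma res_irr (U V : opens X) (VU VU' : V `<=` U) (s : sect X U) :
  res VU s = res VU' s.
Proof. by rewrite (Prop_irrelevance VU VU'). Qed.

Lemma pg_equiv_equiv : equiv_class_of (fun s t => `[< pg_equiv s t >]).
Proof.
split=> [s|s t|t s u].
- by apply/asboolP; exists (pg_open s), (fun y h => h), (fun y h => h); split;
    first exact: pg_in.
- by apply/asboolP/asboolP => -[W [Ws [Wt [Wx e]]]]; exists W, Wt, Ws.
- move=> /asboolP [W [Ws [Wt [Wx e]]]] /asboolP [W' [Wt' [Wu [Wx' e']]]].
  apply/asboolP; exists (openI W W').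
  exists (fun y h => Ws y (proj1 h)), (fun y h => Wu y (proj2 h)); split=> //.
  pose WW : openI W W' `<=` W := fun y h => proj1 h.
  pose WW' : openI W W' `<=` W' := fun y h => proj2 h.
  rewrite -(res_comp Ws WW) -(res_comp Wu WW') e -e'.
  pose WWt : openI W W' `<=` pg_open t := fun y h => Wt y (proj1 h).
  by rewrite (res_comp _ _ WWt) (res_comp _ _ WWt).
Qed.

Canonical pg_equiv_rel := EquivRelPack pg_equiv_equiv.

Definition stalk := {eq_quot pg_equiv_rel}.
HB.instance Definition _ := Choice.on stalk.

Definition germ (U : opens X) (Ux : U x) (s : sect X U) : stalk :=
  \pi_({eq_quot pg_equiv_rel}) (Pregerm Ux s).

Lemma germ_eqP (U V : opens X) (Ux : U x) (Vx : V x) s t :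
  germ Ux s = germ Vx t <->
  exists (W : opens X) (WU : W `<=` U) (WV : W `<=` V),
    W x /\ res WU s = res WV t.
Proof.
split=> [/eqP|h]; first by rewrite eqmodE => /asboolP.
by apply/eqP; rewrite eqmodE; apply/asboolP.
Qed.

Lemma germ_res (U V : opens X) (VU : V `<=` U) (Ux : U x) (Vx : V x) s :
  germ Vx (res VU s) = germ Ux s.
Proof.
apply/germ_eqP; exists V, (fun y h => h), VU; split=> //.
by rewrite res_id.
Qed.

Lemma germ_surj (a : stalk) : exists (U : opens X) (Ux : U x) s, a = germ Ux s.
Proof.
elim/quotW: a => -[U Ux s]; by exists U, Ux, s.
Qed.

Lemma germ_surj2 (a b : stalk) : exists (U : opens X) (Ux : U x) s t,
  a = germ Ux s /\ b = germ Ux t.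
Proof.
have [U [Ux [s ->]]] := germ_surj a; have [V [Vx [t ->]]] := germ_surj b.
pose iU : openI U V `<=` U := fun y h => proj1 h.
pose iV : openI U V `<=` V := fun y h => proj2 h.
have UVx : openI U V x by [].
by exists (openI U V), UVx, (res iU s), (res iV t); rewrite !germ_res.
Qed.

Lemma germ_surj3 (a b c : stalk) : exists (U : opens X) (Ux : U x) s t u,
  [/\ a = germ Ux s, b = germ Ux t & c = germ Ux u].
Proof.
have [U [Ux [s [t [-> ->]]]]] := germ_surj2 a b.
have [V [Vx [u ->]]] := germ_surj c.
pose iU : openI U V `<=` U := fun y h => proj1 h.
pose iV : openI U V `<=` V := fun y h => proj2 h.
have UVx : openI U V x by [].
exists (openI U V), UVx, (res iU s), (res iU t), (res iV u).
by rewrite !germ_res.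
Qed.

Definition stalk_op2 (op : forall U, sect X U -> sect X U -> sect X U)
    (a b : stalk) : stalk :=
  let s := repr a in let t := repr b in
  let W := openI (pg_open s) (pg_open t) in
  germ (U := W) (conj (pg_in s) (pg_in t))
    (op W (res (@openI_subl _ _ _) (pg_sect s))
          (res (@openI_subr _ _ _) (pg_sect t))).

Lemma germ_op2 (op : forall U, sect X U -> sect X U -> sect X U) :
  (forall (U V : opens X) (VU : V `<=` U) s t,
     res VU (op U s t) = op V (res VU s) (res VU t)) ->
  forall (U : opens X) (Ux : U x) s t,
  stalk_op2 op (germ Ux s) (germ Ux t) = germ Ux (op U s t).
Proof.
move=> opP U Ux s t; rewrite /stalk_op2.
have := esym (reprK (germ Ux s)); have := esym (reprK (germ Ux t)).
case: (repr (germ Ux s)) => V Vx s'; case: (repr (germ Ux t)) => V' Vx' t' /=.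
move=> /germ_eqP [W' [W'U [W'V [W'x e']]]].
move=> /germ_eqP [W [WU [WV [Wx e]]]].
apply/germ_eqP; exists (openI W W').
exists (fun y h => conj (WV y (proj1 h)) (W'V y (proj2 h))), (fun y h => WU y (proj1 h)).
split=> //; rewrite !opP.
pose WW : openI W W' `<=` W := fun y h => proj1 h.
pose WW' : openI W W' `<=` W' := fun y h => proj2 h.
pose WWU : openI W W' `<=` U := fun y h => WU y (proj1 h).
pose WWV : openI W W' `<=` V := fun y h => WV y (proj1 h).
pose WWV' : openI W W' `<=` V' := fun y h => W'V y (proj2 h).
congr (op _ _ _).
  by rewrite (res_comp _ _ WWV) -(res_comp WV WW) -e (res_comp _ _ WWU).
by rewrite (res_comp _ _ WWV') -(res_comp W'V WW') -e' (res_comp _ _ WWU).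
Qed.

Definition stalk_cst (c : forall U, sect X U) : stalk :=
  germ (U := openT X) I (c _).

Lemma germ_cst (c : forall U, sect X U) :
  (forall (U V : opens X) (VU : V `<=` U), res VU (c U) = c V) ->
  forall (U : opens X) (Ux : U x), stalk_cst c = germ Ux (c U).
Proof.
move=> cP U Ux; apply/germ_eqP; exists U, (fun _ _ => I), (fun y h => h).
by rewrite !cP.
Qed.

Definition stalk0 := stalk_cst (fun U => 0).
Definition stalk1 := stalk_cst (fun U => 1).
Definition stalkD := stalk_op2 (fun U s t => s + t).
Definition stalkM := stalk_op2 (fun U s t => s * t).
Definition stalkN a := stalk_op2 (fun U s _ => - s) a a.

Lemma germ0 (U : opens X) (Ux : U x) : stalk0 = germ Ux 0.
Proof. by apply: germ_cst => V W VW; rewrite rmorph0. Qed.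
Lemma germ1 (U : opens X) (Ux : U x) : stalk1 = germ Ux 1.
Proof. by apply: germ_cst => V W VW; rewrite rmorph1. Qed.
Lemma germD (U : opens X) (Ux : U x) s t :
  stalkD (germ Ux s) (germ Ux t) = germ Ux (s + t).
Proof. by apply: germ_op2 => V W VW u v; rewrite rmorphD. Qed.
Lemma germM (U : opens X) (Ux : U x) s t :
  stalkM (germ Ux s) (germ Ux t) = germ Ux (s * t).
Proof. by apply: germ_op2 => V W VW u v; rewrite rmorphM. Qed.
Lemma germN (U : opens X) (Ux : U x) s : stalkN (germ Ux s) = germ Ux (- s).
Proof. by apply: germ_op2 => V W VW u v; rewrite rmorphN. Qed.

Lemma stalkDA : associative stalkD.
Proof.
move=> a b c; have [U [Ux [s [t [u [-> -> ->]]]]]] := germ_surj3 a b c.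
by rewrite !germD addrA.
Qed.
Lemma stalkDC : commutative stalkD.
Proof.
move=> a b; have [U [Ux [s [t [-> ->]]]]] := germ_surj2 a b.
by rewrite !germD addrC.
Qed.
Lemma stalk0D : left_id stalk0 stalkD.
Proof.
move=> a; have [U [Ux [s ->]]] := germ_surj a.
by rewrite (germ0 Ux) germD add0r.
Qed.
Lemma stalkND : left_inverse stalk0 stalkN stalkD.
Proof.
move=> a; have [U [Ux [s ->]]] := germ_surj a.
by rewrite (germ0 Ux) germN germD addNr.
Qed.
HB.instance Definition _ :=
  GRing.isZmodule.Build stalk stalkDA stalkDC stalk0D stalkND.

Lemma stalkMA : associative stalkM.
Proof.
move=> a b c; have [U [Ux [s [t [u [-> -> ->]]]]]] := germ_surj3 a b c.
by rewrite !germM mulrA.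
Qed.
Lemma stalkMC : commutative stalkM.
Proof.
move=> a b; have [U [Ux [s [t [-> ->]]]]] := germ_surj2 a b.
by rewrite !germM mulrC.
Qed.
Lemma stalk1M : left_id stalk1 stalkM.
Proof.
move=> a; have [U [Ux [s ->]]] := germ_surj a.
by rewrite (germ1 Ux) germM mul1r.
Qed.
Lemma stalkMD : left_distributive stalkM stalkD.
Proof.
move=> a b c; have [U [Ux [s [t [u [-> -> ->]]]]]] := germ_surj3 a b c.
by rewrite !(germM, germD) mulrDl.
Qed.
HB.instance Definition _ :=
  GRing.Zmodule_isComPzRing.Build stalk stalkMA stalkMC stalk1M stalkMD.

Section Germ.
Variables (U : opens X) (Ux : U x).

Lemma germ_is_zmod_morphism : zmod_morphism (germ Ux).
Proof. by move=> s t; rewrite -germD -germN. Qed.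
Lemma germ_is_monoid_morphism : monoid_morphism (germ Ux).
Proof. by split=> [|s t]; [rewrite -(germ1 Ux) | rewrite -germM]. Qed.
HB.instance Definition _ :=
  GRing.isZmodMorphism.Build (sect X U) stalk (germ Ux) germ_is_zmod_morphism.
HB.instance Definition _ :=
  GRing.isMonoidMorphism.Build (sect X U) stalk (germ Ux)
    germ_is_monoid_morphism.
End Germ.

End Stalk.

Arguments stalk {k} X x : rename.
Arguments germ {k X x U} Ux s : rename.

Section Affine.
Variables (k : fieldType) (X : ringed_space k).

Definition nonvanishing (U : opens X) (f : sect X U) : set X :=
  [set x | exists Ux : U x, is_unit (germ Ux f)].

Lemma nonvanishing_open (U : opens X) (f : sect X U) : open (nonvanishing f).
Proof.
rewrite openE => x [Ux [b fb]].
have [V [Vx [t bt]]] := germ_surj b.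
pose UV := openI U V.
pose iU : UV `<=` U := fun y h => proj1 h.
pose iV : UV `<=` V := fun y h => proj2 h.
have UVx : UV x by [].
move: fb; rewrite bt -(germ_res iU Ux UVx) -(germ_res iV Vx UVx) -rmorphM.
rewrite -(rmorph1 (germ UVx)) => /germ_eqP [W [WU [WU' [Wx e]]]].
rewrite /interior nbhsE; exists (W : set X); first by split=> //; exact: open_setP.
move=> y Wy; have UVy := WU y Wy; exists UVy.1, (germ UVy.2 t).
rewrite -(germ_res iU UVy.1 UVy) -(germ_res iV UVy.2 UVy) -rmorphM.
by rewrite /= -(germ_res WU UVy Wy) e germ_res rmorph1.
Qed.

(* The basic open set D(f). *)
Definition basic (U : opens X) (f : sect X U) : opens X :=
  Opens (nonvanishing_open f).

Lemma basic_sub (U : opens X) (f : sect X U) : basic f `<=` U.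
Proof. by move=> x []. Qed.

Definition vanishing_ideal (U : opens X) x (Ux : U x) : set (sect X U) :=
  [set f | ~ is_unit (germ Ux f)].

(* (U, O_X|_U) is Spec A for A = O_X(U): points are the prime ideals of A, the
   D(f) are a basis of the topology, and O_X(D(f)) = A[1/f]. *)
Definition affine (U : opens X) :=
  [/\ forall p, prime_ideal p <->
        exists x (Ux : U x), p = vanishing_ideal Ux,
      forall x y (Ux : U x) (Uy : U y),
        vanishing_ideal Ux = vanishing_ideal Uy -> x = y,
      forall (V : opens X) x, V `<=` U -> V x ->
        exists f : sect X U, basic f x /\ basic f `<=` V &
      forall f : sect X U,
        localization_away f (res (@basic_sub U f))].

End Affine.

Record scheme (k : fieldType) := Scheme {
  scheme_space :> ringed_space k;
  locally_ringed : forall x : scheme_space, local_ring (stalk scheme_space x);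
  affine_nbhd : forall x : scheme_space,
    exists2 U : opens scheme_space, U x & affine U }.

Section Schemes.
Variable k : fieldType.
Implicit Types X Y Z : scheme k.

Definition closed_point X (x : X) := closed [set x].

Definition finite_type X :=
  exists n (U : 'I_n -> opens X), covers U (openT X) /\
    forall i, affine (U i) /\ fg_algebra (scalar X (U i)).

(* The diagonal X -> X x X is a closed immersion, tested on the affine opens
   U x V of X x X. *)
Definition separated X :=
  forall U V : opens X, affine U -> affine V ->
    affine (openI U V) /\
    forall (s : sect X (openI U V)),
      exists n (a : 'I_n -> sect X U) (b : 'I_n -> sect X V),
        s = \sum_i res (@openI_subl _ U V) (a i) * res (@openI_subr _ U V) (b i).

Definition reduced X :=
  forall (U : opens X) (s : sect X U) n, s ^+ n = 0 -> s = 0.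

(* k is meant to be algebraically closed of characteristic 0, so that
   smoothness is regularity of the local rings at closed points. *)
Definition smooth_at X (x : X) n := regular_local (stalk X x) n.

Definition smooth X n := forall x : X, closed_point x -> smooth_at x n.

Definition cohen_macaulay X := forall x : X, cohen_macaulay_local (stalk X x).

End Schemes.

Definition irreducible (T : topologicalType) (S : set T) :=
  S !=set0 /\ forall F G : set T, closed F -> closed G ->
    S `<=` F `|` G -> S `<=` F \/ S `<=` G.

(* Krull dimension at most 0 of the subspace S. *)
Definition zero_dimensional (T : topologicalType) (S : set T) :=
  forall F G : set T, closed F -> closed G ->
    irreducible (S `&` F) -> irreducible (S `&` G) ->
    S `&` F `<=` S `&` G -> S `&` F = S `&` G.

Definition preim_open (S T : topologicalType) (f : S -> T) (fc : continuous f)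
    (U : opens T) : opens S :=
  Opens (open_comp (fun x _ => fc x) (open_setP U)).

Record morphism (k : fieldType) (X Y : scheme k) := Morphism {
  mor_fun :> X -> Y;
  mor_cont : continuous mor_fun;
  pull : forall U : opens Y,
    {rmorphism sect Y U -> sect X (preim_open mor_cont U)};
  pull_res : forall (U V : opens Y) (VU : V `<=` U)
    (VU' : preim_open mor_cont V `<=` preim_open mor_cont U) s,
    res VU' (pull U s) = pull V (res VU s);
  pull_scalar : forall U c, pull U (scalar Y U c) = scalar X _ c;
  pull_local : forall (U : opens Y) x (Ux : U (mor_fun x)) (s : sect Y U),
    is_unit (germ (U := preim_open mor_cont U) (x := x) Ux (pull U s)) ->
    is_unit (germ Ux s) }.

Definition preim (k : fieldType) (X Y : scheme k) (f : morphism X Y)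
  (U : opens Y) : opens X := preim_open (@mor_cont k X Y f) U.

Arguments pull {k X Y} f U : rename.

Section Subschemes.
Variables (k : fieldType).

(* Over V, f is affine and surjective on sections over affine opens, i.e.
   locally Spec A/I -> Spec A. *)
Definition closed_immersion_over (X Y : scheme k) (f : morphism X Y)
    (V : opens Y) :=
  forall U : opens Y, U `<=` V -> affine U ->
    affine (preim f U) /\ forall t, exists s, pull f U s = t.

Definition closed_immersion (X Y : scheme k) (f : morphism X Y) :=
  closed_immersion_over f (openT Y).

Definition closed_immersion_in (X Y : scheme k) (f : morphism X Y)
    (V : opens Y) :=
  (forall x, V (f x)) /\ closed_immersion_over f V.

Definition ideal_sheaf (X Y : scheme k) (f : morphism X Y) (U : opens Y) :
  set (sect Y U) := [set s | pull f U s = 0].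
Arguments ideal_sheaf {X Y} f U _.

(* P^n glued from its charts U_i = Spec k[X_0/X_i, ..., X_n/X_i], with
   x i j = X_j/X_i. *)
Definition is_projective_space n (P : scheme k) :=
  exists (U : 'I_n.+1 -> opens P) (x : forall i, 'I_n.+1 -> sect P (U i)),
    [/\ covers U (openT P) /\ (forall i, affine (U i)),
        forall i, x i i = 1 /\ polynomial_algebra (scalar P (U i)) i (x i),
        forall i j, U i `&` U j = basic (x i j) &
        forall i j l (W : opens P) (Wi : W `<=` U i) (Wj : W `<=` U j),
          res Wi (x i l) = res Wi (x i j) * res Wj (x j l)].

Definition projective (X : scheme k) :=
  exists n (P : scheme k) (f : morphism X P),
    is_projective_space n P /\ closed_immersion f.

Definition smooth_projective_curve (C : scheme k) :=
  [/\ projective C, irreducible [set: C] & smooth C 1].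

Definition smooth_connected_threefold (X : scheme k) :=
  [/\ finite_type X, separated X, connected [set: X] & smooth X 3].

(* Near p, the closed subscheme i : Y -> X lies in a surface S, closed in an
   open neighbourhood V of p and smooth at p; containment of closed subschemes
   of V is reverse containment of ideal sheaves. *)
Definition locally_in_smooth_surface (X Y : scheme k) (i : morphism Y X)
    (p : X) :=
  exists (V : opens X) (S : scheme k) (s : morphism S X),
    [/\ V p, closed_immersion_in s V,
        (exists2 q : S, s q = p & smooth_at q 2) &
        forall U : opens X, U `<=` V ->
          ideal_sheaf s U `<=` ideal_sheaf i U].

Record projective_primitive_double_curve (X C2 C : scheme k)
    (i : morphism C2 X) (j : morphism C C2) : Prop := {
  ambient_threefold : smooth_connected_threefold X;
  double_closed : closed_immersion i;
  double_cohen_macaulay : cohen_macaulay C2;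
  (* C = (C2)_red: same points, reduced structure *)
  curve_closed : closed_immersion j;
  curve_same_points : forall x : C2, exists y : C, j y = x;
  curve_reduced : reduced C;
  curve_smooth : smooth_projective_curve C;
  double_in_surface : forall p : C, closed_point p ->
    locally_in_smooth_surface i (i (j p));
  ideal_nonzero : exists (U : opens C2) s, ideal_sheaf j U s /\ s <> 0;
  ideal_principal : forall p : C2, exists (U : opens C2) (z : sect C2 U),
    [/\ U p, ideal_sheaf j U z &
        forall (V : opens C2) (VU : V `<=` U) t, ideal_sheaf j V t ->
        forall q, V q -> exists (W : opens C2) (WV : W `<=` V)
          (WU : W `<=` U) (a : sect C2 W),
          W q /\ res WV t = a * res WU z];
  ideal_square0 : forall (U : opens C2) s t,
    ideal_sheaf j U s -> ideal_sheaf j U t -> s * t = 0 }.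

End Subschemes.

Record sheaf_of_modules (k : fieldType) (X : ringed_space k) := SheafOfModules {
  msect : forall U : opens X, lmodType (sect X U);
  mres : forall U V : opens X, V `<=` U -> msect U -> msect V;
  mres_lin : forall (U V : opens X) (VU : V `<=` U) (a : sect X U) m n,
    mres VU (a *: m + n) = res VU a *: mres VU m + mres VU n;
  mres_id : forall (U : opens X) (UU : U `<=` U) m, mres UU m = m;
  mres_comp : forall (U V W : opens X) (VU : V `<=` U) (WV : W `<=` V)
    (WU : W `<=` U) m, mres WV (mres VU m) = mres WU m;
  msect_ext : forall (U : opens X) (I : Type) (V : I -> opens X)
    (VU : forall i, V i `<=` U), covers V U ->
    forall m n, (forall i, mres (VU i) m = mres (VU i) n) -> m = n;
  msect_glue : forall (U : opens X) (I : Type) (V : I -> opens X)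
    (VU : forall i, V i `<=` U), covers V U ->
    forall m : forall i, msect (V i),
    (forall i j (W : opens X) (Wi : W `<=` V i) (Wj : W `<=` V j),
      mres Wi (m i) = mres Wj (m j)) ->
    exists n, forall i, mres (VU i) n = m i }.

Arguments msect {k X} E U : rename.
Arguments mres {k X} E {U V} VU : rename.
Arguments msect_ext {k X} E {U I V} VU _ m n _ : rename.
Arguments msect_glue {k X} E {U I V} VU _ m _ : rename.

Section Modules.
Variables (k : fieldType) (X : ringed_space k).
Implicit Type E : sheaf_of_modules X.

(* E|_U is the sheaf associated with the O_X(U)-module E(U). *)
Definition associated_on E (U : opens X) :=
  forall f : sect X U,
    (forall n : msect E (basic f), exists e m,
       res (@basic_sub _ _ _ f) f ^+ e *: n = mres E (@basic_sub _ _ _ f) m) /\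
    (forall m : msect E U, mres E (@basic_sub _ _ _ f) m = 0 ->
       exists e, f ^+ e *: m = 0).

Definition coherent E :=
  forall x : X, exists U : opens X,
    [/\ U x, affine U, fg_module (msect E U) & associated_on E U].

Record subsheaf E := Subsheaf {
  sub_sect :> forall U : opens X, set (msect E U);
  sub_submodule : forall U : opens X, is_submodule (@sub_sect U);
  sub_res : forall (U V : opens X) (VU : V `<=` U) m,
    @sub_sect U m -> @sub_sect V (mres E VU m);
  sub_local : forall (U : opens X) (m : msect E U),
    (forall x, U x -> exists (V : opens X) (VU : V `<=` U),
       V x /\ @sub_sect V (mres E VU m)) -> @sub_sect U m }.

(* Points where the stalk of F is nonzero. *)
Definition support E (F : subsheaf E) : set X :=
  [set x | exists (U : opens X) (m : msect E U), [/\ U x, F U m &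
    forall (V : opens X) (VU : V `<=` U), V x -> mres E VU m <> 0]].

(* All O_X-submodules F are allowed; on a noetherian scheme, with E coherent,
   testing coherent ones gives the same notion. *)
Definition torsion_free_sheaf E :=
  forall F : subsheaf E, zero_dimensional (support F) ->
    forall U m, F U m -> m = 0.

End Modules.

(* A section over U of Hom(E, O_X): a morphism E|_U -> O_X|_U. *)
Record local_form (k : fieldType) (X : ringed_space k)
    (E : sheaf_of_modules X) (U : opens X) := LocalForm {
  lform : forall V : opens X, V `<=` U -> msect E V -> sect X V;
  lform_lin : forall (V : opens X) (VU : V `<=` U) (a : sect X V) m n,
    lform VU (a *: m + n) = a * lform VU m + lform VU n;
  lform_res : forall (V W : opens X) (VU : V `<=` U) (WU : W `<=` U)
    (WV : W `<=` V) m, res WV (lform VU m) = lform WU (mres E WV m) }.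

HB.instance Definition _ (k : fieldType) (X : ringed_space k)
  (E : sheaf_of_modules X) (U : opens X) := gen_eqMixin (local_form E U).
HB.instance Definition _ (k : fieldType) (X : ringed_space k)
  (E : sheaf_of_modules X) (U : opens X) := gen_choiceMixin (local_form E U).

Section LocalForms.
Variables (k : fieldType) (X : ringed_space k) (E : sheaf_of_modules X).

Lemma lform_eq (U : opens X) (f g : local_form E U) :
  (forall (V : opens X) (VU : V `<=` U) m, lform f VU m = lform g VU m) -> f = g.
Proof.
case: f g => f f1 f2 [g g1 g2] /= fg.
have {}fg : f = g.
  apply: functional_extensionality_dep => V.
  by apply/funext => VU; apply/funext => m.
case: _ / fg g1 g2 => g1 g2.
by rewrite (Prop_irrelevance f1 g1) (Prop_irrelevance f2 g2).
Qed.

Section Module.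
Variable U : opens X.
Implicit Types f g h : local_form E U.

Program Definition lform0 : local_form E U :=
  @LocalForm k X E U (fun V _ _ => 0) _ _.
Next Obligation. by move=> *; rewrite mulr0 addr0. Qed.
Next Obligation. by move=> *; rewrite rmorph0. Qed.

Program Definition lformD f g : local_form E U :=
  @LocalForm k X E U (fun V VU m => lform f VU m + lform g VU m) _ _.
Next Obligation. by move=> * /=; rewrite !lform_lin mulrDr addrACA. Qed.
Next Obligation.
by move=> f g V W VU WU WV m /=; rewrite rmorphD !(lform_res _ _ WU).
Qed.

Program Definition lformZ (b : sect X U) f : local_form E U :=
  @LocalForm k X E U (fun V VU m => res VU b * lform f VU m) _ _.
Next Obligation. by move=> * /=; rewrite lform_lin mulrDr mulrCA. Qed.
Next Obligation.
by move=> b f V W VU WU WV m /=; rewrite rmorphM (lform_res _ _ WU) (res_comp _ _ WU).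
Qed.

Definition lformN f := lformZ (- 1) f.

Lemma lformDA : associative lformD.
Proof. by move=> f g h; apply: lform_eq => V VU m /=; rewrite addrA. Qed.
Lemma lformDC : commutative lformD.
Proof. by move=> f g; apply: lform_eq => V VU m /=; rewrite addrC. Qed.
Lemma lform0D : left_id lform0 lformD.
Proof. by move=> f; apply: lform_eq => V VU m /=; rewrite add0r. Qed.
Lemma lformND : left_inverse lform0 lformN lformD.
Proof.
move=> f; apply: lform_eq => V VU m /=.
by rewrite rmorphN rmorph1 mulN1r addNr.
Qed.
HB.instance Definition _ :=
  GRing.isZmodule.Build (local_form E U) lformDA lformDC lform0D lformND.

Lemma lformZA a b f : lformZ a (lformZ b f) = lformZ (a * b) f.
Proof. by apply: lform_eq => V VU m /=; rewrite rmorphM mulrA. Qed.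
Lemma lformZ1 : left_id 1 lformZ.
Proof. by move=> f; apply: lform_eq => V VU m /=; rewrite rmorph1 mul1r. Qed.
Lemma lformZDr : right_distributive lformZ +%R.
Proof. by move=> a f g; apply: lform_eq => V VU m /=; rewrite mulrDr. Qed.
Lemma lformZDl f : {morph lformZ^~ f : a b / a + b}.
Proof.
by move=> a b; apply: lform_eq => V VU m /=; rewrite rmorphD mulrDl.
Qed.
HB.instance Definition _ :=
  GRing.Zmodule_isLmodule.Build (sect X U) (local_form E U)
    lformZA lformZ1 lformZDr lformZDl.

End Module.

Program Definition lform_restr (U V : opens X) (VU : V `<=` U)
    (f : local_form E U) : local_form E V :=
  @LocalForm k X E V (fun W WV m => lform f (fun x h => VU x (WV x h)) m) _ _.
Next Obligation. by move=> * /=; rewrite lform_lin. Qed.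
Next Obligation. by move=> *; apply: lform_res. Qed.

Lemma lform_irr (U : opens X) (f : local_form E U) (V : opens X)
  (VU VU' : V `<=` U) m : lform f VU m = lform f VU' m.
Proof. by rewrite (Prop_irrelevance VU VU'). Qed.

Lemma lform_restr_lin (U V : opens X) (VU : V `<=` U) (a : sect X U)
    (f g : local_form E U) :
  lform_restr VU (a *: f + g) = res VU a *: lform_restr VU f + lform_restr VU g.
Proof.
apply: lform_eq => W WV m /=.
by rewrite (res_comp VU WV (fun x h => VU x (WV x h))).
Qed.

Lemma lform_restr_id (U : opens X) (UU : U `<=` U) (f : local_form E U) :
  lform_restr UU f = f.
Proof. by apply: lform_eq => W WV m /=; apply: lform_irr. Qed.

Lemma lform_restr_comp (U V W : opens X) (VU : V `<=` U) (WV : W `<=` V)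
    (WU : W `<=` U) (f : local_form E U) :
  lform_restr WV (lform_restr VU f) = lform_restr WU f.
Proof. by apply: lform_eq => Z ZW m /=; apply: lform_irr. Qed.

Lemma lform_ext (U : opens X) (I : Type) (V : I -> opens X)
    (VU : forall i, V i `<=` U) : covers V U ->
  forall f g : local_form E U,
    (forall i, lform_restr (VU i) f = lform_restr (VU i) g) -> f = g.
Proof.
move=> UV f g fg; apply: lform_eq => W WU m.
pose Z i := openI W (V i).
have ZW i : Z i `<=` W by move=> x [].
have ZV i : Z i `<=` V i by move=> x [].
have cZ : covers Z W by move=> x Wx; have [i Vi] := UV _ (WU _ Wx); exists i.
apply: (sect_ext ZW cZ) => i.
have ZU : Z i `<=` U by move=> x /ZW /WU.
rewrite !(lform_res _ _ ZU).
have := congr1 (fun h => lform h (ZV i) (mres E (ZW i) m)) (fg i).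
by rewrite /= (lform_irr f _ ZU) (lform_irr g _ ZU).
Qed.

Lemma lform_glue (U : opens X) (I : Type) (V : I -> opens X)
    (VU : forall i, V i `<=` U) : covers V U ->
  forall f : forall i, local_form E (V i),
  (forall i j (W : opens X) (Wi : W `<=` V i) (Wj : W `<=` V j),
    lform_restr Wi (f i) = lform_restr Wj (f j)) ->
  exists g, forall i, lform_restr (VU i) g = f i.
Proof.
move=> UV f fE.
have fE' i j (W : opens X) (Wi : W `<=` V i) (Wj : W `<=` V j) m :
    lform (f i) Wi m = lform (f j) Wj m.
  have := congr1 (fun h => lform h (fun x h => h) m) (fE i j W Wi Wj).
  by rewrite /= (lform_irr (f i) _ Wi) (lform_irr (f j) _ Wj).
pose Z (W : opens X) i := openI W (V i).
have ZW W i : Z W i `<=` W by move=> x [].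
have ZV W i : Z W i `<=` V i by move=> x [].
have cZ (W : opens X) : W `<=` U -> covers (Z W) W.
  by move=> WU x Wx; have [i Vi] := UV _ (WU _ Wx); exists i.
have gP (W : opens X) (WU : W `<=` U) (m : msect E W) : {t : sect X W |
    forall i, res (ZW W i) t = lform (f i) (ZV W i) (mres E (ZW W i) m)}.
  apply: cid; apply: (sect_glue (ZW W) (cZ W WU)) => i j T Ti Tj.
  have TVi : T `<=` V i by move=> x /Ti [].
  have TVj : T `<=` V j by move=> x /Tj [].
  have TW : T `<=` W by move=> x /Ti [].
  rewrite (lform_res _ _ TVi) (lform_res _ _ TVj).
  by rewrite !(mres_comp _ _ TW); apply: fE'.
pose g (W : opens X) (WU : W `<=` U) m := sval (gP W WU m).
have gE (W : opens X) (WU : W `<=` U) m i :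
    res (ZW W i) (g W WU m) = lform (f i) (ZV W i) (mres E (ZW W i) m).
  exact: (svalP (gP W WU m)).
have g_lin (W : opens X) (WU : W `<=` U) (a : sect X W) m n :
    g W WU (a *: m + n) = a * g W WU m + g W WU n.
  apply: (sect_ext (ZW W) (cZ W WU)) => i.
  by rewrite rmorphD rmorphM !gE mres_lin lform_lin.
have g_res (W T : opens X) (WU : W `<=` U) (TU : T `<=` U) (TW : T `<=` W) m :
    res TW (g W WU m) = g T TU (mres E TW m).
  apply: (sect_ext (ZW T) (cZ T TU)) => i.
  have ZZ : Z T i `<=` Z W i by move=> x [/TW Wx Vx].
  have ZTW : Z T i `<=` W by move=> x [/TW].
  rewrite gE (res_comp _ _ ZTW) -(res_comp (ZW W i) ZZ) gE.
  by rewrite (lform_res _ _ (ZV T i)) !(mres_comp _ _ ZTW).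
exists (@LocalForm k X E U g g_lin g_res) => i.
apply: lform_eq => W WV m /=.
set WU := (fun x h => _).
apply: (sect_ext (ZW W) (cZ W WU)) => l.
have ZVi : Z W l `<=` V i by move=> x [/WV].
by rewrite gE (lform_res _ _ ZVi); apply: fE'.
Qed.

Definition dual_sheaf : sheaf_of_modules X :=
  @SheafOfModules k X (fun U => local_form E U) lform_restr lform_restr_lin
    lform_restr_id lform_restr_comp lform_ext lform_glue.

End LocalForms.

Section BidualSheaf.
Variables (k : fieldType) (X : ringed_space k) (E : sheaf_of_modules X).

Program Definition sheaf_biduality (U : opens X) (m : msect E U) :
    msect (dual_sheaf (dual_sheaf E)) U :=
  @LocalForm k X (dual_sheaf E) U
    (fun V VU (f : local_form E V) => lform f (fun x h => h) (mres E VU m)) _ _.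
Next Obligation. by move=> * /=; rewrite res_id. Qed.
Next Obligation.
move=> U m V W VU WU WV f /=.
by rewrite (lform_res _ _ WV) (mres_comp _ _ WU); apply: lform_irr.
Qed.

Definition reflexive_sheaf := forall U : opens X, bijective (@sheaf_biduality U).

End BidualSheaf.

(* Main.v *)
From HB Require Import structures.
From mathcomp Require Import all_boot all_order all_algebra.
From mathcomp Require Import generic_quotient complex.
From mathcomp Require Import boolp classical_sets reals.
From mathcomp Require Import cardinality topology.
From mathcomp Require Import zify lra.
Require Import Defs.

Set Implicit Arguments.
Unset Strict Implicit.
Unset Printing Implicit Defensive.

Import GRing.Theory.
Local Open Scope classical_set_scope.
Local Open Scope ring_scope.

(* At a closed point, the local ring A of the double curve has z with z^2 = 0 and
   A/z a discrete valuation ring; the Cohen-Macaulay condition makes a lift x of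
   the uniformizer regular, so that A is Gorenstein of dimension one. A finitely
   generated module without x-torsion is filtered by copies of A/z, and
   Ext^1(A/z, A) = 0, hence every form on a saturated submodule extends. Applied
   to a submodule of A^n this makes the biduality map surjective, and applied to
   a line in M it makes it injective when M is torsion free.

   For sheaves, everything is compared at the generic point eta: a coherent sheaf
   is torsion free iff a section vanishing near eta is zero. The hypothesis that
   C is projective enters through the fact that {eta} is not open, which is
   Zariski's lemma over an uncountable field. Forms on stalks extend to
   neighbourhoods without finite presentation, because relations among the
   generators can be tested at eta. *)

(** * Modules over the local rings *)

(** Ext^1(A/z, A) = 0 amounts to the annihilator of z being (z). A form psi on K, to be extended to
    K + A e with z e in K, has at z e a value that z kills; so this value is d z, and d is an
    admissible value at e. At a point where z = 0, A equals A/z and any d will do. The generic point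
    obeys the same axioms with x = 1, for which every submodule is saturated, so one extension
    theorem serves at all points. The generic point controls sections for two reasons: a germ
    outside (z) is a unit at eta, and conversely a germ invertible at eta is outside (z), which is
    nilpotent, hence is a non-zero-divisor. Torsion freeness is tested on all subsheaves, and the
    one-point subspace {eta} is itself zero-dimensional: this is why {eta} has to be shown not open.
    Surjectivity of biduality meets a further obstacle: a section m built at p must represent Psi
    also on open sets that avoid p, where forms need not extend to p; they do after multiplication
    by a section invertible at eta. *)

Section Submodules.
Variables (A : comPzRingType) (M : lmodType A).
Implicit Types (K N : set M) (m : M) (a b : A).

Lemma submodule_sum K I (r : seq I) (P : pred I) (F : I -> M) :
  is_submodule K -> (forall i, P i -> K (F i)) -> K (\sum_(i <- r | P i) F i).
Proof. by move=> [K0 KD _] KF; apply: big_ind. Qed.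

Lemma submodule_opp K m : is_submodule K -> K m -> K (- m).
Proof. by move=> [_ _ KZ] Km; rewrite -scaleN1r; apply: KZ. Qed.

Lemma submodule_sub K m n : is_submodule K -> K m -> K n -> K (m - n).
Proof. by move=> KS Km Kn; case: (KS) => _ KD _; apply: KD => //; apply: submodule_opp. Qed.

Lemma submodule0 : is_submodule [set (0 : M)].
Proof.
split=> // [m n -> ->|a m ->]; rewrite /= ?addr0 //; exact: scaler0.
Qed.

Lemma submoduleI K N : is_submodule K -> is_submodule N -> is_submodule (K `&` N).
Proof.
move=> [K0 KD KZ] [N0 ND NZ]; split=> //.
- by move=> m n [? ?] [? ?]; split; [apply: KD|apply: ND].
- by move=> a m [? ?]; split; [apply: KZ|apply: NZ].
Qed.

Definition adjoin K m : set M := [set n | exists a, K (n - a *: m)].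

Lemma adjoin_submodule K m : is_submodule K -> is_submodule (adjoin K m).
Proof.
move=> [K0 KD KZ]; split.
- by exists 0; rewrite scale0r subr0.
- move=> n p [a Ka] [b Kb]; exists (a + b).
  by rewrite scalerDl opprD addrACA; apply: KD.
- by move=> b n [a Ka]; exists (b * a); rewrite -scalerA -scalerBr; apply: KZ.
Qed.

Lemma adjoin_sub K m : K `<=` adjoin K m.
Proof. by move=> n Kn; exists 0; rewrite scale0r subr0. Qed.

Lemma adjoin_gen K m : is_submodule K -> adjoin K m m.
Proof. by case=> K0 _ _; exists 1; rewrite scale1r subrr. Qed.

Lemma adjoin_min K N m :
  is_submodule N -> K `<=` N -> N m -> adjoin K m `<=` N.
Proof.
move=> [N0 ND NZ] KN Nm n [a /KN Na].
by rewrite -(subrK (a *: m) n); apply: ND => //; apply: NZ.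
Qed.

Definition span n (x : 'I_n -> M) : set M :=
  [set m | exists c : 'I_n -> A, m = \sum_i c i *: x i].

Lemma span_submodule n (x : 'I_n -> M) : is_submodule (span x).
Proof.
split.
- by exists (fun=> 0); rewrite big1 // => i _; rewrite scale0r.
- move=> _ _ [c ->] [d ->]; exists (fun i => c i + d i).
  by rewrite -big_split; apply: eq_bigr => i _; rewrite scalerDl.
- move=> a _ [c ->]; exists (fun i => a * c i).
  by rewrite scaler_sumr; apply: eq_bigr => i _; rewrite scalerA.
Qed.

(** Stated relative to a submodule D, so that an induction on the number of generators can pass to
    the span of fewer of them without a type of submodules. *)
Definition acc_on (D : set M) := forall N : nat -> set M,
  (forall i, is_submodule (N i) /\ N i `<=` D) ->
  (forall i, N i `<=` N i.+1) -> exists n, forall k, N k `<=` N n.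

Definition acc := acc_on [set: M].

Lemma nondecreasing_sets T (N : nat -> set T) : (forall i, N i `<=` N i.+1) ->
  forall i k, (i <= k)%N -> N i `<=` N k.
Proof.
move=> NS i k /subnKC <-; elim: (k - i)%N => [|d IH]; first by rewrite addn0.
by rewrite addnS; apply: subset_trans (NS _).
Qed.

Lemma acc_max : acc -> forall P : set (set M),
  (forall K, P K -> is_submodule K) -> (exists K, P K) ->
  exists2 K, P K & forall N, P N -> K `<=` N -> N `<=` K.
Proof.
move=> accM P PS [K0 PK0]; apply: contrapT => nmax.
have next (K : {K | P K}) : {N : {K | P K} | sval K `<` sval N}.
  apply: cid; apply: contrapT => nK; apply: nmax.
  exists (sval K) => [|N PN KN]; first exact: svalP K.
  by apply: contrapT => nNK; apply: nK; exists (exist P N PN).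
have [f [_ fS]] := dependent_choice next (exist P K0 PK0).
have [|i|n nP] := accM (fun i => sval (f i)).
- by move=> i; split=> //; apply/PS/(svalP (f i)).
- by case: (fS i).
- by case: (fS n) => _; apply; apply: nP.
Qed.

End Submodules.

Lemma noetherian_acc (A : comPzRingType) : noetherian A -> acc A^o.
Proof.
move=> An N NS Nmon.
have {}NS i : is_submodule (N i) by case: (NS i).
have Nle := nondecreasing_sets Nmon.
pose I : set A := [set a | exists i, N i a].
have [|n [x xI]] := An I.
  split; first by exists 0%N; case: (NS 0%N).
  - move=> a b [i Na] [k Nb]; exists (maxn i k); case: (NS (maxn i k)) => _ D _.
    by apply: D; [apply: (Nle i); rewrite ?leq_maxl|
                  apply: (Nle k); rewrite ?leq_maxr].
  - by move=> a b [i Nb]; exists i; case: (NS i) => _ _ Z; apply: Z.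
have xN k : {i | N i (x k)}.
  apply: cid; suff: I (x k) by [].
  rewrite xI; exists (fun l => (l == k)%:R).
  rewrite (bigD1 k) //= eqxx mul1r big1 ?addr0 // => l /negPf ->.
  by rewrite mul0r.
exists (\max_k sval (xN k))%N => m a Na.
have : I a by exists m.
rewrite xI => -[c ->]; apply: (@submodule_sum A A^o) => // k _.
case: (NS (\max_l sval (xN l))%N) => _ _ Z; apply: Z.
have kle := leq_bigmax (F := fun l => sval (xN l)) k.
exact: Nle kle _ (svalP (xN k)).
Qed.

(** A chain is controlled by its traces on the span of the first n generators and by the ideals
    [J i] of coefficients of the last generator. Once both are stationary, an element of a later
    term is corrected by one of [N (maxn n1 n2)] with the same last coefficient, and the difference
    lies in the smaller span. *)
Lemma acc_span (A : comPzRingType) (M : lmodType A) n (x : 'I_n -> M) :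
  noetherian A -> acc_on (span x).
Proof.
move=> /noetherian_acc accA; elim: n x => [|n IH] x N NS Nmon.
  exists 0%N => m y Ny; have [_ /(_ _ Ny) [c ->]] := NS m.
  by rewrite big_ord0; case: (NS 0%N) => [[]].
have {}NS i : is_submodule (N i) /\ N i `<=` span x by [].
pose x' i := x (widen_ord (leqnSn n) i).
have [|i y [Ny y']|n1 n1P] := IH x' (fun i => N i `&` span x').
- move=> i; split; last exact: subIsetr.
  by apply: submoduleI (span_submodule _); case: (NS i).
- by split=> //; apply: Nmon.
pose J i : set A^o :=
  [set a : A | exists2 y, span x' y & N i (a *: x ord_max + y)].
have [|i a [y y' Ny]|n2 n2P] := accA J.
- move=> i; split=> //; have [[N0 ND NZ] _] := NS i.
  have [S0 SD SZ] := span_submodule x'; split.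
  + by exists 0 => //; rewrite addr0 scale0r.
  + move=> a b [y Sy Ny] [y2 Sy2 Ny2]; exists (y + y2); first exact: SD.
    by rewrite scalerDl addrACA; apply: ND.
  + move=> b a [y Sy Ny]; exists (b *: y); first exact: SZ.
    by rewrite -scalerA -scalerDr; apply: NZ.
- by exists y => //; apply: Nmon.
have Nle := nondecreasing_sets Nmon.
exists (maxn n1 n2) => m y Ny; set k := maxn n1 n2.
have [NkS _] := NS k.
have [_ /(_ _ Ny) [c yE]] := NS m.
rewrite big_ord_recr /= addrC in yE.
have [|y2 Sy2 Ny2] := n2P m (c ord_max).
  exists (\sum_(i < n) c (widen_ord (leqnSn n) i) *: x' i).
    by exists (fun i => c (widen_ord (leqnSn n) i)).
  by rewrite -yE.
have NkY : N k (c ord_max *: x ord_max + y2).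
  by apply: (Nle n2) Ny2; rewrite leq_maxr.
have Sd : span x' (y - (c ord_max *: x ord_max + y2)).
  rewrite yE opprD addrACA subrr add0r; apply: submodule_sub => //.
    exact: span_submodule.
  by exists (fun i => c (widen_ord (leqnSn n) i)).
rewrite -[y](subrK (c ord_max *: x ord_max + y2)).
case: (NkS) => _ + _; apply => //.
apply: (Nle n1); first by rewrite leq_maxl.
suff [] : (N n1 `&` span x') (y - (c ord_max *: x ord_max + y2)) by [].
apply: (n1P (maxn k m)); split=> //; have [NS' _] := NS (maxn k m).
apply: submodule_sub => //; first by apply: (Nle m) Ny; rewrite leq_maxr.
by apply: (Nle k) NkY; rewrite leq_maxl.
Qed.

Lemma fg_acc (A : comPzRingType) (M : lmodType A) :
  noetherian A -> fg_module M -> acc M.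
Proof.
move=> An [n [x xP]]; have xT : span x = [set: M].
  by rewrite -subTset => m _; apply: xP.
by rewrite /acc -xT; apply: acc_span.
Qed.

Lemma fg_rV (A : comPzRingType) n : fg_module 'rV[A]_n.
Proof.
by exists n, (fun j => delta_mx 0 j) => u; exists (u 0); apply: row_sum_delta.
Qed.

(** * Ribbons and the extension of linear forms *)

Section Ribbon.
Variables (A : comPzRingType) (z x : A).

(* The local rings of a primitive double curve: x lifts a uniformizer at a
   closed point, and x = 1 at the generic point. *)
Record ribbon : Prop := Ribbon {
  ribbon_sqr0 : z * z = 0;
  ribbon_reg : forall a, x * a = 0 -> a = 0;
  ribbon_dvd : forall a, (exists c, a = c * z) \/
    exists b c n, a * b = x ^+ n + c * z;
  ribbon_unit : forall a, is_unit a \/ exists b c, a = b * x + c * z;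
  ribbon_noeth : noetherian A }.

Hypothesis rA : ribbon.

Lemma ribbon_regX n a : x ^+ n * a = 0 -> a = 0.
Proof.
elim: n => [|n IH]; first by rewrite mul1r.
by rewrite exprS -mulrA => /(ribbon_reg rA).
Qed.

(** A multiple of a is x^n + c z; times its conjugate x^n - c z this is x^(2n), a power of a regular
    element. *)
Lemma ribbon_cancel a b : ~ (exists c, a = c * z) -> a * b = 0 -> b = 0.
Proof.
move=> az ab; have [//|[b' [c [n aE]]]] := ribbon_dvd rA a.
apply: (@ribbon_regX (n + n)).
have -> : x ^+ (n + n) = (x ^+ n + c * z) * (x ^+ n - c * z).
  rewrite mulrBr !mulrDl -exprD [c * z * (c * z)]mulrACA (ribbon_sqr0 rA).
  by rewrite mulr0 addr0 [c * z * _]mulrC addrK.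
by rewrite -aE mulrAC [a * b' * b]mulrAC ab !mul0r.
Qed.

Lemma ribbon_ann c : z * c = 0 -> z = 0 \/ exists d, c = d * z.
Proof.
move=> zc; have [?|cz] := EM (exists d, c = d * z); first by right.
by left; apply: (ribbon_cancel cz); rewrite mulrC.
Qed.

(** Multiplication by w embeds A/z in A. The witness is z, except that 1 is needed when z = 0. *)
Lemma ribbon_ann_gen : exists2 w, z * w = 0 &
  forall b, b * w = 0 -> exists c, b = c * z.
Proof.
have [z0|z0] := EM (z = 0).
  exists 1; first by rewrite z0 mul0r.
  by move=> b; rewrite mulr1 => ->; exists 0; rewrite mul0r.
exists z; first exact: ribbon_sqr0.
by move=> b; rewrite mulrC => /ribbon_ann [].
Qed.

Section Extension.
Variable M : lmodType A.
Hypothesis accM : acc M.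
Implicit Types K : set M.

(** The quotient M / K has no x-torsion; no quotient module is formed. *)
Definition saturated K := forall m, K (x *: m) -> K m.

Lemma saturatedX K n m : saturated K -> K (x ^+ n *: m) -> K m.
Proof.
move=> Ks; elim: n => [|n IH]; first by rewrite scale1r.
by rewrite exprS -scalerA => /Ks.
Qed.

(** The class of e in M / K spans a copy of A/z: if b were outside (z), a multiple of it would be
    x^n modulo z, which puts x^n e, and by saturation e, in K. *)
Lemma saturated_ann K e b : is_submodule K -> saturated K ->
  ~ K e -> K (z *: e) -> K (b *: e) -> exists c, b = c * z.
Proof.
move=> KS Ks Ke Kze Kbe; have [//|[d [c [n bd]]]] := ribbon_dvd rA b.
have [_ KD KZ] := KS.
case: Ke; apply: (saturatedX (n := n) Ks).
rewrite -[x ^+ n](addrK (c * z)) -bd scalerBl.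
apply: submodule_sub => //; last by rewrite -scalerA; apply: KZ.
by rewrite mulrC -scalerA; apply: KZ.
Qed.

(* The quotient of the saturation of K + A f by K is a rank one module over
   the discrete valuation ring A / z: e is a generator. *)
Lemma saturated_adjoin K f : is_submodule K -> saturated K ->
  ~ K f -> K (z *: f) ->
  exists e, [/\ ~ K e, K (z *: e), saturated (adjoin K e) & adjoin K e f].
Proof.
move=> KS Ks Kf Kzf; have [K0 KD KZ] := KS.
pose P : set (set M) := [set N | exists e,
  [/\ N = adjoin K e, ~ K e, K (z *: e) & adjoin K e f]].
have [||_ [e [-> Ke Kze Kef]] emax] := acc_max accM (P := P).
- by move=> _ [e [-> _ _ _]]; apply: adjoin_submodule.
- by exists (adjoin K f), f; split=> //; apply: adjoin_gen.
exists e; split=> // h [a Ka].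
have KeS := adjoin_submodule e KS.
(* Modulo K, x h = a e. If a = b x + c z, then x (h - b e) is in K, hence h - b e is. If a is a
   unit, e is a multiple of x h, so K + A h contains K + A e and f, and maximality puts h in K + A
   e. *)
have [[b ab]|[b [c aE]]] := ribbon_unit rA a; last first.
  have Kx : K (x *: (h - b *: e)).
    rewrite scalerBr scalerA [x * b]mulrC.
    have -> : x *: h - (b * x) *: e = (x *: h - a *: e) + c *: (z *: e).
      by rewrite aE scalerDl scalerA opprD addrA subrK.
    by apply: KD => //; apply: KZ.
  by exists b; apply: Ks.
have Khe : adjoin K h e.
  exists (b * x).
  have -> : e - (b * x) *: h = - (b *: (x *: h - a *: e)).
    by rewrite scalerBr !scalerA [b * a]mulrC ab scale1r opprB.
  by apply: submodule_opp => //; apply: KZ.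
have KhS := adjoin_submodule h KS.
have eh : adjoin K e `<=` adjoin K h.
  by apply: adjoin_min => //; apply: adjoin_sub.
have Kh : ~ K h.
  move=> Kh; apply: Ke; case: Khe => d Kd.
  by rewrite -[e](subrK (d *: h)); apply: KD => //; apply: KZ.
have Kzh : K (z *: h).
  apply: Ks; rewrite scalerA mulrC -scalerA.
  rewrite -[x *: h](subrK (a *: e)) scalerDr scalerA mulrC -scalerA.
  by apply: KD; apply: KZ.
have Ph : P (adjoin K h) by exists h; split=> //; apply: eh.
by apply: (emax _ Ph eh); apply: adjoin_gen.
Qed.

(** When z f is outside K, [saturated_adjoin] is applied to z f, which z kills. Reaching z f instead
    of f suffices for separation: a form that is nonzero at z f is nonzero at f. *)
Lemma saturated_extend K f : is_submodule K -> saturated K -> ~ K f ->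
  exists e, [/\ ~ K e, K (z *: e), saturated (adjoin K e) &
    adjoin K e f \/ adjoin K e (z *: f) /\ ~ K (z *: f)].
Proof.
move=> KS Ks Kf; have [Kzf|Kzf] := EM (K (z *: f)).
  have [e [? ? ? ?]] := saturated_adjoin KS Ks Kf Kzf.
  by exists e; split=> //; left.
have [|e [? ? ? ?]] := saturated_adjoin KS Ks Kzf.
  by rewrite scalerA (ribbon_sqr0 rA) scale0r; case: KS.
by exists e; split=> //; right; split.
Qed.

(** A form on a submodule is a total function whose values off K are arbitrary, so extending it
    needs no change of type. *)
Definition linear_on K (f : M -> A) :=
  forall a m n, K m -> K n -> f (a *: m + n) = a * f m + f n.

Lemma linear_on0 K f : is_submodule K -> linear_on K f -> f 0 = 0.
Proof.
move=> [K0 _ _] fK; have := fK 1 0 0 K0 K0.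
rewrite scale1r addr0 mul1r => /(congr1 (fun t => t - f 0)).
by rewrite addrK subrr.
Qed.

(** The multiples b e that lie in K are those with b in (z), by [saturated_ann]. Hence psi (z e) = d
    z is the only compatibility required of the value d at e, and psi' does not depend on the
    coefficient chosen to write m. *)
Lemma extend_adjoin K e psi d : is_submodule K -> saturated K -> ~ K e ->
  K (z *: e) -> linear_on K psi -> psi (z *: e) = d * z ->
  exists psi', [/\ linear_on (adjoin K e) psi',
    forall m, K m -> psi' m = psi m & psi' e = d].
Proof.
move=> KS Ks Ke Kze psiK psid.
have [K0 KD KZ] := KS.
have psi0 := linear_on0 KS psiK.
pose psi' m := if pselect (adjoin K e m) is left h
  then psi (m - sval (cid h) *: e) + sval (cid h) * d else 0.
have psi'E m a : K (m - a *: e) -> psi' m = psi (m - a *: e) + a * d.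
  move=> Ka; rewrite /psi'; case: pselect => [h|[]]; last by exists a.
  move: (cid h) => [b Kb] /=.
  have Kab : K ((a - b) *: e).
    by move: (submodule_sub KS Kb Ka); rewrite opprB addrC addrA subrK -scalerBl.
  have [c abE] := saturated_ann KS Ks Ke Kze Kab.
  have -> : m - b *: e = c *: (z *: e) + (m - a *: e).
    by rewrite scalerA -abE scalerBl [RHS]addrC addrA subrK.
  rewrite psiK // psid mulrCA mulrC -abE mulrBl addrAC.
  by rewrite subrK addrC.
exists psi'; split.
- move=> a m n [b Kb] [c Kc].
  rewrite (psi'E m b Kb) (psi'E n c Kc).
  have E : a *: m + n - (a * b + c) *: e =
      a *: (m - b *: e) + (n - c *: e).
    by rewrite scalerDl opprD addrACA scalerBr scalerA.
  rewrite (psi'E _ (a * b + c)); last by rewrite E; apply: KD => //; apply: KZ.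
  by rewrite E psiK // mulrDl mulrDr addrACA mulrA.
- move=> m Km; rewrite (psi'E m 0) scale0r subr0 //.
  by rewrite mul0r addr0.
- by rewrite (psi'E e 1) scale1r subrr // psi0 mul1r add0r.
Qed.

(* Ext^1(M / K, A) = 0 for M / K torsion free: by noetherian induction, with
   M / K filtered by copies of A / z. *)
Theorem linear_on_extend K psi : is_submodule K -> saturated K ->
  linear_on K psi ->
  exists2 phi, linear_on [set: M] phi & forall m, K m -> phi m = psi m.
Proof.
move=> KS Ks psiK.
pose P : set (set M) := [set N | exists phi,
  [/\ is_submodule N, saturated N, K `<=` N, linear_on N phi &
      forall m, K m -> phi m = psi m]].
have [||N [phi [NS Ns KN phiN phiK]] Nmax] := acc_max accM (P := P).
- by move=> N [phi []].
- by exists K, psi; split.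
suff NT : N = [set: M] by exists phi; rewrite -?NT.
rewrite -subTset => f _; apply: contrapT => Nf.
have [e [Ne Nze Nes _]] := saturated_extend NS Ns Nf.
(* As z^2 = 0, z kills phi (z e), so [ribbon_ann] puts this value in (z); if z = 0 it is phi 0 =
   0. *)
have [d de] : exists d, phi (z *: e) = d * z.
  have [|z0|//] := @ribbon_ann (phi (z *: e)).
    have [N0 _ _] := NS.
    have := phiN z (z *: e) 0 Nze N0.
    by rewrite addr0 scalerA (ribbon_sqr0 rA) scale0r (linear_on0 NS phiN) addr0.
  by exists 0; rewrite z0 scale0r mul0r (linear_on0 NS phiN).
have [phi' [phi'l phi'N _]] := extend_adjoin NS Ns Ne Nze phiN de.
have PN : P (adjoin N e).
  exists phi'; split=> //; first exact: adjoin_submodule.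
    by apply: subset_trans KN _; apply: adjoin_sub.
  by move=> m Km; rewrite phi'N ?phiK //; apply: KN.
by apply: Ne; apply: (Nmax _ PN); [apply: adjoin_sub|apply: adjoin_gen].
Qed.

(** The zero form on K is extended by e going to w. The annihilator of w being (z), the new form is
    injective on (K + A e) / K, and it is then extended to M. *)
Theorem linear_separate K f : is_submodule K -> saturated K -> ~ K f ->
  exists phi, [/\ linear_on [set: M] phi, forall m, K m -> phi m = 0 &
    phi f <> 0].
Proof.
move=> KS Ks Kf; have [K0 KD KZ] := KS.
have [w zw wz] := ribbon_ann_gen.
have [e [Ke Kze Kes ef]] := saturated_extend KS Ks Kf.
have lin0 : linear_on K (fun=> 0) by move=> *; rewrite mulr0 addr0.
have [|psi [psil psiK psie]] := extend_adjoin (d := w) KS Ks Ke Kze lin0.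
  by rewrite mulrC.
have [phi phil phiE] := linear_on_extend (adjoin_submodule e KS) Kes psil.
have Ke_neq0 g : adjoin K e g -> ~ K g -> phi g <> 0.
  move=> eg Kg; rewrite phiE //; have [b Kb] := eg.
  have -> : g = b *: e + (g - b *: e) by rewrite addrC subrK.
  have Keb : adjoin K e (g - b *: e) by apply: adjoin_sub.
  rewrite (psil _ _ _ (adjoin_gen e KS) Keb) psie (psiK _ Kb) addr0.
  move=> /wz [c bE]; apply: Kg; rewrite -[g](subrK (b *: e)).
  by apply: KD => //; rewrite bE -scalerA; exact: KZ Kze.
exists phi; split=> //.
  by move=> m Km; rewrite phiE ?psiK //; apply: adjoin_sub.
case: ef => [ef|[ezf Kzf]]; first exact: Ke_neq0.
move=> f0; apply: (Ke_neq0 _ ezf Kzf).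
have := phil z f 0 I I.
have MS : is_submodule [set: M] by split.
by rewrite addr0 f0 mulr0 add0r => ->; apply: linear_on0 MS phil.
Qed.

End Extension.
End Ribbon.

(** * Reflexive and torsion free modules over a ribbon *)

Section ModuleReflexivity.
Variables (A : comPzRingType) (z x : A) (M : lmodType A).
Hypothesis rA : ribbon z x.

Lemma linear_on_sum (N : lmodType A) (f : N -> A) n (c : 'I_n -> A)
    (u : 'I_n -> N) :
  linear_on [set: N] f -> f (\sum_i c i *: u i) = \sum_i c i * f (u i).
Proof.
move=> fl; have f0 : f 0 = 0.
  by apply: linear_on0 fl; split.
pose R m a := f m = a; apply: (big_ind2 R) => // [m a m' a' <- <-|i _].
  by rewrite /R -[m]scale1r fl // mul1r scale1r.
by rewrite /R -[_ *: _]addr0 fl // f0 addr0.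
Qed.

Lemma linear_on_rV n (f : 'rV[A]_n -> A) (u : 'rV[A]_n) :
  linear_on [set: 'rV[A]_n] f -> f u = \sum_i u 0 i * f (delta_mx 0 i).
Proof. by move=> fl; rewrite {1}(row_sum_delta u) linear_on_sum. Qed.

Lemma dual_apply0 (f : dual M) : dual_apply f 0 = 0.
Proof. exact: (@linear0 _ _ _ _ (f : {linear M -> A^o})). Qed.

Lemma dual_applyZ (f : dual M) a m : dual_apply f (a *: m) = a * dual_apply f m.
Proof. by rewrite -[a *: m]addr0 dual_linear dual_apply0 addr0. Qed.

Lemma dual_apply_sum (f : dual M) n (c : 'I_n -> A) (u : 'I_n -> M) :
  dual_apply f (\sum_i c i *: u i) = \sum_i c i * dual_apply f (u i).
Proof. by apply: linear_on_sum => a m n' _ _; apply: dual_linear. Qed.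

(* A form on the dual of M is a partial form on A^n through the values at n
   generators, and extends to A^n. *)
Lemma biduality_surj (phi : dual (dual M)) : fg_module M ->
  exists m, biduality m = phi.
Proof.
move=> [n [u uM]].
pose val (g : dual M) : 'rV[A]_n := \row_i dual_apply g (u i).
have val_inj : injective val.
  move=> g h gh; apply: dualP => m; have [c ->] := uM m.
  rewrite !dual_apply_sum; apply: eq_bigr => i _.
  by move/rowP: gh => /(_ i); rewrite !mxE => ->.
have val_lin a g h : val (a *: g + h) = a *: val g + val h.
  by apply/rowP => i; rewrite !mxE.
have val0 : val 0 = 0 by apply/rowP => i; rewrite !mxE.
pose K : set 'rV[A]_n := [set c | exists g, c = val g].
have KS : is_submodule K.
  split; first by exists 0; rewrite val0.
    move=> _ _ [g ->] [h ->]; exists (g + h).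
    by rewrite -[g]scale1r val_lin !scale1r.
  by move=> a _ [g ->]; exists (a *: g); rewrite -[a *: g]addr0 val_lin val0 addr0.
(* If x divides the values of a form at the generators, it divides all its values; as x is regular
   on A, the quotients are unique and form a linear map. *)
have Ks : saturated x K.
  move=> c [g cg].
  have xg m : {t | x * t = dual_apply g m}.
    apply: cid; have [d ->] := uM m; exists (\sum_i d i * c 0 i).
    rewrite dual_apply_sum mulr_sumr; apply: eq_bigr => i _.
    by move/rowP: cg => /(_ i); rewrite !mxE => <-; rewrite mulrCA.
  have x_inj a b : x * a = x * b -> a = b.
    move=> ab; apply/subr0_eq/(ribbon_reg rA).
    by rewrite mulrBr ab subrr.
  have hl a m m' : sval (xg (a *: m + m')) = a * sval (xg m) + sval (xg m').
    apply: x_inj; rewrite mulrDr mulrCA.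
    by rewrite !(svalP (xg _)) dual_linear.
  exists (mk_dual hl); apply/rowP => i; apply: x_inj; rewrite !mxE.
  by move/rowP: cg => /(_ i); rewrite !mxE => ->; rewrite -(svalP (xg _)).
pose psi c := if pselect (K c) is left h then dual_apply phi (sval (cid h)) else 0.
have psiE g : psi (val g) = dual_apply phi g.
  rewrite /psi; case: pselect => [h|[]]; last by exists g.
  by case: (cid h) => g' /= /val_inj ->.
have psil : linear_on K psi.
  by move=> a _ _ [g ->] [h ->]; rewrite -val_lin !psiE dual_linear.
have accA := fg_acc (ribbon_noeth rA) (fg_rV A n).
have [Phi Phil PhiK] := linear_on_extend rA accA KS Ks psil.
exists (\sum_i Phi (delta_mx 0 i) *: u i); apply: dualP => g.
rewrite {1}/dual_apply /= dual_apply_sum -psiE -PhiK; last by exists g.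
by rewrite (linear_on_rV _ Phil); apply: eq_bigr => i _; rewrite mxE mulrC.
Qed.

Lemma biduality_inj : fg_module M -> (forall m : M, x *: m = 0 -> m = 0) ->
  injective (@biduality A M).
Proof.
move=> Mfg xM m n mn; apply: contrapT => /eqP; rewrite -subr_eq0 => /eqP mn0.
have s0 : saturated x [set (0 : M)] by move=> p; apply: xM.
have [|phi [phil _ []]] := linear_separate rA
  (fg_acc (ribbon_noeth rA) Mfg) (submodule0 M) s0 (f := m - n).
  exact: mn0.
have phil' a p q : phi (a *: p + q) = a * phi p + phi q by apply: phil.
pose f : dual M := mk_dual phil'.
have fmn : phi m = phi n := congr1 (fun h => dual_apply h f) mn.
by rewrite addrC -scaleN1r phil' fmn mulN1r addNr.
Qed.

Lemma bijective_of_inj_surj T U (f : T -> U) : injective f ->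
  (forall y, exists t, f t = y) -> bijective f.
Proof.
move=> fi fs; pose g y := sval (cid (fs y)).
have fg y : f (g y) = y by apply: (svalP (cid (fs y))).
by exists g => // t; apply: fi.
Qed.

Hypotheses (lA : local_ring A) (xm : ~ is_unit x).

Lemma reflexive_regular : reflexive_module M -> forall m : M, x *: m = 0 -> m = 0.
Proof.
move=> /bij_inj Minj m xm0; apply: Minj; apply: dualP => f.
change (dual_apply f m = dual_apply f 0); rewrite dual_apply0.
by apply: (ribbon_reg rA); rewrite -dual_applyZ xm0 dual_apply0.
Qed.

(** A nonzero m in N gives the l + 2 submodules A x^j m, for j from l + 1 down to 0, one more than
    the bound l allows. They are distinct: otherwise p = b p for some p = x^j m, with b a multiple
    of x, and 1 - b is a unit because A is local. *)
Lemma regular_torsion_free : (forall m : M, x *: m = 0 -> m = 0) ->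
  torsion_free_module M.
Proof.
move=> xM N NS [l Nl] m Nm; apply: contrapT => m0.
have xMn n (p : M) : x ^+ n *: p = 0 -> p = 0.
  elim: n => [|n IH]; first by rewrite scale1r.
  by rewrite exprS -scalerA => /xM /IH.
pose c (i : 'I_l.+2) : set M := [set p | exists a, p = a *: (x ^+ (l.+1 - i) *: m)].
have /= := Nl l.+1 c _ _; rewrite ltnn => H; suff: false by []; apply: H.
  move=> i; split; last first.
    by move=> _ [a ->]; case: NS => _ _ NZ; apply/NZ/NZ.
  split; first by exists 0; rewrite scale0r.
    by move=> _ _ [a ->] [b ->]; exists (a + b); rewrite scalerDl.
  by move=> a _ [b ->]; exists (a * b); rewrite scalerA.
move=> i k ik; split.
  move=> _ [a ->]; exists (a * x ^+ (k - i)).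
  rewrite !scalerA -mulrA -exprD; congr (_ * _ ^+ _ *: _).
  by have := ltn_ord k; lia.
move=> /(_ (x ^+ (l.+1 - k) *: m)) [].
  by exists 1; rewrite scale1r.
move=> a am; apply: m0; apply: (xMn (l.+1 - k)%N).
have ki : (l.+1 - i = (k - i) + (l.+1 - k))%N by have := ltn_ord k; lia.
move: am; rewrite ki exprD scalerA mulrA -scalerA.
set p := _ *: m; set b := a * _ => pE.
have [_ /(_ (1 - b) b)] := lA; rewrite subrK => H.
have [[u bu]|b1] := EM (is_unit (1 - b)).
  rewrite -[p]scale1r -bu mulrC -scalerA scalerBl scale1r -pE subrr.
  by rewrite scaler0.
case: (H b1); last by exists 1; rewrite mulr1.
move=> [u bu]; apply: xm; exists (a * x ^+ (k - i).-1 * u).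
rewrite -bu /b -{2}(prednK (n := k - i)) ?subn_gt0 // exprS.
by rewrite !mulrA [x * a]mulrC.
Qed.

(* The submodules of A m, for x m = 0, are 0, A z m and A m. *)
Lemma torsion_free_regular : torsion_free_module M ->
  forall m : M, x *: m = 0 -> m = 0.
Proof.
move=> Mtf m xm0; pose N : set M := [set p | exists a, p = a *: m].
have NS : is_submodule N.
  split; first by exists 0; rewrite scale0r.
    by move=> _ _ [a ->] [b ->]; exists (a + b); rewrite scalerDl.
  by move=> a _ [b ->]; exists (a * b); rewrite scalerA.
apply: (Mtf N NS); last by exists 1; rewrite scale1r.
exists 2%N => n c cS clt.
(* Among submodules of A m, this count of the members of {m, z m} in K grows at each strict
   inclusion; it is at most 2, whence the bound on chains. *)
pose h (K : set M) : nat := (`[< K m >] + `[< K (z *: m) >])%N.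
have hlt K L : is_submodule K -> is_submodule L -> L `<=` N -> K `<` L ->
    (h K < h L)%N.
  move=> KS LS LN [KL LK].
  have [K0 KD KZ] := KS; have [L0 LD LZ] := LS.
  have [y Ly Ky] : exists2 y, L y & ~ K y.
    apply: contrapT => nLK; apply: LK => y Ly; apply: contrapT => Ky.
    by apply: nLK; exists y.
  suff : L m /\ ~ K m \/ L (z *: m) /\ ~ K (z *: m).
    have mono p : (`[< K p >] <= `[< L p >])%N.
      by case: asboolP => // /KL; case: asboolP.
    have m1 := mono m; have m2 := mono (z *: m).
    rewrite /h /=; case=> -[/asboolT E1 /asboolF E2].
      by move: m2; rewrite E1 E2; lia.
    by move: m1; rewrite E1 E2; lia.
  have [a yE] := LN _ Ly; rewrite {}yE in Ly Ky.
  have unit_case b p : is_unit b -> L (b *: p) -> ~ K (b *: p) -> L p /\ ~ K p.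
    move=> [u bu] Lp Kp; split; last by move=> /(KZ b).
    by rewrite -[p]scale1r -bu mulrC -scalerA; apply: LZ.
  have [ua|[b [d aE]]] := ribbon_unit rA a; first by left; apply: unit_case Ky.
  have azm : a *: m = d *: (z *: m).
    by rewrite aE scalerDl -scalerA xm0 scaler0 add0r scalerA.
  rewrite azm in Ly Ky.
  have [ud|[b' [d' dE]]] := ribbon_unit rA d; first by right; apply: unit_case Ky.
  case: Ky; rewrite dE scalerDl -!scalerA [x *: (z *: m)]scalerA mulrC.
  rewrite -[(z * x) *: m]scalerA xm0 !scaler0 add0r [z *: _]scalerA (ribbon_sqr0 rA).
  by rewrite scale0r scaler0.
have hi (i : 'I_n.+1) : (i <= h (c i))%N.
  case: i => i /=; elim: i => // i IH ii.
  have ii' := ltnW ii; apply: leq_ltn_trans (IH ii') _.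
  by apply: hlt; [case: (cS (Ordinal ii'))|case: (cS (Ordinal ii))|
    case: (cS (Ordinal ii))|apply: clt].
apply: leq_trans (hi ord_max) _; rewrite /h.
by case: `[< _ >]; case: `[< _ >].
Qed.

Theorem reflexive_module_torsion_free : fg_module M ->
  reflexive_module M <-> torsion_free_module M.
Proof.
move=> Mfg; split=> [/reflexive_regular|]; first exact: regular_torsion_free.
move=> /torsion_free_regular xM; apply: bijective_of_inj_surj.
  exact: biduality_inj.
by move=> phi; apply: biduality_surj.
Qed.

End ModuleReflexivity.

(** * Zariski's lemma over an uncountable field *)

(* Cantor's nested intervals: the n-th one avoids f n. *)
Lemma real_sequence_misses (R : realType) (f : nat -> R) :
  exists x, forall n, f n <> x.
Proof.
pose d (p : R * R) := (p.2 - p.1) / 3.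
pose step n (p : R * R) :=
  if f n <= p.1 + d p then (p.1 + 2 * d p, p.2) else (p.1, p.1 + d p).
pose I := fix I n := if n is m.+1 then step m (I m) else (0, 1).
have I_lt n : (I n).1 < (I n).2.
  elim: n => [|n]; first by rewrite /=; lra.
  by rewrite /= /step /d; case: (I n) => a b /= ab; case: ifP => _ /=; lra.
have I_step n : (I n).1 <= (I n.+1).1 /\ (I n.+1).2 <= (I n).2.
  have := I_lt n; rewrite /= /step /d; case: (I n) => a b /= ab.
  by case: ifP => _ /=; lra.
have I_mono n k : (I n).1 <= (I (n + k)%N).1 /\ (I (n + k)%N).2 <= (I n).2.
  elim: k => [|k [le1 le2]]; first by rewrite addn0.
  by rewrite addnS; have [] := I_step (n + k)%N; lra.
have I_le n m : (I n).1 <= (I m).2.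
  have [_ le1] := I_mono m n; have [le2 _] := I_mono n m.
  by rewrite addnC in le1; have := I_lt (n + m)%N; lra.
pose S : set R := range (fun n => (I n).1).
have S_sup : has_sup S.
  by split; [exists (I 0%N).1, 0%N|exists (I 0%N).2 => _ [n _ <-]].
exists (sup S) => n fn.
have le1 : (I n.+1).1 <= sup S by apply: ub_le_sup; [case: S_sup|exists n.+1].
have le2 : sup S <= (I n.+1).2.
  by apply: ge_sup; [case: S_sup|move=> _ [m _ <-]].
move: le1 le2; rewrite -fn /= /step; have := I_lt n; rewrite /d.
by case: (I n) => a b /= ab; case: ifP => /= [|/negbT]; rewrite -?Order.TotalTheory.ltNge; lra.
Qed.

Lemma real_uncountable (R : realType) : ~ countable [set: R].
Proof.
move=> /countable_injP [f finj].
have [x xP] := real_sequence_misses (fun n => xget 0 [set r | f r = n]).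
apply: (xP (f x)); case: xgetP => [r _ /= fr|/(_ x) []//].
by apply: finj; rewrite ?inE.
Qed.

(** Otherwise R would be a countable union of finite sets. This is the pigeonhole that fixes an
    exponent and a dimension for infinitely many scalars. *)
Lemma infinite_fiber (R : realType) (T : countType) (f : R -> T) :
  exists t, infinite_set [set r | f r = t].
Proof.
apply: contrapT => fin.
apply: (@real_uncountable R).
have -> : [set: R] = \bigcup_t [set r | f r = t].
  by apply/esym; rewrite -subTset => r _; exists (f r).
apply: bigcup_countable; first exact: countableP.
move=> t _; apply: finite_set_countable; apply: contrapT => inf.
by apply: fin; exists t.
Qed.

Section UncountableNullstellensatz.
Variables (R : realType) (D : comNzRingType) (s : {rmorphism R[i] -> D}).
Hypothesis (fgD : fg_algebra s).
Hypothesis (domD : forall a b : D, a * b = 0 -> a = 0 \/ b = 0).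

Definition combination (v : nat -> D) (a : D) (N : nat) :=
  exists c : nat -> R[i], a = \sum_(i < N) s (c i) * v i.

Lemma combination_leq v a N N' :
  (N <= N')%N -> combination v a N -> combination v a N'.
Proof.
move=> NN' [c ->]; exists (fun i => if (i < N)%N then c i else 0).
rewrite (big_ord_widen N' (fun i => s (c i) * v i) NN') big_mkcond.
by apply: eq_bigr => i _; case: ifP; rewrite // rmorph0 mul0r.
Qed.

(** The family v lists the monomials in the generators through codes of words. The induction of
    [fg_algebra] is run on the a that multiply the span C into itself: this set is visibly closed
    under products, so two combinations are never multiplied. *)
Lemma fg_algebra_countable :
  exists v : nat -> D, forall a, exists N, combination v a N.
Proof.
have [n [y yP]] := fgD.
pose w (l : seq 'I_n) : D := \prod_(i <- l) y i.
pose v k : D := w (odflt [::] (unpickle k)).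
pose C : set D := [set a | exists N, combination v a N].
have C0 : C 0 by exists 0%N, (fun=> 0); rewrite big_ord0.
have CD a b : C a -> C b -> C (a + b).
  move=> [N aN] [N' bN'].
  have [c ->] := combination_leq (leq_maxl N N') aN.
  have [d ->] := combination_leq (leq_maxr N N') bN'.
  exists (maxn N N'), (fun i => c i + d i); rewrite -big_split.
  by apply: eq_bigr => i _; rewrite rmorphD mulrDl.
have Cs c a : C a -> C (s c * a).
  move=> [N [d ->]]; exists N, (fun i => c * d i); rewrite mulr_sumr.
  by apply: eq_bigr => i _; rewrite rmorphM mulrA.
have Cw l : C (w l).
  exists (pickle l).+1, (fun i => (i == pickle l)%:R).
  rewrite big_ord_recr /= eqxx rmorph1 mul1r /v pickleK /= big1 ?add0r // => i _.
  by rewrite (ltn_eqF (ltn_ord i)) rmorph0 mul0r.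
have Csum N (c : nat -> R[i]) (u : nat -> D) : (forall i, C (u i)) ->
    C (\sum_(i < N) s (c i) * u i).
  by move=> Cu; apply: (big_ind C) => // i _; apply: Cs.
exists v => a; pose S : set D := [set a | forall b, C b -> C (a * b)].
suff : S a by move=> /(_ 1); rewrite mulr1; apply; have := Cw [::]; rewrite /w big_nil.
apply: (yP S).
- by move=> c b; apply: Cs.
- move=> i _ [N [c ->]]; rewrite mulr_sumr.
  under eq_bigr do rewrite mulrCA.
  apply: (Csum N c (fun k => y i * v k)) => k; have := Cw (i :: odflt [::] (unpickle k)).
  by rewrite /w big_cons.
- by move=> b b' Sb Sb' d Cd; rewrite mulrDl; apply: CD; [apply: Sb|apply: Sb'].
- by move=> b b' Sb Sb' d Cd; rewrite -mulrA; apply/Sb/Sb'.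
Qed.

(** R[i] is algebraically closed: p splits, and in a domain one of its linear factors vanishes at
    t. *)
Lemma horner_map_root (p : {poly R[i]}) t :
  p != 0 -> (map_poly s p).[t] = 0 -> exists c, t = s c.
Proof.
move=> p0; have [l pE] := closed_field_poly_normal p.
rewrite pE map_polyZ hornerZ => /domD [].
  have lp : lead_coef p * (lead_coef p)^-1 = 1.
    by rewrite mulfV // lead_coef_eq0.
  move=> lp0; have := congr1 s lp; rewrite rmorphM lp0 mul0r rmorph1.
  by move=> /esym /eqP; rewrite oner_eq0.
rewrite rmorph_prod horner_prod; elim: l {pE} => [|c l IH].
  by rewrite big_nil => /eqP; rewrite oner_eq0.
rewrite big_cons => /domD [|//].
by rewrite rmorphB /= map_polyX map_polyC hornerXsubC => /subr0_eq; exists c.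
Qed.

(* Otherwise f^e / (t - c), for c in the uncountable field, would be
   uncountably many independent vectors in a space of countable dimension. *)
Theorem fg_domain_scalar (f : D) : f <> 0 ->
  (forall a, a <> 0 -> exists e d, a * d = f ^+ e) ->
  forall t, exists c, t = s c.
Proof.
move=> f0 fP t; apply: contrapT => ts.
have [v vP] := fg_algebra_countable.
(* The real scalars are already uncountable. Each t - r is nonzero because t is not a scalar; the
   pair records the exponent e of f and a number N of vectors of v that suffice for d = f^e / (t -
   r). *)
have inv (r : R) : {p : nat * nat | exists d,
    (t - s r%:C%C) * d = f ^+ p.1 /\ combination v d p.2}.
  apply: cid; have [|e [d E]] := fP (t - s r%:C%C).
    by move=> /subr0_eq tE; apply: ts; exists r%:C%C.
  by have [N dN] := vP d; exists (e, N), d.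
have [[e N]] := infinite_fiber (fun r => sval (inv r)).
move=> /(infinite_set_fset (N : nat).+1) [X XP NX].
pose r (i : 'I_N.+1) : R := nth 0 (finmap.enum_fset X) i.
have rX i : r i \in finmap.enum_fset X by apply: mem_nth; apply: leq_trans NX.
have rinj : injective r.
  move=> i k /eqP; rewrite nth_uniq ?(leq_trans _ NX) // => [/eqP/val_inj //|].
  exact: finmap.fset_uniq.
have dP i : exists p : D * (nat -> R[i]), (t - s (r i)%:C%C) * p.1 = f ^+ e /\
    p.1 = \sum_(j < N) s (p.2 j) * v j.
  have /= := XP _ (rX i) => E; have := svalP (inv (r i)); rewrite E /=.
  by move=> [d [dE [c dc]]]; exists (d, c).
pose d i := (sval (cid (dP i))).1; pose c i := (sval (cid (dP i))).2.
have dE i : (t - s (r i)%:C%C) * d i = f ^+ e := (svalP (cid (dP i))).1.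
have dc i : d i = \sum_(j < N) s (c i j) * v j := (svalP (cid (dP i))).2.
pose M : 'M[R[i]]_(N.+1, N) := \matrix_(i, j) c i j.
(* N + 1 vectors in the span of N: u is a nontrivial linear relation between the d i. *)
have /rowV0Pn [u /sub_kermxP uM u0] : kermx M != 0.
  by rewrite kermx_eq0 /row_free; have := rank_leq_col M; lia.
have ud : \sum_i s (u 0 i) * d i = 0.
  under eq_bigr => i _ do rewrite dc mulr_sumr.
  rewrite exchange_big big1 //= => j _.
  under eq_bigr => i _ do rewrite mulrA -rmorphM.
  rewrite -mulr_suml -rmorph_sum /=.
  have /rowP /(_ j) := uM; rewrite !mxE => uMj.
  have -> : \sum_i u 0 i * c i j = 0.
    by rewrite -[RHS]uMj; apply: eq_bigr => i _; rewrite mxE.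
  by rewrite rmorph0 mul0r.
pose q i : {poly R[i]} := \prod_(j | j != i) ('X - ((r j)%:C%C)%:P).
(* Clearing denominators in the sum of the u_i f^e / (t - r_i) gives f^e p(t) = 0. The polynomial p
   is nonzero: at r_i0 only the term i0 survives. *)
pose p := \sum_i u 0 i *: q i.
have [i0 ui0] : exists i, u 0 i != 0 by apply/rV0Pn.
apply: ts; apply: (horner_map_root (p := p)).
  apply/eqP => /(congr1 (fun p => p.[(r i0)%:C%C])) /eqP.
  rewrite horner0 /p horner_sum (bigD1 i0) //= big1 => [|i ii0]; last first.
    rewrite hornerZ horner_prod (bigD1 i0) 1?eq_sym //= hornerXsubC subrr.
    by rewrite mul0r mulr0.
  rewrite addr0 hornerZ mulf_eq0 (negPf ui0) horner_prod /=.
  apply/negP/prodf_neq0 => j ji.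
  rewrite hornerXsubC subr_eq0; apply: contra ji => /eqP /complexI rij.
  by apply/eqP/rinj.
have fX0 n : f ^+ n <> 0.
  elim: n => [/eqP|n IH]; first by rewrite oner_eq0.
  by rewrite exprS => /domD [].
suff /domD [/fX0 //|//] : f ^+ e * (map_poly s p).[t] = 0.
transitivity (\prod_j (t - s (r j)%:C%C) * \sum_i s (u 0 i) * d i); last first.
  by rewrite ud mulr0.
rewrite /p rmorph_sum horner_sum !mulr_sumr.
apply: eq_bigr => i _; rewrite /= map_polyZ hornerZ rmorph_prod horner_prod.
rewrite -(dE i) [in RHS](bigD1 i) //=.
under eq_bigr => j _ do rewrite rmorphB /= map_polyX map_polyC hornerXsubC.
by rewrite -!mulrA; congr (_ * _); rewrite mulrC mulrAC mulrC.
Qed.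

End UncountableNullstellensatz.

(** * Local rings of a double curve *)

Section LocalRings.
Implicit Types A B : comPzRingType.

Lemma is_unitM A (a b : A) : is_unit (a * b) <-> is_unit a /\ is_unit b.
Proof.
split=> [[c abc]|[[c ac] [d bd]]].
  by split; [exists (b * c); rewrite mulrA|exists (a * c); rewrite mulrCA mulrA].
by exists (c * d); rewrite mulrACA ac bd mulr1.
Qed.

Lemma is_unit1 A : is_unit (1 : A).
Proof. by exists 1; rewrite mulr1. Qed.

Lemma is_unitX A (a : A) n : is_unit a -> is_unit (a ^+ n).
Proof.
move=> ua; elim: n => [|n IH]; first exact: is_unit1.
by rewrite exprS is_unitM.
Qed.

Lemma is_unit_rmorph A B (f : {rmorphism A -> B}) a : is_unit a -> is_unit (f a).
Proof. by move=> [b ab]; exists (f b); rewrite -rmorphM ab rmorph1. Qed.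

Lemma unit_cancel A (a b : A) : is_unit a -> a * b = 0 -> b = 0.
Proof. by move=> [c ac] ab; rewrite -[b]mul1r -ac mulrAC ab mul0r. Qed.

Lemma nilp_unit A (a b : A) : is_unit a -> b * b = 0 -> is_unit (a + b).
Proof.
move=> [c ac] bb; exists (c * (1 - b * c)).
rewrite mulrDl mulrA ac mul1r mulrA mulrBr mulr1.
by rewrite [b * c * (b * c)]mulrACA bb mul0r subr0 subrK.
Qed.

Lemma local_not_unit0 A : local_ring A -> ~ is_unit (0 : A).
Proof. by move=> [n1 _] [b]; rewrite mul0r => /esym. Qed.

Lemma local_unit1B A (a b : A) : local_ring A -> ~ is_unit a ->
  is_unit (1 - b * a).
Proof.
move=> [_ lA] ua; apply: contrapT => u1.
have : ~ is_unit (1 - b * a + b * a).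
  by apply: lA => // /is_unitM [].
by rewrite subrK; apply; apply: is_unit1.
Qed.

Lemma prime_idealX A (I : set A) a n : prime_ideal I -> I (a ^+ n) -> I a.
Proof.
move=> [_ I1 IM]; elim: n => [/I1 //|n IH].
by rewrite exprS => /IM [].
Qed.

(** The maximal ideal is (x). If some nonzero element were not associate to a power of x, take (c)
    maximal among the ideals generated by such elements: c = d x with d of the same kind, so d = e c
    = e x d by maximality, and 1 - e x is a unit, so d = 0. *)
Lemma dvr_uniformizer B : regular_local B 1 -> exists x : B,
  [/\ ~ is_unit x, forall b, is_unit b \/ exists c, b = c * x,
      forall b, b = 0 \/ exists u n, is_unit u /\ b * u = x ^+ n &
      forall n, x ^+ n <> 0].
Proof.
move=> [lB nB [[p [pP plt]] _] [x0 xM]].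
pose x := x0 ord0.
have xu : ~ is_unit x.
  have : max_ideal x.
    rewrite xM; exists (fun=> 1).
    by rewrite (bigD1 ord0) //= mul1r big1 ?addr0 // => i; rewrite ord1.
  by [].
have xP b : is_unit b \/ exists c, b = c * x.
  have [?|ub] := EM (is_unit b); [by left|right].
  have : max_ideal b by [].
  by rewrite xM => -[c]; rewrite big_ord1 => ->; exists (c ord0).
exists x; split=> //.
- move=> b; apply: contrapT => nb.
  pose Q b := ~ (b = 0 \/ exists u n, is_unit u /\ b * u = x ^+ n).
  pose P : set (set B^o) := [set N | exists2 c, Q c & N = [set d | exists e, d = e * c]].
  have [||_ [c Qc ->] cmax] := acc_max (noetherian_acc nB) (P := P).
  + move=> _ [c _ ->]; split; first by exists 0; rewrite mul0r.
      by move=> _ _ [e ->] [e' ->]; exists (e + e'); rewrite mulrDl.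
    by move=> a _ [e ->]; exists (a * e); rewrite -mulrA.
  + by exists [set d | exists e, d = e * b], b.
  + have [[d cd]|[d cE]] := xP c.
      by apply: Qc; right; exists d, 0%N; split=> //; exists c; rewrite mulrC.
    have Qd : Q d.
      move=> [d0|[u [n [uu du]]]]; apply: Qc.
        by left; rewrite cE d0 mul0r.
      by right; exists u, n.+1; split=> //; rewrite cE mulrAC du exprSr.
    have Pd : P [set g | exists e, g = e * d] by exists d.
    have cd : [set g | exists e, g = e * c] `<=` [set g | exists e, g = e * d].
      by move=> _ [e ->]; exists (e * x); rewrite cE -mulrA [d * x]mulrC.
    have [|e dE] := cmax _ Pd cd d; first by exists 1; rewrite mul1r.
    apply: Qd; left; apply: (unit_cancel (local_unit1B e lB xu)).
    by rewrite mulrBl mul1r {1}dE cE mulrAC !mulrA subrr.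
(* A nilpotent x lies in every prime, so the smaller prime of the chain would contain the maximal
   ideal (x), hence the larger prime. *)
- move=> n xn0.
  have [p01 p10] := plt ord0 ord_max isT.
  apply: p10 => b p1b; have [[[p00 _ pM] _ _] [_ p11 _]] := (pP ord0, pP ord_max).
  have [[c bc]|[c ->]] := xP b.
    case: p11; rewrite -bc mulrC; have [[_ _ +] _ _] := pP ord_max.
    by apply.
  by apply: pM; apply: (prime_idealX (n := n) (pP ord0)); rewrite xn0.
Qed.

Section Thickening.
Variables (A B : comPzRingType) (f : {rmorphism A -> B}) (z : A).
Hypotheses (fsurj : forall b, exists a, f a = b)
  (fker : forall a, f a = 0 <-> exists c, a = c * z) (zz : z * z = 0).

Lemma thickening_unit a : is_unit (f a) -> is_unit a.
Proof.
move=> [b]; have [c <-] := fsurj b; rewrite -rmorphM => ac.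
have [d acd] : exists d, a * c - 1 = d * z.
  by apply/fker; rewrite rmorphB ac rmorph1 subrr.
have : is_unit (a * c).
  rewrite -[a * c](subrK 1) addrC acd; apply: nilp_unit; first exact: is_unit1.
  by rewrite mulrACA zz mulr0.
by move=> /is_unitM [].
Qed.

Lemma thickening_field_ribbon : noetherian A ->
  (forall b : B, b <> 0 -> is_unit b) -> ribbon z 1.
Proof.
move=> nA Bf; split=> //.
- by move=> a; rewrite mul1r.
- move=> a; have [/fker ?|/Bf /thickening_unit [b ab]] := EM (f a = 0).
    by left.
  by right; exists b, 0, 0%N; rewrite mul0r addr0 expr0.
- by move=> a; right; exists a, 0; rewrite mulr1 mul0r addr0.
Qed.

(** The chain of two primes of B pulls back to A, so the Cohen-Macaulay sequence has a first term
    y0, regular and not a unit. Its square is not 0, so y0 is outside (z), and y0 b = x^m + c z with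
    b a unit and m positive. If x w = 0, then y0 b w = c z w, and applying y0 b twice kills w since
    z^2 = 0; hence w = 0. *)
Lemma thickening_dvr_ribbon : cohen_macaulay_local A -> regular_local B 1 ->
  exists2 x, ribbon z x & ~ is_unit x.
Proof.
move=> [lA nA [n [y [[_ dimA] ynu yreg]]]] regB.
have [xB [xBu xBg xBp xB0]] := dvr_uniformizer regB.
have [x fx] := fsurj xB.
have xu : ~ is_unit x by move=> /(is_unit_rmorph f); rewrite fx.
have [y0 y0u y0reg] : exists2 y0 : A, ~ is_unit y0 & forall a, y0 * a = 0 -> a = 0.
  have [_ _ [[p [pP plt]] _] _] := regB.
  have n0 : (0 < n)%N.
    apply: (dimA 1%N (fun i => f @^-1` (p i))); split=> [i|i k ik].
      have [[p0 pD pM] p1 pPr] := pP i; split=> [|/=|a b /=].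
      - split=> [|a b|a b] /=; rewrite ?rmorph0 ?rmorphD ?rmorphM //.
          exact: pD.
        exact: pM.
      - by rewrite rmorph1.
      - by rewrite rmorphM => /pPr.
    have [pik pki] := plt i k ik; split=> [a|H]; first exact: pik.
    by apply: pki => b; have [a <-] := fsurj b; apply: H.
  exists (y (Ordinal n0)); first exact: ynu.
  move=> a ya; have [|c ->] := yreg (Ordinal n0) a.
    by exists (fun=> 0); rewrite ya big_pred0.
  by rewrite big_pred0.
have dvd a : (exists c, a = c * z) \/
    exists b c n, is_unit b /\ a * b = x ^+ n + c * z.
  have [/fker ?|[u [m [uu au]]]] := xBp (f a); [by left|right].
  have [b fb] := fsurj u; exists b.
  have [c abc] : exists c, a * b - x ^+ m = c * z.
    by apply/fker; rewrite rmorphB rmorphM fb rmorphXn fx au subrr.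
  exists c, m; split; first by apply: thickening_unit; rewrite fb.
  by rewrite -abc addrC subrK.
exists x => //; split=> // [w xw|a|a].
- have [[c y0E]|[b [c [m [ub y0b]]]]] := dvd y0.
    have y00 : y0 = 0 by apply: y0reg; rewrite y0E mulrACA zz mulr0.
    have [A1 _] := lA; case: A1; apply: y0reg.
    by rewrite y00 mul0r.
  case: m y0b => [|m] y0b.
    case: y0u; suff /is_unitM[] : is_unit (y0 * b) by [].
    rewrite y0b; apply: nilp_unit; first exact: is_unit1.
    by rewrite mulrACA zz mulr0.
  have xmw : x ^+ m.+1 * w = 0 by rewrite exprSr -mulrA xw mulr0.
  have ybw : y0 * b * w = c * z * w by rewrite y0b mulrDl xmw add0r.
  have : y0 * (b * (y0 * (b * w))) = 0.
    rewrite [y0 * (b * w)]mulrA ybw mulrA [c * z * w]mulrC mulrA ybw.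
    by rewrite mulrAC mulrACA zz mulr0 mul0r.
  move=> /y0reg /(unit_cancel ub) /y0reg.
  exact: unit_cancel.
- have [?|[b [c [m [_ ab]]]]] := dvd a; [by left|right].
  by exists b, c, m.
- have [/thickening_unit ?|[b fa]] := xBg (f a); [by left|right].
  have [b' fb'] := fsurj b; exists b'.
  have [c acE] : exists c, a - b' * x = c * z.
    by apply/fker; rewrite rmorphB rmorphM fb' fx -fa subrr.
  by exists c; rewrite -acE addrC subrK.
Qed.

End Thickening.
End LocalRings.

(** * Points of schemes *)

Section RingedSpaces.
Variables (k : fieldType) (X : ringed_space k).
Implicit Types U V W : opens X.

Lemma sect_empty U (s t : sect X U) : (forall y, ~ U y) -> s = t.
Proof.
move=> U0; have VU : forall i : False, U `<=` U by [].
have cU : covers (fun _ : False => U) U by move=> y /U0.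
by apply: (sect_ext VU cU) => -[].
Qed.

Lemma sect_local U (s t : sect X U) :
  (forall y, U y -> exists (V : opens X) (VU : V `<=` U), V y /\ res VU s = res VU t) ->
  s = t.
Proof.
move=> loc.
pose I := {V : opens X | exists VU : V `<=` U, res VU s = res VU t}.
have VU (i : I) : sval i `<=` U by case: (svalP i).
apply: (sect_ext VU) => [y Uy|i].
  by have [V [VU' [Vy E]]] := loc y Uy; exists (exist _ V (ex_intro _ VU' E)).
by case: (svalP i) => VU' E; rewrite !(res_irr _ VU').
Qed.

Lemma sect_germ U (s t : sect X U) :
  (forall y (Uy : U y), germ Uy s = germ Uy t) -> s = t.
Proof.
move=> st; apply: sect_local => y Uy.
have [V [VU [VU' [Vy E]]]] := (germ_eqP Uy Uy s t).1 (st y Uy).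
by exists V, VU; split; rewrite // E (res_irr _ VU).
Qed.

Lemma germ_unit_nbhd U y (Uy : U y) s : is_unit (germ Uy s) ->
  exists (V : opens X) (VU : V `<=` U), V y /\ is_unit (res VU s).
Proof.
move=> [b]; have [W [Wy [t ->]]] := germ_surj b.
pose UW := openI U W; have UWy : UW y by [].
rewrite -(germ_res (@openI_subl _ U W) Uy UWy).
rewrite -(germ_res (@openI_subr _ U W) Wy UWy) -rmorphM.
rewrite -(rmorph1 (germ UWy)) => /germ_eqP [V [VUW [VUW' [Vy E]]]].
have VU : V `<=` U by apply: subset_trans VUW (@openI_subl _ _ _).
exists V, VU; split=> //; exists (res VUW (res (@openI_subr _ U W) t)).
by move: E; rewrite rmorphM rmorph1 (res_comp _ VUW VU).
Qed.

Lemma basicE U (f : sect X U) y (Uy : U y) : basic f y = is_unit (germ Uy f).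
Proof.
apply/propext; split=> [[Uy'] fu|fu]; last by exists Uy.
by rewrite (Prop_irrelevance Uy Uy').
Qed.

Lemma finite_openI n (V : 'I_n -> opens X) y : (forall i, V i y) ->
  exists W, W y /\ forall i, W `<=` V i.
Proof.
elim: n V => [|n IH] V Vy; first by exists (openT X); split=> // -[].
have [W [Wy WV]] := IH (fun i => V (widen_ord (leqnSn n) i)) (fun i => Vy _).
exists (openI W (V ord_max)); split=> // i t [Wt Vt].
have [im|im] := eqVneq i ord_max; first by rewrite im.
have ltin : (i < n)%N.
  by have := ltn_ord i; move: im; rewrite -val_eqE /=; lia.
have -> : i = widen_ord (leqnSn n) (Ordinal ltin) by apply: val_inj.
exact: WV.
Qed.

Lemma germ_family_eq n U (s t : 'I_n -> sect X U) y (Uy : U y) :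
  (forall i, germ Uy (s i) = germ Uy (t i)) ->
  exists (V : opens X) (VU : V `<=` U), V y /\ forall i, res VU (s i) = res VU (t i).
Proof.
move=> st; have H i : {V : opens X | exists VU : V `<=` U, V y /\ res VU (s i) = res VU (t i)}.
  apply: cid; have [V [VU [VU' [Vy E]]]] := (germ_eqP Uy Uy _ _).1 (st i).
  by exists V, VU; split; rewrite // E (res_irr _ VU).
have [|W [Wy WV]] := @finite_openI n (fun i => sval (H i)) y.
  by move=> i; case: (svalP (H i)) => ? [].
have WU : openI U W `<=` U by apply: openI_subl.
exists (openI U W), WU; split=> // i.
case: (svalP (H i)) => VU [_ E].
have WVi : openI U W `<=` sval (H i).
  by apply: subset_trans (@openI_subr _ _ _) (WV i).
by rewrite -(res_comp VU WVi WU) E (res_comp VU WVi WU).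
Qed.

Lemma germ_family n y (a : 'I_n -> stalk X y) :
  exists U (Uy : U y) (s : 'I_n -> sect X U), forall i, a i = germ Uy (s i).
Proof.
have H i : {p : {U : opens X & sect X U} | exists Uy : projT1 p y,
    a i = germ Uy (projT2 p)}.
  apply: cid; have [U [Uy [s ->]]] := germ_surj (a i).
  by exists (existT _ U s), Uy.
have [|W [Wy WV]] := @finite_openI n (fun i => projT1 (sval (H i))) y.
  by move=> i; case: (svalP (H i)).
exists W, Wy, (fun i => res (WV i) (projT2 (sval (H i)))) => i.
by case: (svalP (H i)) => Uy aE; rewrite [LHS]aE germ_res.
Qed.

Section Affine.
Variable U : opens X.
Hypothesis affU : affine U.

Lemma affine_basic V y : U y -> V y ->
  exists f : sect X U, basic f y /\ basic f `<=` V.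
Proof.
move=> Uy Vy; have [_ _ Ub _] := affU.
have [|//|f [fy fV]] := Ub (openI U V) y; first exact: openI_subl.
by exists f; split=> // t /fV [].
Qed.

Lemma affine_sect V y (s : sect X V) : U y -> V y ->
  exists (f : sect X U) (fV : basic f `<=` V) e a, basic f y /\
    res (@basic_sub _ _ U f) f ^+ e * res fV s = res (@basic_sub _ _ U f) a.
Proof.
move=> Uy Vy; have [f [fy fV]] := affine_basic Uy Vy.
have [_ _ _ /(_ f) [_ fl _]] := affU; have [e [a fa]] := fl (res fV s).
by exists f, fV, e, a.
Qed.

Lemma affine_res_basic0 (f a : sect X U) : res (@basic_sub _ _ U f) a = 0 ->
  exists e, f ^+ e * a = 0.
Proof. by have [_ _ _ /(_ f) [_ _]] := affU; apply. Qed.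

Lemma affine_germ0 (a : sect X U) y (Uy : U y) : germ Uy a = 0 ->
  exists f, is_unit (germ Uy f) /\ f * a = 0.
Proof.
rewrite -(rmorph0 (germ Uy)) => /germ_eqP [W [WU [WU' [Wy E]]]].
have [f [fy fW]] := affine_basic Uy Wy.
have [|e fe] := affine_res_basic0 (f := f) (a := a).
  by rewrite -(res_comp WU fW) E rmorph0 rmorph0.
by exists (f ^+ e); rewrite rmorphXn; split=> //; apply: is_unitX; rewrite -basicE.
Qed.

Lemma affine_nilpotent (f : sect X U) : (forall y, ~ basic f y) ->
  exists e, f ^+ e = 0.
Proof.
move=> f0; have [|e fe] := affine_res_basic0 (f := f) (a := 1).
  exact: sect_empty.
by exists e; rewrite -[f ^+ e]mulr1.
Qed.

(** That y' is a specialization of y is written as: every open set containing y' contains y. On an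
    affine open set this is inclusion of vanishing ideals. *)
Lemma vanishing_ideal_le y y' (Uy : U y) (Uy' : U y') :
  (forall V, V y' -> V y) -> vanishing_ideal Uy `<=` vanishing_ideal Uy'.
Proof.
move=> yy' f fy fy'; apply: fy; rewrite -basicE; apply: yy'.
by rewrite basicE.
Qed.

Lemma vanishing_ideal_spec y y' (Uy : U y) (Uy' : U y') :
  vanishing_ideal Uy `<=` vanishing_ideal Uy' -> forall V, V y' -> V y.
Proof.
move=> yy' V Vy'; have [f [fy' fV]] := affine_basic Uy' Vy'.
apply: fV; rewrite basicE; apply: contrapT => fy.
by case: (yy' f fy); rewrite -basicE.
Qed.

Lemma affine_T0 y y' : U y -> U y' -> (forall V, V y <-> V y') -> y = y'.
Proof.
move=> Uy Uy' yy'; have [_ Ui _ _] := affU; apply: (Ui _ _ Uy Uy').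
by apply/seteqP; split; apply: vanishing_ideal_le => V /yy'.
Qed.

(* Zorn gives a maximal proper ideal above the vanishing ideal of y. *)
Lemma affine_closed_specialization y : U y -> exists y', [/\ U y',
  forall V, V y' -> V y &
  forall w, U w -> (forall V, V w -> V y') -> w = y'].
Proof.
move=> Uy; have [Up Ui _ _] := affU.
pose I := vanishing_ideal Uy.
have [[I0 ID IM] I1 _] : prime_ideal I by apply/Up; exists y, Uy.
(* Ideals above I are presented as unions J with I because Zorn's lemma also tests the empty chain,
   whose union is empty. *)
pose P : set (set (sect X U)) := [set J | is_ideal (J `|` I) /\ ~ (J `|` I) 1].
have [F FP Ftot|J [PJ Jmax]] := @Zorn_bigcup _ P.
  have FI J : F J -> J `|` I `<=` (\bigcup_(X in F) X) `|` I.
    by move=> FJ a [Ja|Ia]; [left; exists J|right].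
  have get a : (\bigcup_(X in F) X `|` I) a -> I a \/ exists2 J, F J & (J `|` I) a.
    by move=> [[J FJ Ja]|]; [right; exists J => //; left|left].
  split; first split.
  - by right.
  - move=> a b /get [Ia|[J FJ Ja]] /get [Ib|[J' FJ' Jb]].
    + by right; apply: ID.
    + apply: (FI J' FJ'); have [[_ JD _] _] := FP _ FJ'.
      by apply: JD => //; right.
    + apply: (FI J FJ); have [[_ JD _] _] := FP _ FJ.
      by apply: JD => //; right.
    + have [JJ'|J'J] := Ftot _ _ FJ FJ'.
        apply: (FI J' FJ'); have [[_ JD _] _] := FP _ FJ'.
        by apply: JD => //; case: Ja => [/JJ'|]; [left|right].
      apply: (FI J FJ); have [[_ JD _] _] := FP _ FJ.
      by apply: JD => //; case: Jb => [/J'J|]; [left|right].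
  - move=> a b /get [Ib|[J FJ Jb]]; first by right; apply: IM.
    by apply: (FI J FJ); have [[_ _ JM] _] := FP _ FJ; apply: JM.
  - move=> /get [//|[J FJ J1]].
    by have [_] := FP _ FJ; apply.
have [[J0 JD JM] J1] := PJ; pose K := J `|` I.
have Kmax a : ~ K a -> exists b c, K c /\ 1 = b * a + c.
  move=> Ka; apply: contrapT => n1.
  pose L : set (sect X U) := [set d | exists b c, K c /\ d = b * a + c].
  have KL : K `<=` L by move=> c Kc; exists 0, c; rewrite mul0r add0r.
  have LI : L `|` I = L.
    by apply/seteqP; split=> [d [//|Id]|]; [apply: KL; right|left].
  have La : L a by exists 1, 0; rewrite mul1r addr0.
  apply: (Jmax L).
    split; first by move=> b Jb; apply: KL; left.
    by move=> LJ; apply: Ka; left; apply: LJ.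
  split; rewrite LI; last by move=> [b [c [Kc E]]]; apply: n1; exists b, c.
  split; first exact: KL.
    move=> _ _ [b [c [Kc ->]]] [b' [c' [Kc' ->]]]; exists (b + b'), (c + c').
    by rewrite mulrDl addrACA; split=> //; apply: JD.
  move=> d _ [b [c [Kc ->]]]; exists (d * b), (d * c).
  by rewrite mulrDr mulrA; split=> //; apply: JM.
have /Up [y' [Uy' KE]] : prime_ideal K.
  split=> // a b Kab; have [?|/Kmax [c [d [Kd E]]]] := EM (K a); [by left|right].
  rewrite -[b]mul1r E mulrDl; apply: JD; last by rewrite mulrC; apply: JM.
  by rewrite -mulrA; apply: JM.
exists y'; split=> //.
  by apply: (vanishing_ideal_spec (Uy := Uy) (Uy' := Uy')); rewrite -KE; right.
move=> w Uw wy'; apply: (Ui _ _ Uw Uy'); apply/seteqP; split; last first.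
  exact: vanishing_ideal_le.
rewrite -KE => a wa; apply: contrapT => /Kmax [b [c [Kc E]]].
have [[_ wD wM] w1 _] : prime_ideal (vanishing_ideal Uw) by apply/Up; exists w, Uw.
apply: w1; rewrite E; apply: wD; first exact: wM.
by have := vanishing_ideal_le (Uy := Uy') (Uy' := Uw) wy'; rewrite -KE; apply.
Qed.

End Affine.

Lemma closed_set1P (y : X) :
  (forall w, (forall V, V w -> V y) -> w = y) -> closed [set y].
Proof.
move=> H w cw; apply: H => V Vw.
by have [|t [-> Vt]] := cw V; first exact: (open_nbhs_nbhs (conj (open_setP V) Vw)).
Qed.

Lemma closed_point_spec (y : X) : closed [set y] ->
  forall w, (forall V, V w -> V y) -> w = y.
Proof.
move=> /closed_openC oy w wy; apply: contrapT => wny.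
by have := wy (Opens oy) wny; apply.
Qed.

(** A point closed in one chart need not be closed in X, so the charts are treated in turn, q being
    moved to a specialization closed in the next chart. Nothing gained is lost: a specialization of
    the new point in an earlier chart is one of the old q, hence equals q; the new point is then in
    that chart too, and also equals q. *)
Lemma closed_specialization n (U : 'I_n -> opens X) :
  covers U (openT X) -> (forall i, affine (U i)) ->
  forall p, exists q, closed [set q] /\ forall V, V q -> V p.
Proof.
move=> cU affU p.
have H m : (m <= n)%N -> exists q, (forall V, V q -> V p) /\
    forall (i : 'I_n) y, (i < m)%N -> U i y -> (forall V, V y -> V q) -> y = q.
  elim: m => [|m IH] mn; first by exists p.
  have [q [qp qP]] := IH (ltnW mn); pose im := Ordinal mn.
  have [[y [Uy yq]]|ny] := EM (exists y, U im y /\ forall V, V y -> V q).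
    have [y' [Uy' yy' y'c]] := affine_closed_specialization (affU im) Uy.
    exists y'; split=> [V /yy' /yq /qp //|i w].
    rewrite ltnS leq_eqVlt => /orP [/eqP im'|im'] Uw wy'.
      have iE : i = im by apply: val_inj.
      by apply: y'c => //; rewrite -iE.
    have wq : w = q by apply: (qP i) => // V /wy' /yy' /yq.
    have Uiy' : U i y' by apply: wy'.
    by rewrite wq; apply/esym/(qP i) => // V /yy' /yq.
  exists q; split=> // i y; rewrite ltnS leq_eqVlt => /orP [/eqP im'|]; last exact: qP.
  have iE : i = im by apply: val_inj.
  by rewrite iE => Uy yq; case: ny; exists y.
have [q [qp qP]] := H n (leqnn n).
exists q; split=> //; apply: closed_set1P => w wq.
by have [i Uw] := cU w I; apply: (qP i).
Qed.

End RingedSpaces.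

Section Soberness.
Variables (k : fieldType) (X : scheme k).
Implicit Types U V W : opens X.

Lemma irreducible_meet (T : set X) V W : irreducible T ->
  T `&` V !=set0 -> T `&` W !=set0 -> T `&` (openI V W) !=set0.
Proof.
move=> [_ Tirr] [v [Tv Vv]] [w [Tw Ww]]; apply: contrapT => n0.
have [|||TV|TW] := Tirr (~` V) (~` W).
- exact/open_closedC/open_setP.
- exact/open_closedC/open_setP.
- move=> t Tt; apply: contrapT => /not_orP [/contrapT Vt /contrapT Wt].
  by apply: n0; exists t.
- exact: (TV v Tv).
- exact: (TW w Tw).
Qed.

(** In an affine open set meeting T, the sections invertible at no point of T form a prime ideal,
    that of q. As T is not assumed closed, q may lie outside T. *)
Lemma irreducible_generic (T : set X) : irreducible T ->
  exists q, forall V, V q <-> T `&` V !=set0.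
Proof.
move=> Tirr; have [[t Tt] _] := Tirr.
have [U Ut affU] := affine_nbhd t; have [Up _ _ _] := affU.
pose p : set (sect X U) := [set f | forall y, T y -> ~ basic f y].
have /Up [q [Uq pE]] : prime_ideal p.
  split; first split.
  - move=> y Ty [Uy]; rewrite rmorph0; apply: local_not_unit0.
    exact: locally_ringed.
  - move=> a b pa pb y Ty [Uy]; rewrite rmorphD.
    have [_] := locally_ringed y; apply; rewrite -basicE; [exact: pa|exact: pb].
  - move=> a b pb y Ty [Uy]; rewrite rmorphM => /is_unitM [_].
    by rewrite -basicE; apply: pb.
  - by move=> /(_ t Tt); apply; exists Ut; rewrite rmorph1; apply: is_unit1.
  - move=> a b pab; apply: contrapT => /not_orP [pa pb].
    have get f : ~ p f -> T `&` basic f !=set0.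
      move=> pf; apply: contrapT => n0; apply: pf => y Ty fy; apply: n0.
      by exists y.
    have [y [Ty [ay by_]]] := irreducible_meet Tirr (get a pa) (get b pb).
    apply: (pab y Ty); have [Uy _] := ay; rewrite basicE rmorphM is_unitM.
    by rewrite -!basicE.
exists q => V; split=> [Vq|TV].
  have [f [fq fV]] := affine_basic affU Uq Vq.
  have : ~ p f by rewrite pE => /=; rewrite /vanishing_ideal /= -basicE; apply.
  move=> pf; apply: contrapT => n0; apply: pf => y Ty fy; apply: n0.
  by exists y; split=> //; apply: fV.
have TU : T `&` U !=set0 by exists t.
have [y [Ty [Vy Uy]]] := irreducible_meet Tirr TV TU.
have [f [fy fV]] := affine_basic affU Uy Vy.
apply: fV; rewrite (basicE _ Uq); apply: contrapT => fq.
have : p f by rewrite pE.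
by move=> /(_ y Ty).
Qed.

End Soberness.

(** [polynomial_algebra] is a universal property and [fg_algebra] an induction principle; a subset
    closed under the operations is made into a ring so that it can be the target of a universal
    map. *)
Record subring (A : comPzRingType) := Subring {
  subring_set :> A -> Prop;
  subring1 : subring_set 1;
  subringB : forall a b, subring_set a -> subring_set b -> subring_set (a - b);
  subringM : forall a b, subring_set a -> subring_set b -> subring_set (a * b) }.

Section GeneratedSubring.
Variables (A : comPzRingType) (S : subring A).

Definition subring_pred : {pred A} := fun a => `[< S a >].

Lemma subring_pred_closed : GRing.subring_closed subring_pred.
Proof.
split=> [|a b|a b].
- exact/asboolP/subring1.
- by move=> /asboolP Sa /asboolP Sb; apply/asboolP/subringB.
- by move=> /asboolP Sa /asboolP Sb; apply/asboolP/subringM.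
Qed.
HB.instance Definition _ :=
  GRing.isSubringClosed.Build A subring_pred subring_pred_closed.

Record subring_of := SubringOf { subring_val : A; _ : subring_val \in subring_pred }.
HB.instance Definition _ := [isSub for subring_val].
HB.instance Definition _ := [Choice of subring_of by <:].
HB.instance Definition _ := 
  GRing.SubChoice_isSubComPzRing.Build A subring_pred subring_of subring_pred_closed.

Lemma subring_val_all (h : {rmorphism A -> subring_of}) :
  (forall a, \val (h a) = a) -> forall a, S a.
Proof. by move=> hE a; have := valP (h a); rewrite hE => /asboolP. Qed.
End GeneratedSubring.

(** The universal map from A to the subring S, followed by inclusion, is the identity by uniqueness,
    so S is all of A. *)
Lemma polynomial_algebra_fg (k A : comPzRingType) (s : {rmorphism k -> A})
    n (i0 : 'I_n) (x : 'I_n -> A) :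
  x i0 = 1 -> polynomial_algebra s i0 x -> fg_algebra s.
Proof.
move=> xi0 univ; exists n, x => S Ss Sx SD SM.
have S1 : S 1 by rewrite -xi0.
have SN a : S a -> S (- a).
  by move=> Sa; rewrite -mulN1r -(rmorph1 s) -rmorphN; apply: SM.
have SB a b : S a -> S b -> S (a - b) by move=> Sa /SN; apply: SD.
pose S' : subring A := Subring S1 SB SM.
pose B : comPzRingType := subring_of S'.
have inS a : S a -> a \in subring_pred S' by move=> Sa; apply/asboolP.
pose t c : B := SubringOf (inS _ (Ss c)).
have t_zmod : zmod_morphism t by move=> c d; apply: val_inj; apply: rmorphB.
have t_monoid : monoid_morphism t.
  by split=> [|c d]; apply: val_inj; [apply: rmorph1|apply: rmorphM].
pose tM : {rmorphism k -> B} := HB.pack t (GRing.isZmodMorphism.Build k B t t_zmod)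
  (GRing.isMonoidMorphism.Build k B t t_monoid).
have [h [hs hx] _] := univ B tM (fun i => SubringOf (inS _ (Sx i))).
have [g _ guniq] := univ A s x.
apply: (subring_val_all (S := S') (h := h)) => a.
pose vh : {rmorphism A -> A} := \val \o h.
have -> : \val (h a) = vh a by [].
rewrite (guniq vh) => [||i ii0] /=; last 2 first.
- by move=> c /=; rewrite hs.
- by rewrite hx.
by rewrite -(guniq idfun).
Qed.

(** * Stalks and closed immersions *)

Section StalkMap.
Variables (k : fieldType) (X Y : scheme k) (f : morphism Y X) (y : Y).

Definition stalk_map (a : stalk X (f y)) : stalk Y y :=
  germ (U := preim f (pg_open (repr a))) (pg_in (repr a))
    (pull f _ (pg_sect (repr a))).

Lemma stalk_mapE (U : opens X) (Ux : U (f y)) (Uy : preim f U y) s :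
  stalk_map (germ Ux s) = germ Uy (pull f U s).
Proof.
rewrite /stalk_map; have := esym (reprK (germ Ux s)).
case: (repr (germ Ux s)) => V Vx t /= /germ_eqP [W [WU [WV [Wx E]]]].
have VW : preim f W `<=` preim f V by move=> w /WV.
have UW : preim f W `<=` preim f U by move=> w /WU.
apply/germ_eqP; exists (preim f W), VW, UW; split=> //.
by rewrite !pull_res E.
Qed.

Lemma stalk_map_zmod : zmod_morphism stalk_map.
Proof.
move=> a b; have [U [Ux [s [t [-> ->]]]]] := germ_surj2 a b.
by rewrite -rmorphB !(stalk_mapE _ (Ux : preim f U y)) !rmorphB.
Qed.

Lemma stalk_map_monoid : monoid_morphism stalk_map.
Proof.
split=> [|a b].
  rewrite -(rmorph1 (germ (U := openT X) (x := f y) I)).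
  by rewrite (stalk_mapE _ (I : preim f (openT X) y)) !rmorph1.
have [U [Ux [s [t [-> ->]]]]] := germ_surj2 a b.
by rewrite -rmorphM !(stalk_mapE _ (Ux : preim f U y)) !rmorphM.
Qed.
HB.instance Definition _ :=
  GRing.isZmodMorphism.Build (stalk X (f y)) (stalk Y y) stalk_map stalk_map_zmod.
HB.instance Definition _ :=
  GRing.isMonoidMorphism.Build (stalk X (f y)) (stalk Y y) stalk_map
    stalk_map_monoid.

Lemma pull_unit (U : opens X) (Ux : U (f y)) (Uy : preim f U y) s :
  is_unit (germ Uy (pull f U s)) <-> is_unit (germ Ux s).
Proof.
split=> [|u]; last by rewrite -(stalk_mapE Ux); apply: is_unit_rmorph.
rewrite (Prop_irrelevance Uy (Ux : preim f U y)); exact: pull_local.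
Qed.

Lemma basic_pull (U : opens X) s : basic (pull f U s) y <-> basic s (f y).
Proof.
split=> [[Uy u]|[Ux u]]; first by exists Uy; apply: (pull_unit _ Uy s).1 u.
by exists Ux; apply: (pull_unit Ux _ s).2 u.
Qed.

End StalkMap.

Arguments stalk_map {k X Y} f y a.

Section ClosedImmersion.
Variables (k : fieldType) (X Y : scheme k) (f : morphism Y X).
Hypothesis fci : closed_immersion f.

Lemma closed_immersion_affine x : exists U : opens X,
  [/\ U x, affine U, affine (preim f U) & forall t, exists s, pull f U s = t].
Proof.
have [U Ux affU] := affine_nbhd x; exists U.
by have [] := fci (U := U) (fun _ _ => I) affU.
Qed.

(** Y has the topology induced by f: in an affine chart, a basic open set of Y is given by a section
    that lifts to X. *)
Lemma closed_immersion_nbhd (V : opens Y) y : V y ->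
  exists W : opens X, W (f y) /\ preim f W `<=` V.
Proof.
move=> Vy; have [U [Ux affU affY pullU]] := closed_immersion_affine (f y).
have [t [ty tV]] := affine_basic affY (Ux : preim f U y) Vy.
have [s st] := pullU t; exists (basic s); rewrite -st in ty tV.
by split=> [|w ws]; [apply/basic_pull|apply: tV; apply/basic_pull].
Qed.

(** Over an affine chart b is a fraction a / g^e. Both terms lift, and the lift of g is invertible
    at f y because f is local. *)
Lemma stalk_map_surj y (b : stalk Y y) : exists a, stalk_map f y a = b.
Proof.
have [U [Ux affU affY pullU]] := closed_immersion_affine (f y).
have [V [Vy [t ->]]] := germ_surj b.
have [g [gV [e [a [gy E]]]]] := affine_sect affY t (Ux : preim f U y) Vy.
pose Uy : preim f U y := Ux.
have := congr1 (germ gy) E.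
rewrite rmorphM rmorphXn /= !(germ_res _ Uy gy) (germ_res gV Vy gy).
have [g' gE] := pullU g; have [a' aE] := pullU a.
have : is_unit (germ Uy g) by rewrite -basicE.
rewrite -aE -{1 2}gE -!(stalk_mapE Ux) => u.
have [c gc] : is_unit (germ Ux g' ^+ e).
  by apply/is_unitX/(pull_unit Ux Uy g').1; rewrite -(stalk_mapE Ux); exact: u.
move=> E'; exists (germ Ux a' * c).
by rewrite rmorphM /= -E' mulrAC -rmorphXn -rmorphM gc rmorph1 mul1r.
Qed.

Lemma stalk_map_ker y (a : stalk X (f y)) : stalk_map f y a = 0 ->
  exists (U : opens X) (Ux : U (f y)) s, a = germ Ux s /\ pull f U s = 0.
Proof.
have [V [Vx [s ->]]] := germ_surj a.
rewrite (stalk_mapE _ (Vx : preim f V y)).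
rewrite -(rmorph0 (germ (Vx : preim f V y))) => /germ_eqP [W [WV [WV' [Wy E]]]].
have [W' [W'y W'W]] := closed_immersion_nbhd Wy.
have VW : openI V W' `<=` V by apply: openI_subl.
have VWx : openI V W' (f y) by [].
exists (openI V W'), VWx, (res VW s); rewrite germ_res; split=> //.
have pVW : preim f (openI V W') `<=` preim f V by move=> w /VW.
have pW : preim f (openI V W') `<=` W by move=> w [_ /W'W].
rewrite -(pull_res _ pVW) -(res_comp WV pW pVW) E.
by rewrite (res_comp WV' pW pVW) rmorph0.
Qed.

Lemma closed_immersion_closed_point y : closed [set y] ->
  (forall x, exists y', f y' = x) -> closed [set f y].
Proof.
move=> yc fs; apply: closed_set1P => w wy; have [y' fy'] := fs w.
rewrite -[w]fy'; congr (f _).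
apply: (closed_point_spec yc) => V Vy'.
have [W [Wy' WV]] := closed_immersion_nbhd Vy'.
by apply: WV; apply: wy; rewrite -fy'.
Qed.

End ClosedImmersion.

(** * The generic point of the reduced curve *)

Section ReducedGeneric.
Variables (k : fieldType) (Y : scheme k) (eta : Y).
Hypothesis redY : reduced Y.
Hypothesis etaP : forall V : opens Y, V eta <-> exists y, V y.

(** A nonzero germ has a nonzero numerator a on an affine chart. Were a not invertible at eta, D(a)
    would be empty, as every nonempty open set contains eta; a would be nilpotent, hence 0. *)
Lemma generic_unit (V : opens Y) y (Vy : V y) (Ve : V eta) s :
  germ Vy s <> 0 -> is_unit (germ Ve s).
Proof.
move=> s0; have [U Uy affU] := affine_nbhd y.
have [g [gV [e [a [gy E]]]]] := affine_sect affU s Uy Vy.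
have a0 : a <> 0.
  move=> a0; apply: s0; apply: (unit_cancel (a := germ Uy g ^+ e)).
    by apply: is_unitX; rewrite -basicE.
  have := congr1 (germ gy) E.
  by rewrite a0 !rmorph0 rmorphM rmorphXn /= (germ_res _ Uy gy) (germ_res gV Vy gy).
have ae : basic a eta.
  apply: contrapT => nae; apply: a0.
  have [|m am] := affine_nilpotent affU (f := a); last exact: redY am.
  by move=> w aw; apply/nae/etaP; exists w.
have ge : basic g eta by apply/etaP; exists y.
have := congr1 (germ ge) E; have [Ue] := ae.
rewrite rmorphM rmorphXn /= !(germ_res _ Ue ge) (germ_res gV Ve ge) => ua E'.
by move: ua; rewrite -E' => /is_unitM [].
Qed.

Lemma generic_stalk_unit (b : stalk Y eta) : b <> 0 -> is_unit b.
Proof. by have [V [Ve [s ->]]] := germ_surj b; apply: generic_unit. Qed.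

End ReducedGeneric.

Section GenericNotOpen.
Variables (R : realType) (C : scheme R[i]) (eta : C).
Hypotheses (redC : reduced C) (Ccurve : smooth_projective_curve C).
Hypothesis etaP : forall V : opens C, V eta <-> exists y, V y.

Lemma projective_charts : exists n (U : 'I_n -> opens C),
  [/\ covers U (openT C), forall i, affine (U i) &
      forall i, fg_algebra (scalar C (U i))].
Proof.
have [[n [P [f [[U [x [[Uc Ua] Ux _ _]]] fci]]]] _ _] := Ccurve.
exists n.+1, (fun i => preim f (U i)).
have fU i := fci (U i) (fun _ _ => I) (Ua i).
split=> [y _|i|i]; first exact: (Uc (f y) I).
  by have [] := fU i.
have [xi univ] := Ux i; have [m [w wP]] := polynomial_algebra_fg xi univ.
exists m, (fun l => pull f (U i) (w l)) => S Ss Sx SD SM a.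
have [_ /(_ a) [b <-]] := fU i.
apply: (wP (fun b => S (pull f (U i) b))) => // [c|b1 b2|b1 b2].
- by rewrite pull_scalar.
- by rewrite rmorphD; apply: SD.
- by rewrite rmorphM; apply: SM.
Qed.

Lemma exists_closed_point p : exists q : C, closed_point q /\
  forall V : opens C, V q -> V p.
Proof.
have [n [U [Uc Ua _]]] := projective_charts.
exact: closed_specialization Uc Ua p.
Qed.

(* Were {eta} open, the sections of O supported on {eta} would be a subsheaf
   with zero-dimensional support, and O would not be torsion free. *)
Lemma generic_not_open (V : opens C) : V eta -> exists2 y, V y & y <> eta.
Proof.
move=> Ve; apply: contrapT => nV.
have Veta y : V y -> y = eta.
  by move=> Vy; apply: contrapT => ye; apply: nV; exists y.
have [n [U [Uc Ua Ufg]]] := projective_charts.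
have [q [qc _]] := exists_closed_point eta.
have [l Uq] := Uc q I; move: (U l) (Ua l) (Ufg l) Uq => {Uc Ua Ufg}U affU fgU Uq.
have lq := locally_ringed q; have Ue : U eta by apply/etaP; exists q.
have unit_eta (a : sect C U) : a <> 0 -> is_unit (germ Ue a).
  move=> a0; apply: contrapT => ae; apply: a0; apply: sect_germ => y Uy.
  apply: contrapT; rewrite rmorph0 => ay; apply: ae.
  exact: generic_unit ay.
have unit_neq0 (a : sect C U) : is_unit (germ Ue a) -> a <> 0.
  move=> ua a0; move: ua; rewrite a0 rmorph0.
  by apply: local_not_unit0; apply: locally_ringed.
have D1 : (1 : sect C U) != 0.
  by apply/eqP/unit_neq0; rewrite rmorph1; apply: is_unit1.
pose D : comNzRingType := HB.pack (GRing.ComPzRing.sort (sect C U))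
  (GRing.PzSemiRing_isNonZero.Build (sect C U) D1).
have domD (a b : sect C U) : a * b = 0 -> a = 0 \/ b = 0.
  move=> ab; have [?|a0] := EM (a = 0); [by left|right].
  apply: contrapT => b0; apply: (@unit_neq0 (a * b)) => //.
  by rewrite rmorphM is_unitM; split; apply: unit_eta.
have [f [fe fV]] := affine_basic affU Ue Ve.
have f0 : f <> 0 by apply: unit_neq0; rewrite -basicE.
(* Here D(f) = {eta}, so the inverse of a at eta is a section over D(f), a fraction d / f^e:
   inverting f gives a field. *)
have fP (a : sect C U) : a <> 0 -> exists e d, a * d = f ^+ e.
  move=> /unit_eta ua.
  have [W [WU [We [b ab]]]] := germ_unit_nbhd ua.
  have fW : basic f `<=` W by move=> y /fV /Veta ->.
  have [_ _ _ /(_ f) [_ fl fl0]] := affU.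
  have [e [d fd]] := fl (res fW b).
  have [|e' E] := fl0 (f ^+ e - a * d).
    rewrite rmorphB rmorphM -fd rmorphXn mulrCA -(res_comp WU fW _ a) -rmorphM ab.
    by rewrite rmorph1 mulr1 subrr.
  exists (e' + e)%N, (f ^+ e' * d); rewrite mulrCA exprD.
  by apply/esym/subr0_eq; rewrite -mulrBr.
(* Up to a unit, the uniformizer at the closed point q is the germ of a section a over U. All such
   sections being scalars, it would be 0 or a unit. *)
have [_ _ Cs] := Ccurve; have [x [xu _ _ x0]] := dvr_uniformizer (Cs q qc).
have [W [Wq [s xs]]] := germ_surj x.
have [g [gW [e [a [gq E]]]]] := affine_sect affU s Uq Wq.
have ug : is_unit (germ Uq g) by rewrite -basicE.
have aE : germ Uq a = germ Uq g ^+ e * x.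
  have := congr1 (germ gq) E.
  by rewrite rmorphM rmorphXn /= !(germ_res _ Uq gq) (germ_res gW Wq gq) -xs => ->.
have [c ac] := fg_domain_scalar (D := D) (s := scalar C U) fgU domD f0 fP a.
have [c0|c0] := EM (c = 0).
  apply: (x0 1%N); rewrite expr1; apply: (unit_cancel (is_unitX e ug)).
  by rewrite -aE ac c0 !rmorph0.
apply: xu; suff /is_unitM[] : is_unit (germ Uq g ^+ e * x) by [].
rewrite -aE ac; apply: is_unit_rmorph; apply: is_unit_rmorph.
by exists c^-1; rewrite mulfV //; apply/eqP.
Qed.

End GenericNotOpen.

(** The interface between the double curve and the sheaf statements, which are proved for any scheme
    with such a point. In [generic_ribbon], (z) stands for the ideal of C at p. *)
Record generic_structure (k : fieldType) (Y : scheme k) (eta : Y) : Prop := {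
  generic_dense : forall V : opens Y, V eta <-> exists y, V y;
  generic_ribbon : forall p : Y, exists z x : stalk Y p, ribbon z x /\
    forall (U : opens Y) (Up : U p) (Ue : U eta) s,
      ~ (exists c, germ Up s = c * z) -> is_unit (germ Ue s);
  generic_neq : forall V : opens Y, V eta -> exists2 y, V y & y <> eta;
  generic_closed : forall p : Y, p <> eta -> closed_point p }.

(** * Local and generic structure of the double curve *)

Section DoubleCurve.
Variables (R : realType) (X C2 C : scheme R[i]).
Variables (i : morphism C2 X) (j : morphism C C2).
Hypothesis hC2 : projective_primitive_double_curve i j.

Lemma double_kernel y : exists z : stalk C2 (j y), z * z = 0 /\
  forall a, stalk_map j y a = 0 <-> exists c, a = c * z.
Proof.
have [U [z [Uy zI zgen]]] := ideal_principal hC2 (j y).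
exists (germ Uy z); split.
  by rewrite -rmorphM (ideal_square0 hC2) // rmorph0.
move=> a; split=> [a0|[c ->]]; last first.
  by rewrite rmorphM /= (stalk_mapE Uy Uy) zI rmorph0 mulr0.
have [V [Vy [s [-> s0]]]] := stalk_map_ker (curve_closed hC2) a0.
have VU : openI U V `<=` U by apply: openI_subl.
have VV : openI U V `<=` V by apply: openI_subr.
have VUy : openI U V (j y) by [].
have [|W [WV [WU [b [Wy E]]]]] := zgen _ VU (res VV s) _ (j y) VUy.
  have pVV : preim j (openI U V) `<=` preim j V by move=> w /VV.
  by rewrite /ideal_sheaf /= -(pull_res _ pVV) s0 rmorph0.
exists (germ Wy b).
rewrite -(germ_res VV Vy VUy) -(germ_res WV VUy Wy) E rmorphM /=.
by rewrite (germ_res WU Uy Wy).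
Qed.

Lemma curve_generic : exists eta : C, forall V : opens C, V eta <-> exists y, V y.
Proof.
have [_ Cirr _] := curve_smooth hC2.
have [eta etaP] := irreducible_generic Cirr; exists eta => V; rewrite etaP.
by split=> -[y]; [move=> [_ Vy]|move=> Vy]; exists y.
Qed.

Lemma double_closed_ribbon y : closed_point y ->
  exists z x : stalk C2 (j y), [/\ ribbon z x, ~ is_unit x &
    forall a, stalk_map j y a = 0 <-> exists c, a = c * z].
Proof.
have [_ _ Cs] := curve_smooth hC2; move=> /Cs regy.
have [z [zz zk]] := double_kernel y.
have [x rx xu] := thickening_dvr_ribbon (stalk_map_surj (curve_closed hC2) (y := y))
  zk zz (double_cohen_macaulay hC2 (j y)) regy.
by exists z, x.
Qed.

(* p specializes to a closed point q, and the discrete valuation ring at q has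
   only two primes. *)
Lemma curve_closed_point eta : (forall V : opens C, V eta <-> exists y, V y) ->
  forall p : C, p <> eta -> closed_point p.
Proof.
move=> etaP p pe; have Ccurve := curve_smooth hC2.
have [q [qc qp]] := exists_closed_point Ccurve p.
suff -> : p = q by [].
have [U Uq affU] := affine_nbhd q; have Up := qp U Uq.
have Ue : U eta by apply/etaP; exists q.
(* If such an s exists, every t that is not a unit at q has a power divisible by s near q, so t is
   not a unit at p; then p specializes q, and p = q. Otherwise each section that is not a unit at p
   vanishes near q, hence at eta, which forces p = eta. *)
have [[s [sp sq]]|ns] := EM (exists s : sect C U, ~ is_unit (germ Up s) /\ germ Uq s <> 0).
  apply: (closed_point_spec qc); apply: (vanishing_ideal_spec affU (Uy := Uq) (Uy' := Up)).
  move=> t tq tp; apply: sp.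
  have [_ _ Cs] := Ccurve; have [x [xu xg xp _]] := dvr_uniformizer (Cs q qc).
  have [//|[u [n [uu sx]]]] := xp (germ Uq s).
  have [//|[c tc]] := xg (germ Uq t).
  have [V [Vq [d dE]]] := germ_surj (c ^+ n * u).
  have VU : openI U V `<=` U by apply: openI_subl.
  have VV : openI U V `<=` V by apply: openI_subr.
  have UVq : openI U V q by [].
  have : germ UVq (res VU t ^+ n) = germ UVq (res VV d * res VU s).
    rewrite rmorphXn rmorphM /= !(germ_res VU Uq UVq) (germ_res VV Vq UVq).
    by rewrite -dE tc exprMn -mulrA [u * _]mulrC sx.
  move=> /germ_eqP [W [WUV [WUV' [Wq E]]]].
  have Wp := qp W Wq; have UVp := qp _ UVq.
  have := congr1 (germ Wp) E; rewrite (res_irr WUV' WUV).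
  rewrite !(germ_res WUV UVp Wp) rmorphXn rmorphM /= !(germ_res VU Up UVp) => E'.
  have : is_unit (germ Up t ^+ n) by apply: is_unitX.
  by rewrite E' => /is_unitM [].
case: pe; apply: (affine_T0 affU) => // V; split=> [Vp|].
  by apply/etaP; exists p.
apply: (vanishing_ideal_spec affU (Uy := Up) (Uy' := Ue)) => s sp.
have /(germ_eqP Uq Uq) [W [WU [WU' [Wq E]]]] : germ Uq s = germ Uq 0.
  by rewrite rmorph0; apply: contrapT => sq; apply: ns; exists s.
have We : W eta by apply/etaP; exists q.
rewrite /vanishing_ideal /= -(germ_res WU Ue We) E !rmorph0.
by apply: local_not_unit0; apply: locally_ringed.
Qed.

Theorem double_generic : exists eta : C2, generic_structure eta.
Proof.
have Ccurve := curve_smooth hC2; have redC := curve_reduced hC2.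
have jci := curve_closed hC2; have jsurj := curve_same_points hC2.
have [eta etaP] := curve_generic; exists (j eta).
have cpt := curve_closed_point etaP.
have dense (V : opens C2) : V (j eta) <-> exists y, V y.
  split=> [Vj|[y Vy]]; first by exists (j eta).
  have [y' yE] := jsurj y; change (preim j V eta); apply/etaP.
  by exists y'; rewrite -yE in Vy.
split=> //.
- move=> p; have [y <-] := jsurj p.
  have [z [x [rzx zk]]] : exists z x : stalk C2 (j y), ribbon z x /\
      forall a, stalk_map j y a = 0 <-> exists c, a = c * z.
    have [ye|/cpt /double_closed_ribbon [z [x [rzx _ zk]]]] := EM (y = eta).
      rewrite {}ye; have [z [zz zk]] := double_kernel eta.
      exists z, 1; split=> //; have [_ nA _] := double_cohen_macaulay hC2 (j eta).
      apply: (thickening_field_ribbon (stalk_map_surj jci (y := eta)) zk zz nA).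
      exact: generic_stalk_unit redC etaP.
    by exists z, x.
  exists z, x; split=> // U Uy Ue s sz.
  apply/(pull_unit Ue Ue s).1; apply: (generic_unit redC etaP (V := preim j U) (Vy := Uy)).
  by rewrite -(stalk_mapE Uy Uy) => /zk.
- move=> V Ve; have [y Vy ye] := generic_not_open redC Ccurve etaP (Ve : preim j V eta).
  exists (j y) => // jye.
  (* The topology of C is induced by j: if j y = j eta, every open set containing eta contains y,
     against the complement of the closed point y. *)
  have oy : open (~` [set y]) by apply: closed_openC; apply: cpt.
  have [|W [We Wy]] := closed_immersion_nbhd jci (V := Opens oy) (y := eta).
    by move=> /esym.
  by apply: (Wy y) => //; rewrite /preim /= jye.
- move=> p pe; have [y yE] := jsurj p; rewrite -yE.
  apply: (closed_immersion_closed_point jci) => //; apply: cpt => ye.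
  by apply: pe; rewrite -yE ye.
Qed.

Theorem stalk_reflexive_torsion_free (P : C) : closed_point P ->
  forall M : lmodType (stalk C2 (j P)), fg_module M ->
  reflexive_module M <-> torsion_free_module M.
Proof.
move=> /double_closed_ribbon [z [x [rzx xu _]]] M Mfg.
exact: (reflexive_module_torsion_free rzx (locally_ringed (j P)) xu Mfg).
Qed.

End DoubleCurve.

(** * Sheaves of modules *)

Section GenericSections.
Variables (k : fieldType) (Y : scheme k) (eta : Y).
Hypothesis gs : generic_structure eta.
Implicit Types U V W : opens Y.

Lemma generic_mem V y : V y -> V eta.
Proof. by move=> Vy; apply/(generic_dense gs); exists y. Qed.

Lemma germ_generic_eq U V p (Up : U p) (Vp : V p) (Ue : U eta) (Ve : V eta)
    (s : sect Y U) (t : sect Y V) :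
  germ Up s = germ Vp t -> germ Ue s = germ Ve t.
Proof.
move=> /germ_eqP [W [WU [WV [Wp E]]]]; apply/germ_eqP; exists W, WU, WV.
by split=> //; apply: generic_mem Wp.
Qed.

(** Near q, s is a fraction whose numerator a vanishes at eta, so some g invertible at eta kills a.
    Elements of (z) have square 0, so the germ of g at q is outside (z) and can be cancelled. *)
Lemma sect_generic0 V (Ve : V eta) (s : sect Y V) : germ Ve s = 0 -> s = 0.
Proof.
move=> s0; apply: sect_germ => q Vq; rewrite rmorph0.
have [U Uq affU] := affine_nbhd q; have Ue := generic_mem Uq.
have [f [fV [e [a [fq E]]]]] := affine_sect affU s Uq Vq.
have fe := generic_mem fq.
have a0 : germ Ue a = 0.
  have := congr1 (germ fe) E.
  by rewrite rmorphM rmorphXn /= !(germ_res _ Ue fe) (germ_res fV Ve fe) s0 mulr0.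
have [g [ug ga]] := affine_germ0 affU a0.
have [z [x [rzx zu]]] := generic_ribbon gs q.
have gz : ~ exists c, germ Uq g = c * z.
  move=> [c gc]; have gg : germ Uq (g * g) = germ Uq 0.
    by rewrite rmorphM /= gc mulrACA (ribbon_sqr0 rzx) mulr0 rmorph0.
  have := germ_generic_eq Ue Ue gg; rewrite rmorphM rmorph0 => gg0.
  have /is_unitM : is_unit (germ Ue g) /\ is_unit (germ Ue g) by split.
  by rewrite [_ * _]gg0; apply: local_not_unit0; apply: locally_ringed.
have aq : germ Uq a = 0.
  by apply: (ribbon_cancel rzx gz); rewrite -rmorphM ga rmorph0.
apply: (unit_cancel (a := germ Uq f ^+ e)).
  by apply: is_unitX; rewrite -basicE.
have := congr1 (germ fq) E.
by rewrite rmorphM rmorphXn /= !(germ_res _ Uq fq) (germ_res fV Vq fq) aq.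
Qed.

Lemma sect_generic_eq V (Ve : V eta) (s t : sect Y V) :
  germ Ve s = germ Ve t -> s = t.
Proof.
by move=> st; apply/subr0_eq/(sect_generic0 (Ve := Ve)); rewrite rmorphB /= st subrr.
Qed.

(** Otherwise x^2 = 0, although x is regular. Together with [generic_ribbon] this makes x invertible
    at eta. *)
Lemma ribbon_generic_unit p (z x : stalk Y p) : ribbon z x ->
  ~ exists c, x = c * z.
Proof.
move=> rzx [c xE]; have [n1 _] := locally_ringed p; apply: n1.
by do 2 apply: (ribbon_reg rzx); rewrite mulr1 xE mulrACA (ribbon_sqr0 rzx) mulr0.
Qed.

End GenericSections.

(** * Forms on a sheaf with finitely many local generators *)

Section SheafLemmas.
Variables (k : fieldType) (Y : ringed_space k) (E : sheaf_of_modules Y).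
Implicit Types U V W : opens Y.

Lemma mres_irr U V (VU VU' : V `<=` U) m : mres E VU m = mres E VU' m.
Proof. by rewrite (Prop_irrelevance VU VU'). Qed.

Lemma mres0 U V (VU : V `<=` U) : mres E VU 0 = 0.
Proof.
have := mres_lin VU 1 (0 : msect E U) 0.
rewrite rmorph1 !scale1r addr0 => /(congr1 (fun t => t - mres E VU 0)).
by rewrite addrK subrr.
Qed.

Lemma mresD U V (VU : V `<=` U) m n :
  mres E VU (m + n) = mres E VU m + mres E VU n.
Proof. by rewrite -{1}[m]scale1r mres_lin rmorph1 scale1r. Qed.

Lemma mresZ U V (VU : V `<=` U) a m :
  mres E VU (a *: m) = res VU a *: mres E VU m.
Proof. by rewrite -[a *: m]addr0 mres_lin mres0 addr0. Qed.

Lemma mres_sum U V (VU : V `<=` U) n (c : 'I_n -> sect Y U) (x : 'I_n -> msect E U) :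
  mres E VU (\sum_i c i *: x i) = \sum_i res VU (c i) *: mres E VU (x i).
Proof.
apply: (big_ind2 (fun m m' => mres E VU m = m')) => [|m m' n0 n' <- <-|i _].
- exact: mres0.
- exact: mresD.
- exact: mresZ.
Qed.

Lemma msect_empty U (m n : msect E U) : (forall y, ~ U y) -> m = n.
Proof.
move=> U0; have VU : forall i : False, U `<=` U by [].
have cU : covers (fun _ : False => U) U by move=> y /U0.
by apply: (msect_ext E VU cU) => -[].
Qed.

Section Forms.
Variables (U : opens Y) (f : local_form E U).

Lemma lform0E V (VU : V `<=` U) : lform f VU 0 = 0.
Proof.
have := lform_lin f VU 1 0 0.
rewrite scale1r addr0 mul1r => /(congr1 (fun t => t - lform f VU 0)).
by rewrite addrK subrr.
Qed.

Lemma lform_sum V (VU : V `<=` U) n (c : 'I_n -> sect Y V) (x : 'I_n -> msect E V) :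
  lform f VU (\sum_i c i *: x i) = \sum_i c i * lform f VU (x i).
Proof.
apply: (big_ind2 (fun m t => lform f VU m = t)) => [|m t m' t' <- <-|i _].
- exact: lform0E.
- by rewrite -{1}[m]scale1r lform_lin mul1r.
- by rewrite -[_ *: _]addr0 lform_lin lform0E addr0.
Qed.
End Forms.

(** Surjectivity of O^n -> E over U as a map of sheaves; nothing is asked of its kernel. *)
Definition generates U n (x : 'I_n -> msect E U) :=
  forall V (m : msect E V) q, U q -> V q ->
  exists W (WV : W `<=` V) (WU : W `<=` U) (c : 'I_n -> sect Y W),
    W q /\ mres E WV m = \sum_i c i *: mres E WU (x i).

Lemma associated_generates U n (x : 'I_n -> msect E U) : affine U ->
  (forall m, exists c : 'I_n -> sect Y U, m = \sum_i c i *: x i) ->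
  associated_on E U -> generates x.
Proof.
move=> affU xgen assoc V m q Uq Vq.
have [f [fq fV]] := affine_basic affU Uq Vq.
have [/(_ (mres E fV m)) [e [m' E']] _] := assoc f.
have [c mE] := xgen m'.
have [_ _ _ /(_ f) [[b fb] _ _]] := affU.
exists (basic f), fV, (@basic_sub _ _ U f), (fun i => b ^+ e * res (@basic_sub _ _ U f) (c i)).
split=> //; rewrite -[LHS]scale1r -(expr1n _ e) -fb exprMn mulrC -scalerA E' mE.
by rewrite mres_sum scaler_sumr; apply: eq_bigr => i _; rewrite scalerA.
Qed.

Section Generated.
Variables (U : opens Y) (n : nat) (x : 'I_n -> msect E U).
Hypothesis xgen : generates x.

Definition lform_values W (WU : W `<=` U) (f : local_form E W) (i : 'I_n) :
  sect Y W := lform f (@subset_refl _ W) (mres E WU (x i)).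

Lemma lform_valuesE W (WU : W `<=` U) (f : local_form E W) V (VW : V `<=` W)
    (VU : V `<=` U) (r : 'I_n -> sect Y V) :
  lform f VW (\sum_i r i *: mres E VU (x i)) =
  \sum_i r i * res VW (lform_values WU f i).
Proof.
rewrite lform_sum; apply: eq_bigr => i _; congr (_ * _).
by rewrite /lform_values (lform_res _ _ VW) (mres_comp _ _ VU).
Qed.

Lemma lform_values_inj W (WU : W `<=` U) (f g : local_form E W) :
  lform_values WU f =1 lform_values WU g -> f = g.
Proof.
move=> fg; apply: lform_eq => V VW m; apply: sect_local => q Vq.
have [V' [V'V [V'U [c [V'q E']]]]] := xgen m (WU _ (VW _ Vq)) Vq.
have V'W : V' `<=` W by apply: subset_trans V'V VW.
exists V', V'V; split=> //.
rewrite !(lform_res _ _ V'W) E' !(lform_valuesE WU).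
by apply: eq_bigr => i _; rewrite fg.
Qed.

Section Extension.
Variables (W : opens Y) (WU : W `<=` U) (c : 'I_n -> sect Y W).
Hypothesis crel : forall V (VW : V `<=` W) (VU : V `<=` U) (r : 'I_n -> sect Y V),
  \sum_i r i *: mres E VU (x i) = 0 -> \sum_i r i * res VW (c i) = 0.

(** The graph of the form to be built: locally, m is written in the generators and each [x i] is
    replaced by [c i]. It is a relation because the coefficients are not unique; [crel] makes it
    single-valued, and gluing makes it total. *)
Definition local_value V (m : msect E V) (t : sect Y V) :=
  forall q, V q -> exists V' (V'V : V' `<=` V) (V'W : V' `<=` W)
    (V'U : V' `<=` U) (r : 'I_n -> sect Y V'),
    [/\ V' q, mres E V'V m = \sum_i r i *: mres E V'U (x i) &
        res V'V t = \sum_i r i * res V'W (c i)].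

Lemma local_value_res V V' (V'V : V' `<=` V) m t :
  local_value m t -> local_value (mres E V'V m) (res V'V t).
Proof.
move=> mt q V'q; have [T [TV [TW [TU [r [Tq Em Et]]]]]] := mt q (V'V q V'q).
have SV' : openI T V' `<=` V' by apply: openI_subr.
have ST : openI T V' `<=` T by apply: openI_subl.
have SW : openI T V' `<=` W by apply: subset_trans ST TW.
have SU : openI T V' `<=` U by apply: subset_trans ST TU.
have SV : openI T V' `<=` V by apply: subset_trans ST TV.
exists (openI T V'), SV', SW, SU, (fun i => res ST (r i)); split=> //.
- rewrite (mres_comp _ _ SV) -(mres_comp TV ST) Em mres_sum.
  by apply: eq_bigr => i _; rewrite (mres_comp _ _ SU).
- rewrite (res_comp _ _ SV) -(res_comp TV ST) Et rmorph_sum.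
  by apply: eq_bigr => i _; rewrite rmorphM /= (res_comp _ _ SW).
Qed.

Lemma local_value_lin V (a : sect Y V) m t m' t' :
  local_value m t -> local_value m' t' ->
  local_value (a *: m + m') (a * t + t').
Proof.
move=> mt mt' q Vq.
have [T [TV [TW [TU [r [Tq Em Et]]]]]] := mt q Vq.
have [S [SV [SW [SU [r' [Sq Em' Et']]]]]] := local_value_res TV mt' Tq.
have SV0 : S `<=` V by apply: subset_trans SV TV.
exists S, SV0, SW, SU, (fun i => res SV0 a * res SV (r i) + r' i).
split=> //.
- rewrite mres_lin -(mres_comp TV SV SV0 m') Em' -(mres_comp TV SV SV0 m) Em.
  rewrite mres_sum scaler_sumr -big_split; apply: eq_bigr => i _.
  by rewrite scalerDl -scalerA (mres_comp _ _ SU).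
- rewrite rmorphD rmorphM /= -(res_comp TV SV SV0 t') Et' -(res_comp TV SV SV0 t) Et.
  rewrite rmorph_sum mulr_sumr -big_split; apply: eq_bigr => i _.
  by rewrite rmorphM /= mulrDl mulrA (res_comp _ _ SW).
Qed.

Lemma local_value_uniq V (m : msect E V) t t' :
  local_value m t -> local_value m t' -> t = t'.
Proof.
move=> mt mt'; have := local_value_lin (-1) mt mt'.
rewrite scaleN1r addNr mulN1r => mtt.
suff : - t + t' = 0 by move=> /(congr1 (+%R t)); rewrite addrA subrr add0r addr0.
apply: sect_local => q Vq; have [T [TV [TW [TU [r [Tq Em Et]]]]]] := mtt q Vq.
exists T, TV; split=> //; rewrite rmorph0 Et; apply: (@crel _ TW TU).
by rewrite -Em mres0.
Qed.

Lemma local_value_exists V (VW : V `<=` W) (m : msect E V) :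
  exists t, local_value m t.
Proof.
have loc (q : {q | V q}) : {V' : opens Y & {r : 'I_n -> sect Y V' |
    exists (V'V : V' `<=` V) (V'U : V' `<=` U), V' (sval q) /\
      mres E V'V m = \sum_i r i *: mres E V'U (x i)}}.
  case: q => q Vq.
  have /cid [V' /cid [V'V /cid [V'U /cid [r [V'q E']]]]] :=
    xgen m (WU (VW _ Vq)) Vq.
  by exists V', r, V'V, V'U.
pose T q := projT1 (loc q); pose r q : 'I_n -> sect Y (T q) := sval (projT2 (loc q)).
have TV q : T q `<=` V by case: (svalP (projT2 (loc q))).
have Tmem q : T q (sval q) by case: (svalP (projT2 (loc q))) => ? [? []].
have TU q : T q `<=` U by apply: subset_trans (TV q) (subset_trans VW WU).
have TW q : T q `<=` W by apply: subset_trans (TV q) VW.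
have TE q : mres E (TV q) m = \sum_i r q i *: mres E (TU q) (x i).
  have [V'V [V'U [_ E']]] := svalP (projT2 (loc q)).
  rewrite (mres_irr _ V'V) E'; apply: eq_bigr => i _.
  by rewrite (mres_irr _ (TU q)).
have cT : covers T V.
  by move=> q Vq; exists (exist _ q Vq); apply: Tmem.
have [|t tE] := sect_glue TV cT (fun q => \sum_i r q i * res (TW q) (c i)).
  move=> q q' S Sq Sq'.
  have SU : S `<=` U by apply: subset_trans Sq (TU q).
  have SW : S `<=` W by apply: subset_trans Sq (TW q).
  have SV : S `<=` V by apply: subset_trans Sq (TV q).
  apply/subr0_eq; rewrite !rmorph_sum -sumrB.
  transitivity (\sum_i (res Sq (r q i) - res Sq' (r q' i)) * res SW (c i)).
    apply: eq_bigr => i _.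
    by rewrite !rmorphM /= !(res_comp _ _ SW) mulrBl.
  have Eq : mres E SV m = \sum_i res Sq (r q i) *: mres E SU (x i).
    rewrite -(mres_comp (TV q) Sq) TE mres_sum; apply: eq_bigr => i _.
    by rewrite (mres_comp _ _ SU).
  have Eq' : mres E SV m = \sum_i res Sq' (r q' i) *: mres E SU (x i).
    rewrite -(mres_comp (TV q') Sq') TE mres_sum; apply: eq_bigr => i _.
    by rewrite (mres_comp _ _ SU).
  apply: (@crel _ SW SU); under eq_bigr do rewrite scalerBl.
  by rewrite sumrB -Eq -Eq' subrr.
exists t => q Vq; pose q' : {q | V q} := exist _ q Vq.
exists (T q'), (TV q'), (TW q'), (TU q'), (r q'); split=> //.
Qed.

Lemma local_form_of_values : exists f : local_form E W, lform_values WU f =1 c.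
Proof.
pose g V (VW : V `<=` W) m := sval (cid (local_value_exists VW m)).
have gP V (VW : V `<=` W) m : local_value m (g V VW m).
  exact: (svalP (cid (local_value_exists VW m))).
have g_lin V (VW : V `<=` W) (a : sect Y V) m m' :
    g V VW (a *: m + m') = a * g V VW m + g V VW m'.
  by apply: local_value_uniq (gP _ _ _) _; apply: local_value_lin.
have g_res V V' (VW : V `<=` W) (V'W : V' `<=` W) (V'V : V' `<=` V) m :
    res V'V (g V VW m) = g V' V'W (mres E V'V m).
  by apply: local_value_uniq (gP _ _ _); apply: local_value_res.
exists (LocalForm g_lin g_res) => i; rewrite /lform_values /=.
apply: local_value_uniq (gP _ _ _) _ => q Wq.
have WW : W `<=` W by [].
exists W, WW, WW, WU, (fun l => (l == i)%:R); split=> //.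
  rewrite mres_id (bigD1 i) //= eqxx scale1r big1 ?addr0 // => l /negPf ->.
  by rewrite scale0r.
rewrite !res_id (bigD1 i) //= eqxx mul1r big1 ?addr0 ?res_id // => l /negPf ->.
by rewrite mul0r.
Qed.

End Extension.
End Generated.
End SheafLemmas.

(** * Separating sections by forms near the generic point *)

Section GenericSheaf.
Variables (k : fieldType) (Y : scheme k) (eta : Y).
Hypothesis gs : generic_structure eta.
Variable E : sheaf_of_modules Y.
Implicit Types U V W : opens Y.

Lemma sect_generic_zero V (s : sect Y V) :
  (forall Ve : V eta, germ Ve s = 0) -> s = 0.
Proof.
move=> s0; have [Ve|Ve] := EM (V eta); first exact: sect_generic0 (s0 Ve).
by apply: sect_empty => y Vy; apply: Ve; apply: generic_mem Vy.
Qed.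

Lemma lform_values_restr U n (x : 'I_n -> msect E U) W (WU : W `<=` U)
    (f : local_form E W) V (VW : V `<=` W) (VU : V `<=` U) i :
  lform_values x VU (lform_restr VW f) i = res VW (lform_values x WU f i).
Proof.
by rewrite /lform_values (lform_res _ _ VW) (mres_comp _ _ VU); apply: lform_irr.
Qed.

Lemma lform_restrE W (f : local_form E W) V (VW : V `<=` W) (m : msect E V) :
  lform (lform_restr VW f) (@subset_refl _ V) m = lform f VW m.
Proof. exact: lform_irr. Qed.

(** T need not contain p. In an affine neighbourhood N of p each [c i] is a fraction at eta, and G
    is the product of the denominators. *)
Lemma common_denominator n (T : opens Y) (Te : T eta) (c : 'I_n -> sect Y T) (p : Y) :
  exists (N : opens Y) (Np : N p) (G : sect Y N) (h : 'I_n -> sect Y N),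
    (forall Ne : N eta, is_unit (germ Ne G)) /\
    forall i (Ne : N eta), germ Ne G * germ Te (c i) = germ Ne (h i).
Proof.
have [N Np affN] := affine_nbhd p; have Ne := generic_mem gs Np.
have H i : {ga : sect Y N * sect Y N | is_unit (germ Ne ga.1) /\
    germ Ne ga.1 * germ Te (c i) = germ Ne ga.2}.
  apply: cid; have [f [fT [e [a [fe E']]]]] := affine_sect affN (c i) Ne Te.
  exists (f ^+ e, a) => /=; rewrite rmorphXn; split.
    by apply: is_unitX; rewrite -basicE.
  have := congr1 (germ fe) E'.
  by rewrite rmorphM rmorphXn /= !(germ_res _ Ne fe) (germ_res fT Te fe).
pose g i := (sval (H i)).1; pose a i := (sval (H i)).2.
exists N, Np, (\prod_i g i), (fun i => a i * \prod_(l | l != i) g l).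
split=> [Ne'|i Ne']; rewrite (Prop_irrelevance Ne' Ne) rmorph_prod /=.
  apply: (big_ind (fun t => is_unit t)); first exact: is_unit1.
    by move=> s t us ut; apply/is_unitM.
  by move=> i _; case: (svalP (H i)).
rewrite rmorphM rmorph_prod (bigD1 i) //= mulrAC; congr (_ * _).
by case: (svalP (H i)).
Qed.

Definition generic_torsion_free := forall V W (WV : W `<=` V) (m : msect E V),
  W eta -> mres E WV m = 0 -> m = 0.

Hypothesis Ecoh : coherent E.

Lemma coherent_generates p : exists U n (x : 'I_n -> msect E U),
  U p /\ generates x.
Proof.
have [U [Up affU [n [x xgen]] assoc]] := Ecoh p; exists U, n, x; split=> //.
exact: associated_generates.
Qed.

Hypothesis Etf : generic_torsion_free.

(** With A the stalk of O at eta, the stalk of E there is A^n / K, K being the germs of relations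
    between generators. K is saturated since x0 is a unit at eta, so a coefficient vector of m
    outside K is separated from K by a form on A^n, which spreads out to a neighbourhood. *)
Lemma forms_separate V (m : msect E V) :
  (forall W (WV : W `<=` V) (f : local_form E W),
     lform f (@subset_refl _ W) (mres E WV m) = 0) -> m = 0.
Proof.
move=> mkill; have [Ve|Ve] := EM (V eta); last first.
  by apply: msect_empty => y Vy; apply: Ve; apply: generic_mem Vy.
have [U [n [x [Ue xgen]]]] := coherent_generates eta.
have [W0 [W0V [W0U [c [W0e mE]]]]] := xgen V m eta Ue Ve.
have [z [x0 [rzx zu]]] := generic_ribbon gs eta.
have x0u : is_unit x0.
  have [T [Te [s xs]]] := germ_surj x0; rewrite xs; apply: zu; rewrite -xs.
  exact: ribbon_generic_unit rzx.
pose K : set 'rV[stalk Y eta]_n := [set v | exists W (We : W eta) (WU : W `<=` U)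
  (r : 'I_n -> sect Y W), (forall i, v 0 i = germ We (r i)) /\
    \sum_i r i *: mres E WU (x i) = 0].
have KS : is_submodule K.
  split.
  - exists U, Ue, (@subset_refl _ U), (fun=> 0); split.
      by move=> i; rewrite mxE rmorph0.
    by rewrite big1 // => i _; rewrite scale0r.
  - move=> v v' [W [We [WU [r [vr r0]]]]] [W' [We' [WU' [r' [vr' r0']]]]].
    have SW : openI W W' `<=` W by apply: openI_subl.
    have SW' : openI W W' `<=` W' by apply: openI_subr.
    have SU : openI W W' `<=` U by apply: subset_trans SW WU.
    have Se : openI W W' eta by [].
    exists (openI W W'), Se, SU, (fun i => res SW (r i) + res SW' (r' i)); split.
      move=> i; rewrite mxE vr vr' rmorphD /=.
      by rewrite (germ_res SW We Se) (germ_res SW' We' Se).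
    under eq_bigr => i _.
      rewrite scalerDl -{1}(mres_comp WU SW SU) -(mres_comp WU' SW' SU) -!mresZ.
      over.
    rewrite big_split /=.
    have sumr W1 (WU1 : W1 `<=` U) (S1 : openI W W' `<=` W1) (r1 : 'I_n -> sect Y W1) :
        \sum_i r1 i *: mres E WU1 (x i) = 0 ->
        \sum_i mres E S1 (r1 i *: mres E WU1 (x i)) = 0.
      move=> r10; under eq_bigr do rewrite mresZ.
      by rewrite -mres_sum r10 mres0.
    by rewrite !sumr // addr0.
  - move=> a v [W [We [WU [r [vr r0]]]]].
    have [W' [We' [s ->]]] := germ_surj a.
    have SW : openI W W' `<=` W by apply: openI_subl.
    have SW' : openI W W' `<=` W' by apply: openI_subr.
    have SU : openI W W' `<=` U by apply: subset_trans SW WU.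
    have Se : openI W W' eta by [].
    exists (openI W W'), Se, SU, (fun i => res SW' s * res SW (r i)); split.
      move=> i; rewrite mxE vr rmorphM /=.
      by rewrite (germ_res SW We Se) (germ_res SW' We' Se).
    under eq_bigr => i _ do rewrite -scalerA -(mres_comp WU SW SU).
    by rewrite -scaler_sumr -mres_sum r0 mres0 scaler0.
have Ks : saturated x0 K.
  move=> v; have [b xb] := x0u; case: KS => _ _ KZ /(KZ b).
  by rewrite scalerA mulrC xb scale1r.
pose v0 : 'rV[stalk Y eta]_n := \row_i germ W0e (c i).
have [[W [We [WU [r [vr r0]]]]]|Kv0] := EM (K v0).
  have SW : openI W W0 `<=` W by apply: openI_subl.
  have SW0 : openI W W0 `<=` W0 by apply: openI_subr.
  have SU : openI W W0 `<=` U by apply: subset_trans SW WU.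
  have SV : openI W W0 `<=` V by apply: subset_trans SW0 W0V.
  have Se : openI W W0 eta by [].
  apply: (Etf (WV := SV) (m := m)) => //.
  rewrite -(mres_comp W0V SW0) mE mres_sum.
  transitivity (\sum_i res SW (r i) *: mres E SW (mres E WU (x i))).
    apply: eq_bigr => i _; rewrite !(mres_comp _ _ SU); congr (_ *: _).
    apply: (sect_generic_eq gs (Ve := Se)).
    by rewrite (germ_res SW We Se) (germ_res SW0 W0e Se) -vr mxE.
  by rewrite -mres_sum r0 mres0.
have accA := fg_acc (ribbon_noeth rzx) (fg_rV (stalk Y eta) n).
have [phi [phil phiK]] := linear_separate rzx accA KS Ks Kv0.
case; rewrite (linear_on_rV _ phil).
have [W1 [W1e [s sE]]] := germ_family (fun i => phi (delta_mx 0 i)).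
have W2W1 : openI W1 U `<=` W1 by apply: openI_subl.
have W2U : openI W1 U `<=` U by apply: openI_subr.
have W2e : openI W1 U eta by [].
(* A relation over any smaller open set has its germ in K, which phi kills; the required equality
   thus holds at eta, hence everywhere. *)
have [|f fE] := local_form_of_values xgen W2U (c := fun i => res W2W1 (s i)).
  move=> T TW TU r r0; apply: sect_generic_zero => Te.
  have := linear_on_rV (\row_i germ Te (r i)) phil; rewrite phiK; last first.
    by exists T, Te, TU, r; split=> // i; rewrite mxE.
  move=> ->; rewrite rmorph_sum; apply: eq_bigr => i _.
  by rewrite mxE rmorphM /= (germ_res TW W2e Te) (germ_res W2W1 W1e W2e) -sE.
pose W3 := openI (openI W1 U) W0.
have W32 : W3 `<=` openI W1 U by apply: openI_subl.
have W30 : W3 `<=` W0 by apply: openI_subr.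
have W3U : W3 `<=` U by apply: subset_trans W30 W0U.
have W3V : W3 `<=` V by apply: subset_trans W30 W0V.
have W3e : W3 eta by [].
have := mkill W3 W3V (lform_restr W32 f).
rewrite lform_restrE -(mres_comp W0V W30) mE mres_sum.
under eq_bigr do rewrite (mres_comp _ _ W3U).
rewrite (lform_valuesE x W2U) => /(congr1 (germ W3e)).
rewrite rmorph0 rmorph_sum => f0; apply: etrans f0; apply: eq_bigr => i _.
rewrite mxE fE rmorphM /= (germ_res W30 W0e W3e) (germ_res W32 W2e W3e).
by rewrite (germ_res W2W1 W1e W2e) -sE.
Qed.

End GenericSheaf.

(** * Local representation of a form on the dual sheaf *)

Section SheafReflexivity.
Variables (k : fieldType) (Y : scheme k) (eta : Y).
Hypothesis gs : generic_structure eta.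
Variable E : sheaf_of_modules Y.
Hypothesis Ecoh : coherent E.
Implicit Types U V W : opens Y.

Section LocalBiduality.
Variables (V : opens Y) (Psi : local_form (dual_sheaf E) V) (p : Y) (Vp : V p).
Variables (U : opens Y) (n : nat) (x : 'I_n -> msect E U) (Up : U p).
Hypothesis xgen : generates x.

Lemma bidual_form_res W (WV : W `<=` V) W' (W'W : W' `<=` W) (W'V : W' `<=` V)
    (f : local_form E W) :
  res W'W (lform Psi WV f) = lform Psi W'V (lform_restr W'W f).
Proof. exact: (lform_res Psi WV W'V W'W). Qed.

(** The stalk at p of the dual sheaf, embedded in A^n by values at the generators. It plays the part
    of K in [biduality_surj], and [value_form] is the form that Psi induces on it. *)
Definition value_germs : set 'rV[stalk Y p]_n := [set v |
  exists W (Wp : W p) (WU : W `<=` U) (WV : W `<=` V) (f : local_form E W),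
    forall i, v 0 i = germ Wp (lform_values x WU f i)].

Lemma value_germs_uniq (v : 'rV[stalk Y p]_n) W (Wp : W p) (WU : W `<=` U) (WV : W `<=` V)
    (f : local_form E W) W' (W'p : W' p) (W'U : W' `<=` U) (W'V : W' `<=` V)
    (f' : local_form E W') :
  (forall i, v 0 i = germ Wp (lform_values x WU f i)) ->
  (forall i, v 0 i = germ W'p (lform_values x W'U f' i)) ->
  germ Wp (lform Psi WV f) = germ W'p (lform Psi W'V f').
Proof.
move=> vf vf'.
have SW : openI W W' `<=` W by apply: openI_subl.
have SW' : openI W W' `<=` W' by apply: openI_subr.
have Sp : openI W W' p by [].
have [|T [TS [Tp TE]]] := germ_family_eq
  (s := fun i => res SW (lform_values x WU f i))
  (t := fun i => res SW' (lform_values x W'U f' i)) (Uy := Sp).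
  by move=> i; rewrite (germ_res SW Wp Sp) (germ_res SW' W'p Sp) -vf -vf'.
have TW : T `<=` W by apply: subset_trans TS SW.
have TW' : T `<=` W' by apply: subset_trans TS SW'.
have TU : T `<=` U by apply: subset_trans TW WU.
have TV : T `<=` V by apply: subset_trans TW WV.
rewrite -(germ_res TW Wp Tp) -(germ_res TW' W'p Tp).
rewrite !(bidual_form_res _ _ TV); congr (germ _ (lform _ _ _)).
apply: (lform_values_inj xgen (WU := TU)) => i.
rewrite (lform_values_restr x WU) (lform_values_restr x W'U).
by have := TE i; rewrite !(res_comp _ _ TW) !(res_comp _ _ TW').
Qed.

Definition is_value (v : 'rV[stalk Y p]_n) (t : stalk Y p) :=
  exists W (Wp : W p) (WU : W `<=` U) (WV : W `<=` V) (f : local_form E W),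
    (forall i, v 0 i = germ Wp (lform_values x WU f i)) /\
    t = germ Wp (lform Psi WV f).

Definition value_form (v : 'rV[stalk Y p]_n) : stalk Y p :=
  if pselect (exists t, is_value v t) is left h then sval (cid h) else 0.

Lemma value_formE (v : 'rV[stalk Y p]_n) W (Wp : W p) (WU : W `<=` U) (WV : W `<=` V)
    (f : local_form E W) :
  (forall i, v 0 i = germ Wp (lform_values x WU f i)) ->
  value_form v = germ Wp (lform Psi WV f).
Proof.
move=> vf; rewrite /value_form; case: pselect => [h|[]]; last first.
  by exists (germ Wp (lform Psi WV f)), W, Wp, WU, WV, f.
move: (svalP (cid h)) => [W1 [W1p [W1U [W1V [f1 [vf1 tE]]]]]].
rewrite [LHS]tE; exact: value_germs_uniq vf1 vf.
Qed.

Lemma value_germs_lin a v v' : value_germs v -> value_germs v' ->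
  value_germs (a *: v + v') /\
  value_form (a *: v + v') = a * value_form v + value_form v'.
Proof.
move=> [W [Wp [WU [WV [f vf]]]]] [W' [W'p [W'U [W'V [f' vf']]]]].
have [T [Tp [s ->]]] := germ_surj a.
pose S := openI T (openI W W').
have ST : S `<=` T by apply: openI_subl.
have SWW : S `<=` openI W W' by apply: openI_subr.
have SW : S `<=` W by apply: subset_trans SWW (@openI_subl _ _ _).
have SW' : S `<=` W' by apply: subset_trans SWW (@openI_subr _ _ _).
have SU : S `<=` U by apply: subset_trans SW WU.
have SV : S `<=` V by apply: subset_trans SW WV.
have Sp : S p by [].
pose g := res ST s *: lform_restr SW f + lform_restr SW' f'.
have gE i : (germ Tp s *: v + v') 0 i = germ Sp (lform_values x SU g i).
  rewrite !mxE vf vf' -(germ_res ST Tp Sp) -(germ_res SW Wp Sp).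
  rewrite -(germ_res SW' W'p Sp) -rmorphM -rmorphD; congr (germ _ _).
  rewrite -(lform_values_restr x WU _ SW SU) -(lform_values_restr x W'U _ SW' SU).
  by rewrite /lform_values /= res_id.
split; first by exists S, Sp, SU, SV, g.
rewrite (value_formE SV gE) (value_formE WV vf).
rewrite (value_formE W'V vf') lform_lin rmorphD rmorphM /=.
rewrite (germ_res ST Tp Sp) -(bidual_form_res WV) -(bidual_form_res W'V).
by rewrite (germ_res SW Wp Sp) (germ_res SW' W'p Sp).
Qed.

Lemma value_germs_submodule : is_submodule value_germs.
Proof.
have K0 : value_germs 0.
  pose S := openI U V.
  have SU : S `<=` U by apply: openI_subl.
  have SV : S `<=` V by apply: openI_subr.
  have Sp : S p by [].
  by exists S, Sp, SU, SV, 0 => i; rewrite mxE rmorph0.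
split=> // [v v' Kv Kv'|a v Kv].
  by have [+ _] := value_germs_lin 1 Kv Kv'; rewrite scale1r.
by have [+ _] := value_germs_lin a Kv K0; rewrite addr0.
Qed.

(** A vector v with x0 v in the image is spread out to sections c near p. These respect every
    relation among the generators, since their multiples by x0 do and x0 is invertible at eta; so c
    defines a form. *)
Lemma value_germs_saturated z x0 : ribbon z x0 ->
  (forall U (Up : U p) (Ue : U eta) s,
     ~ (exists c, germ Up s = c * z) -> is_unit (germ Ue s)) ->
  saturated x0 value_germs.
Proof.
move=> rzx zu v [W [Wp [WU [WV [f vf]]]]].
have [T [Tp [s xs]]] := germ_surj x0.
have [T' [T'p [c vc]]] := germ_family (fun i => v 0 i).
pose S := openI T (openI T' W).
have ST : S `<=` T by apply: openI_subl.
have STW : S `<=` openI T' W by apply: openI_subr.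
have ST' : S `<=` T' by apply: subset_trans STW (@openI_subl _ _ _).
have SW : S `<=` W by apply: subset_trans STW (@openI_subr _ _ _).
have Sp : S p by [].
have [|Q [QS [Qp QE]]] := germ_family_eq
  (s := fun i => res ST s * res ST' (c i))
  (t := fun i => res SW (lform_values x WU f i)) (Uy := Sp).
  move=> i; rewrite rmorphM /= (germ_res ST Tp Sp) (germ_res ST' T'p Sp).
  by rewrite (germ_res SW Wp Sp) -xs -vc -vf mxE.
have QT : Q `<=` T by apply: subset_trans QS ST.
have QT' : Q `<=` T' by apply: subset_trans QS ST'.
have QW : Q `<=` W by apply: subset_trans QS SW.
have QU : Q `<=` U by apply: subset_trans QW WU.
have QV : Q `<=` V by apply: subset_trans QW WV.
have [|g gE] := local_form_of_values xgen QU (c := fun i => res QT' (c i)).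
  move=> D DQ DU r r0; apply: (sect_generic_zero gs) => De.
  have DT : D `<=` T by apply: subset_trans DQ QT.
  have DW : D `<=` W by apply: subset_trans DQ QW.
  have us : is_unit (germ De (res DT s)).
    have Te := DT _ De; rewrite (germ_res DT Te De).
    by apply: (zu _ Tp); rewrite -xs; apply: ribbon_generic_unit rzx.
  apply: (unit_cancel us); rewrite -rmorphM mulr_sumr.
  have := lform_valuesE x WU f DW DU r; rewrite r0 lform0E => fr.
  transitivity (germ De 0); last exact: rmorph0.
  congr (germ De _); apply: etrans (esym fr); apply: eq_bigr => i _; rewrite mulrCA.
  have DS : D `<=` S by apply: subset_trans DQ QS.
  have DT' : D `<=` T' by apply: subset_trans DQ QT'.
  congr (_ * _); have := congr1 (res DQ) (QE i).
  rewrite !(res_comp _ _ DS) rmorphM /= !(res_comp _ _ DT) !(res_comp _ _ DT').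
  by rewrite (res_comp _ _ DW).
exists Q, Qp, QU, QV, g => i; rewrite gE vc.
by rewrite (germ_res QT' T'p Qp).
Qed.

(* Extending Psi from the vectors of values at p to A^n gives the coefficients
   of m. On opens that avoid p the equality is checked at eta, where the form is
   a multiple of one defined near p. *)
Lemma local_bidual : exists W (WV : W `<=` V) (m : msect E W), W p /\
  forall (T : opens Y) (TW : T `<=` W) (TV : T `<=` V) (f : local_form E T),
    lform Psi TV f = lform f (@subset_refl _ T) (mres E TW m).
Proof.
have [z [x0 [rzx zu]]] := generic_ribbon gs p.
have accA := fg_acc (ribbon_noeth rzx) (fg_rV (stalk Y p) n).
have psil : linear_on value_germs value_form.
  by move=> a v v' Kv Kv'; have [] := value_germs_lin a Kv Kv'.
have [Phi Phil PhiK] := linear_on_extend rzx accA value_germs_submodule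
  (value_germs_saturated rzx zu) psil.
have [Ws [Wsp [s sE]]] := germ_family (fun i => Phi (delta_mx 0 i)).
pose W := openI Ws (openI U V).
have WWs : W `<=` Ws by apply: openI_subl.
have WUV : W `<=` openI U V by apply: openI_subr.
have WU : W `<=` U by apply: subset_trans WUV (@openI_subl _ _ _).
have WV : W `<=` V by apply: subset_trans WUV (@openI_subr _ _ _).
have Wp : W p by [].
pose m := \sum_i res WWs (s i) *: mres E WU (x i).
exists W, WV, m; split=> // T TW TV f.
have [Te|Te] := EM (T eta); last first.
  by apply: sect_empty => y Ty; apply: Te; apply: (generic_mem gs) Ty.
have TU : T `<=` U by apply: subset_trans TW WU.
(* The values h of G f are defined near p and give a form g there, with g = G f on S. The equality
   proved for g descends to f by cancelling G at eta. *)
have [N [Np [G [h [Gu Gh]]]]] := common_denominator gs Te (lform_values x TU f) p.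
pose W1 := openI W N.
have W1W : W1 `<=` W by apply: openI_subl.
have W1N : W1 `<=` N by apply: openI_subr.
have W1U : W1 `<=` U by apply: subset_trans W1W WU.
have W1V : W1 `<=` V by apply: subset_trans W1W WV.
have W1s : W1 `<=` Ws by apply: subset_trans W1W WWs.
have W1p : W1 p by [].
have W1e := generic_mem gs W1p; have Ne := generic_mem gs Np.
pose S := openI T W1.
have ST : S `<=` T by apply: openI_subl.
have SW1 : S `<=` W1 by apply: openI_subr.
have SN : S `<=` N by apply: subset_trans SW1 W1N.
have SU : S `<=` U by apply: subset_trans ST TU.
have SV : S `<=` V by apply: subset_trans ST TV.
have Se : S eta by [].
have hE i : res SN (h i) = res SN G * res ST (lform_values x TU f i).
  apply: (sect_generic_eq gs (Ve := Se)); rewrite rmorphM /=.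
  by rewrite !(germ_res SN Ne Se) (germ_res ST Te Se) Gh.
have [|g gE] := local_form_of_values xgen W1U (c := fun i => res W1N (h i)).
  move=> D DW1 DU r r0; apply: (sect_generic_zero gs) => De.
  pose D' := openI D S.
  have D'D : D' `<=` D by apply: openI_subl.
  have D'S : D' `<=` S by apply: openI_subr.
  have D'T : D' `<=` T by apply: subset_trans D'S ST.
  have D'N : D' `<=` N by apply: subset_trans D'S SN.
  have D'U : D' `<=` U by apply: subset_trans D'T TU.
  have DN : D `<=` N by apply: subset_trans DW1 W1N.
  have D'e : D' eta by [].
  rewrite -(germ_res D'D De D'e); transitivity (germ D'e 0); last exact: rmorph0.
  congr (germ _ _).
  transitivity (res D'N G * lform f D'T (mres E D'D (\sum_i r i *: mres E DU (x i)))).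
    rewrite mres_sum; under [in RHS]eq_bigr do rewrite (mres_comp _ _ D'U).
    rewrite (lform_valuesE x TU) rmorph_sum mulr_sumr; apply: eq_bigr => i _.
    rewrite rmorphM /= (res_comp _ _ DN) (res_comp _ _ D'N) mulrCA; congr (_ * _).
    rewrite -(res_comp SN D'S D'N (h i)) hE rmorphM /=.
    by rewrite (res_comp _ _ D'N) (res_comp _ _ D'T).
  by rewrite r0 mres0 lform0E mulr0.
pose v := \row_i germ W1p (lform_values x W1U g i).
have vg i : v 0 i = germ W1p (lform_values x W1U g i) by rewrite mxE.
have Kv : value_germs v by exists W1, W1p, W1U, W1V, g.
have gm : lform g (@subset_refl _ W1) (mres E W1W m) =
    \sum_i res W1s (s i) * lform_values x W1U g i.
  rewrite mres_sum; under eq_bigr do rewrite (mres_comp _ _ W1U) (res_comp _ _ W1s).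
  by rewrite (lform_valuesE x W1U); apply: eq_bigr => i _; rewrite res_id.
(* Since Phi extends [value_form], the germ of Psi (g) at p is the sum of Phi (e_i) g (x_i), and m
   has the Phi (e_i) as coefficients. *)
have Psig : germ W1p (lform Psi W1V g) =
    germ W1p (lform g (@subset_refl _ W1) (mres E W1W m)).
  rewrite -(value_formE W1V vg) -PhiK // (linear_on_rV _ Phil) gm.
  rewrite rmorph_sum; apply: eq_bigr => i _.
  by rewrite rmorphM /= (germ_res W1s Wsp W1p) -sE vg mulrC.
have {}Psig : lform Psi W1V g = lform g (@subset_refl _ W1) (mres E W1W m).
  by apply: (sect_generic_eq gs (Ve := W1e)); apply: (germ_generic_eq gs) Psig.
have gf : lform_restr SW1 g = res SN G *: lform_restr ST f.
  apply: (lform_values_inj xgen (WU := SU)) => i.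
  rewrite (lform_values_restr x W1U) gE (res_comp _ _ SN) hE.
  by rewrite -(lform_values_restr x TU _ ST SU) /lform_values /= res_id.
apply: (sect_generic_eq gs (Ve := Te)).
rewrite -!(germ_res ST Te Se); apply/subr0_eq/(unit_cancel (Gu Ne)).
rewrite -rmorphB -(germ_res SN Ne Se) -rmorphM; transitivity (germ Se 0); last exact: rmorph0.
congr (germ _ _); rewrite mulrBr; apply/eqP; rewrite subr_eq0; apply/eqP.
have := congr1 (res SW1) Psig; rewrite (bidual_form_res _ _ SV) gf.
rewrite (lform_res _ _ SW1) -(lform_restrE g SW1) gf.
have SW : S `<=` W by apply: subset_trans SW1 W1W.
rewrite (mres_comp _ _ SW) => H.
rewrite (bidual_form_res _ _ SV) (lform_res _ _ ST) (mres_comp _ _ SW) -(lform_restrE f ST).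
have PG : lform Psi SV (res SN G *: lform_restr ST f) =
    res SN G * lform Psi SV (lform_restr ST f).
  by rewrite -[_ *: lform_restr ST f]addr0 lform_lin lform0E addr0.
by rewrite -PG H /= res_id.
Qed.

End LocalBiduality.
End SheafReflexivity.

(** * Reflexive and torsion free coherent sheaves *)

Section CoherentSheaves.
Variables (k : fieldType) (Y : scheme k) (eta : Y).
Hypothesis gs : generic_structure eta.
Variable E : sheaf_of_modules Y.
Implicit Types U V W : opens Y.

Lemma sheaf_biduality_inj V (m m' : msect E V) : coherent E ->
  generic_torsion_free eta E ->
  sheaf_biduality m = sheaf_biduality m' -> m = m'.
Proof.
move=> Ecoh Etf mm'; apply/subr0_eq/(forms_separate gs Ecoh Etf) => W WV f.
have := congr1 (fun h : local_form (dual_sheaf E) V => lform h WV f) mm'; rewrite /= => fmm'.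
rewrite -scaleN1r addrC mresD mresZ rmorphN rmorph1 lform_lin.
by rewrite !(lform_irr f (@subset_refl _ W) (fun _ h => h)) fmm' mulN1r addNr.
Qed.

Lemma generic_torsion_free_reflexive : coherent E ->
  generic_torsion_free eta E -> reflexive_sheaf E.
Proof.
move=> Ecoh Etf V; apply: bijective_of_inj_surj => [m m'|Psi].
  exact: sheaf_biduality_inj.
have loc (q : {q | V q}) : {W : opens Y & {m : msect E W |
    exists WV : W `<=` V, W (sval q) /\
    forall (T : opens Y) (TW : T `<=` W) (TV : T `<=` V) (f : local_form E T),
      lform Psi TV f = lform f (@subset_refl _ T) (mres E TW m)}}.
  case: q => q Vq /=.
  have /cid [U /cid [n /cid [x [Uq xgen]]]] := coherent_generates Ecoh q.
  have /cid [W /cid [WV /cid [m [Wq mP]]]] := local_bidual gs Psi Vq Uq xgen.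
  by exists W, m, WV.
pose W q := projT1 (loc q); pose m q : msect E (W q) := sval (projT2 (loc q)).
have WV q : W q `<=` V by case: (svalP (projT2 (loc q))).
have Wmem q : W q (sval q) by case: (svalP (projT2 (loc q))) => ? [].
have mP q (T : opens Y) (TW : T `<=` W q) (TV : T `<=` V) (f : local_form E T) :
    lform Psi TV f = lform f (@subset_refl _ T) (mres E TW (m q)).
  by case: (svalP (projT2 (loc q))) => ? [_]; apply.
have cW : covers W V by move=> q Vq; exists (exist _ q Vq); apply: Wmem.
have [|M ME] := msect_glue E WV cW m.
  (* The local sections agree on overlaps because both represent Psi there and biduality is
     injective. *)
  move=> q q' S Sq Sq'; apply: sheaf_biduality_inj => //.
  apply: lform_eq => T TS f /=.
  have Tq : T `<=` W q by apply: subset_trans TS Sq.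
  have Tq' : T `<=` W q' by apply: subset_trans TS Sq'.
  have TV : T `<=` V by apply: subset_trans Tq (WV q).
  rewrite (mres_comp _ _ Tq) (mres_comp _ _ Tq').
  by rewrite !(lform_irr f _ (@subset_refl _ T)) -!(mP _ _ _ TV).
exists M; apply: lform_eq => T TV f /=; apply: sect_local => q Tq.
pose q' : {q | V q} := exist _ q (TV q Tq).
have ST : openI T (W q') `<=` T by apply: openI_subl.
have SW : openI T (W q') `<=` W q' by apply: openI_subr.
have SV : openI T (W q') `<=` V by apply: subset_trans ST TV.
exists (openI T (W q')), ST; split; first by split=> //; apply: (Wmem q').
rewrite (lform_res _ _ ST) (mres_comp _ _ SV) -(mres_comp (WV q') SW) ME.
rewrite (lform_res Psi _ SV ST) -(lform_restrE f ST).
by rewrite (mP q' _ SW).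
Qed.

(** An irreducible subset of S misses W, so its generic point is not eta; that point is closed, and
    the subset is reduced to it. *)
Lemma proper_closed_zero_dimensional (S : set Y) W : W eta ->
  (forall y, S y -> ~ W y) -> zero_dimensional S.
Proof.
move=> We SW F G _ _ Firr Girr FG.
have single (T : set Y) : T `<=` S -> irreducible T -> exists q, T = [set q].
  move=> TS Tirr; have [q qP] := irreducible_generic Tirr.
  have qe : q <> eta.
    move=> qe; have /qP [y [Ty Wy]] : W q by rewrite qe.
    exact: (SW y (TS y Ty)).
  have qc := generic_closed gs qe; exists q.
  have Tq : T `<=` [set q].
    move=> y Ty; apply: contrapT => yq.
    have : (Opens (closed_openC qc)) q by apply/qP; exists y.
    by apply.
  apply/seteqP; split=> // _ ->; have [[y Ty] _] := Tirr.
  by rewrite -(Tq y Ty).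
have [q qE] := single _ (@subIsetl _ S F) Firr.
have [q' qE'] := single _ (@subIsetl _ S G) Girr.
rewrite qE qE' in FG *; congr [set _].
exact: (FG q erefl).
Qed.

(** For y other than eta, {y} and S itself, irreducible because it contains eta, would be two nested
    irreducible closed subsets of S. *)
Lemma zero_dimensional_generic (S : set Y) : zero_dimensional S -> S eta ->
  forall y, S y -> y = eta.
Proof.
move=> S0 Se y Sy; apply: contrapT => ye.
have yc := generic_closed gs ye.
have yirr : irreducible (S `&` [set y]).
  split; first by exists y.
  move=> F G _ _ FG; have [Fy|Gy] := FG y (conj Sy erefl).
    by left=> _ [_ ->].
  by right=> _ [_ ->].
have Sirr : irreducible (S `&` setT).
  split; first by exists eta.
  have closed_eta (F : set Y) : closed F -> F eta -> S `&` setT `<=` F.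
    move=> Fc Fe t _; apply: contrapT => Ft.
    exact: (@generic_mem _ _ _ gs (Opens (closed_openC Fc)) t Ft).
  by move=> F G Fc Gc FG; have [Fe|Ge] := FG eta (conj Se I);
    [left; apply: closed_eta|right; apply: closed_eta].
have Sy_T : S `&` [set y] `<=` S `&` setT by move=> t [].
have := S0 _ _ yc closedT yirr Sirr Sy_T.
move=> /seteqP [_ /(_ eta (conj Se I)) [_ ey]].
by apply: ye; rewrite ey.
Qed.

(** Some y in U is off the support of F: eta, or else any other point, by
    [zero_dimensional_generic], and there is one because {eta} is not open. Then m vanishes near y,
    an open set that contains eta, so every form vanishes on m at eta, hence identically, and m = 0
    by injectivity of biduality. *)
Lemma reflexive_sheaf_torsion_free : reflexive_sheaf E -> torsion_free_sheaf E.
Proof.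
move=> Erefl F F0 U m Fm.
have [Ue|Ue] := EM (U eta); last first.
  by apply: msect_empty => y Uy; apply: Ue; apply: (generic_mem gs) Uy.
have [y Uy Fy] : exists2 y, U y & ~ support F y.
  have [Fe|Fe] := EM (support F eta); last by exists eta.
  have [y Uy ye] := generic_neq gs Ue; exists y => // Fy.
  exact: ye (zero_dimensional_generic F0 Fe Fy).
have [W [WU [Wy m0]]] : exists (W : opens Y) (WU : W `<=` U), W y /\ mres E WU m = 0.
  apply: contrapT => nW; apply: Fy; exists U, m; split=> // W WU Wy m0.
  by apply: nW; exists W, WU.
have We := generic_mem gs Wy.
apply: (bij_inj (Erefl U)); apply: lform_eq => V VU f /=.
rewrite mres0 lform0E; apply: (sect_generic_zero gs) => Ve.
have SV : openI V W `<=` V by apply: openI_subl.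
have SW : openI V W `<=` W by apply: openI_subr.
have SU : openI V W `<=` U by apply: subset_trans SW WU.
have Se : openI V W eta by [].
rewrite -(germ_res SV Ve Se) (lform_res _ _ SV) (mres_comp _ _ SU).
by rewrite -(mres_comp WU SW) m0 mres0 lform0E rmorph0.
Qed.

(* The sections that vanish on W form a subsheaf supported off W. *)
Lemma torsion_free_sheaf_generic :
  torsion_free_sheaf E -> generic_torsion_free eta E.
Proof.
move=> Etf V W WV m We m0.
have SU U : openI U W `<=` U by apply: openI_subl.
pose F0 U : set (msect E U) := [set n | mres E (SU U) n = 0].
have F_sub U : is_submodule (F0 U).
  split; rewrite /F0 /=; first exact: mres0.
    by move=> n n' n0 n0'; rewrite mresD n0 n0' addr0.
  by move=> a n n0; rewrite mresZ n0 scaler0.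
have F_res U U' (U'U : U' `<=` U) n : F0 U n -> F0 U' (mres E U'U n).
  rewrite /F0 /= => n0.
  have S'S : openI U' W `<=` openI U W by move=> y [/U'U].
  have S'U : openI U' W `<=` U by move=> y [/U'U].
  by rewrite (mres_comp _ _ S'U) -(mres_comp (SU U) S'S) n0 mres0.
have F_loc U (n : msect E U) : (forall y, U y -> exists (U' : opens Y)
    (U'U : U' `<=` U), U' y /\ F0 U' (mres E U'U n)) -> F0 U n.
  move=> loc; rewrite /F0 /=.
  pose I := {U' : opens Y | exists U'U : U' `<=` U, F0 U' (mres E U'U n)}.
  have TS (i : I) : openI (sval i) W `<=` openI U W.
    by case: (svalP i) => iU _ y [/iU].
  apply: (msect_ext E TS) => [y [Uy Wy]|i].
    have [U' [U'U [U'y F']]] := loc y Uy.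
    by exists (exist _ U' (ex_intro _ U'U F')).
  case: (svalP i) => iU Fi; rewrite mres0.
  have TU : openI (sval i) W `<=` U by move=> y [/iU].
  by rewrite (mres_comp _ _ TU) -Fi (mres_comp _ _ TU).
pose F := Subsheaf F_sub F_res F_loc.
apply: (Etf F).
  apply: (proper_closed_zero_dimensional We) => y [U [n [Uy Fn nz]]] Wy.
  exact: (nz (openI U W) (SU U) (conj Uy Wy)).
rewrite /= /F0 /=.
have SW : openI V W `<=` W by apply: openI_subr.
by rewrite -(mres_comp WV SW) m0 mres0.
Qed.

Theorem reflexive_sheaf_iff_torsion_free : coherent E ->
  reflexive_sheaf E <-> torsion_free_sheaf E.
Proof.
move=> Ecoh; split; first exact: reflexive_sheaf_torsion_free.
move=> /torsion_free_sheaf_generic; exact: generic_torsion_free_reflexive.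
Qed.

End CoherentSheaves.

Theorem mainTheorem7 (R : realType) (X C2 C : scheme R[i])
    (i : morphism C2 X) (j : morphism C C2)
    (hC2 : projective_primitive_double_curve i j) :
  (forall P : C, closed_point P ->
     forall M : lmodType (stalk C2 (j P)), fg_module M ->
     (reflexive_module M <-> torsion_free_module M)) /\
  (forall E : sheaf_of_modules C2, coherent E ->
     (reflexive_sheaf E <-> torsion_free_sheaf E)).
Proof.
split=> [P Pc M|E]; first exact: (stalk_reflexive_torsion_free hC2 Pc).
by have [eta gs] := double_generic hC2; apply: (reflexive_sheaf_iff_torsion_free gs).
Qed.
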